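(* Let $d\ge 2$, let $p$ be a homogeneous polynomial of degree $2$ on $\mathbb{R}^d$ with complex coefficients, and let $K(x)=p(x)|x|^{-d-2}$ for $x\in\mathbb{R}^d\setminus\{0\}$, where $\int_{\mathbb{S}^{d-1}}K\,ds=0$. Then there exists a compact convex set $\mathcal{C}\subset\mathbb{C}$ such that for any $\lambda\in\mathbb{C}\setminus\mathcal{C}$, any $N\in\mathbb{N}$ for which $\omega^N$ is non-empty, and any $F=(F_m)_{m\in\omega^N}\in\ell^2(\omega^N)$, the system $$\lambda u_m - N^{-d}\sum_{n\in\omega^N,\,n\ne m}K(x^N_m-x^N_n)\,u_n=F_m\qquad(m\in\omega^N)$$ has a unique solution $(u_m)_{m\in\omega^N}\in\ell^2(\omega^N)$, and, $T^N$ denoting the matrix of this system (so that the system reads $(\lambda I-T^N)U=F$), there is the uniform estimate in the operator norm of $\ell^2(\omega^N)$ $$\|(\lambda I-T^N)^{-1}\|\le \operatorname{dist}(\lambda,\mathcal{C})^{-1}.$$ Furthermore, the numerical range of the singular integral operator $A$ satisfies $W(A)\subset\mathcal{C}$.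
   Context: Let $\Omega\subset\mathbb{R}^d$ be an open set. For each positive integer $N$ fix an origin $a^N\in\mathbb{R}^d$ and put $x^N_m=a^N+\frac mN$ for $m\in\mathbb{Z}^d$ and $\omega^N=\{m\in\mathbb{Z}^d\mid x^N_m\in\Omega\}$. The matrix $T^N=(t^N_{mn})_{m,n\in\omega^N}$ has entries $t^N_{mn}=N^{-d}K(x^N_m-x^N_n)$ for $m\ne n$ and $t^N_{mm}=0$; it acts on $\ell^2(\omega^N)$. $A$ is the operator on $L^2(\mathbb{R}^d)$ of convolution with $K$ understood in the Cauchy principal value sense, $Au(x)=\mathrm{p.v.}\int_{\mathbb{R}^d}K(x-y)u(y)\,dy$ (by the condition $\int_{\mathbb{S}^{d-1}}K\,ds=0$ it is bounded on $L^2(\mathbb{R}^d)$). The numerical range of a bounded operator $B$ on a Hilbert space is $W(B)=\{(u,Bu)\mid \|u\|=1\}$. *)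

(* Defs.v *)
From HB Require Import structures.
From mathcomp Require Import all_boot all_order all_algebra.
From mathcomp Require Import complex.
From mathcomp Require Import all_classical all_reals all_analysis.
From mathcomp Require Import measurable_realfun.
From mathcomp Require Import(canonicals,coercions) mpoly.

Set Implicit Arguments.
Unset Strict Implicit.
Unset Printing Implicit Defensive.

Import Order.TTheory GRing.Theory Num.Theory.
Import numFieldNormedType.Exports.

Local Open Scope classical_set_scope.
Local Open Scope ring_scope.

Definition measure_row_display : measure_display -> measure_display.
Proof. exact. Qed.

Section measurable_row.
Context {d} {T : sigmaRingType d}.
Variable n : nat.

Let coords : 'I_n -> 'rV[T]_n -> T := fun i x => x ord0 i.

Let row_set0 : g_sigma_preimage coords set0.
Proof. exact: sigma_algebra0. Qed.

Let row_setC A : g_sigma_preimage coords A -> g_sigma_preimage coords (~` A).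
Proof. exact: sigma_algebraC. Qed.

Let row_bigcup (F : _^nat) : (forall i, g_sigma_preimage coords (F i)) ->
  g_sigma_preimage coords (\bigcup_i (F i)).
Proof. exact: sigma_algebra_bigcup. Qed.

HB.instance Definition _ := @isMeasurable.Build (measure_row_display d)
  'rV[T]_n (g_sigma_preimage coords) row_set0 row_setC row_bigcup.

End measurable_row.

Section measurable_row_theory.
Context d (T : measurableType d).

Lemma measurable_coord n (i : 'I_n) :
  measurable_fun [set: 'rV[T]_n] (fun x : 'rV[T]_n => x ord0 i).
Proof.
move=> _ Y mY; rewrite setTI; apply: sub_sigma_algebra => /=.
rewrite -bigcup_seq/=; exists i => /=; first by rewrite mem_index_enum.
by exists Y => //; rewrite setTI.
Qed.

Lemma measurable_fun_row d1 (T1 : measurableType d1) n (f : T1 -> 'rV[T]_n) :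
  (forall i, measurable_fun setT (fun x => f x ord0 i)) ->
  measurable_fun setT f.
Proof.
move=> mf _ A mA; rewrite setTI.
suff: (measurable : set (set 'rV[T]_n)) `<=` [set A | measurable (f @^-1` A)].
  exact.
apply: smallest_sub; first split => /=.
- by rewrite preimage_set0.
- by move=> B mB; rewrite setTD -preimage_setC; exact: measurableC.
- by move=> F mF; rewrite preimage_bigcup; exact: bigcup_measurable.
move=> B; rewrite -bigcup_seq => -[i _ [Y mY <-]] /=.
by rewrite setTI -[X in measurable X]setTI; exact: mf.
Qed.

End measurable_row_theory.


Section lebesgue.
Variable R : realType.

Definition row_cons n (xy : R * 'rV[R]_n) : 'rV[R]_n.+1 :=
  row_mx (const_mx xy.1 : 'rV_1) xy.2.

Lemma measurable_row_cons n : measurable_fun setT (@row_cons n).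
Proof.
apply: measurable_fun_row => i.
case: (@split_ordP 1 n i) => j ->.
  rewrite (_ : (fun _ => _) = fst); first exact: measurable_fst.
  by apply/funext => x; rewrite /row_cons [LHS]row_mxEl mxE.
rewrite (_ : (fun _ => _) = (fun y : 'rV[R]_n => y ord0 j) \o snd).
  exact: (measurableT_comp (measurable_coord j) measurable_snd).
by apply/funext => x; rewrite /row_cons [LHS]row_mxEr.
Qed.

Lemma row_cons0 n (x : R * 'rV[R]_n) : row_cons x ord0 ord0 = x.1.
Proof.
have -> : (ord0 : 'I_n.+1) = lshift n (ord0 : 'I_1) by exact/val_inj.
by rewrite [LHS]row_mxEl mxE.
Qed.

Lemma row_consS n (x : R * 'rV[R]_n) j :
  row_cons x ord0 (lift ord0 j) = x.2 ord0 j.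
Proof.
have -> : lift ord0 j = rshift 1 j by exact/val_inj.
by rewrite [LHS]row_mxEr.
Qed.

Section lebesgue_succ.
Variables (n : nat) (mu : {sigma_finite_measure set 'rV[R]_n -> \bar R}).
Local Open Scope ereal_scope.

Definition lebesgue_succ : set 'rV[R]_n.+1 -> \bar R :=
  pushforward (@lebesgue_measure R \x mu) (@row_cons n).

Let lebesgue_succ0 : lebesgue_succ set0 = 0.
Proof. by rewrite /lebesgue_succ /pushforward preimage_set0 measure0. Qed.

Let lebesgue_succ_ge0 A : 0 <= lebesgue_succ A.
Proof. by rewrite /lebesgue_succ /pushforward; exact: measure_ge0. Qed.

Let lebesgue_succ_sigma_additive : semi_sigma_additive lebesgue_succ.
Proof.
have mc A : measurable A -> measurable (@row_cons n @^-1` A).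
  by move=> mA; rewrite -[X in measurable X]setTI; exact: measurable_row_cons.
move=> F mF tF mUF; rewrite /lebesgue_succ /pushforward preimage_bigcup.
apply: measure_semi_sigma_additive.
- by move=> k; exact: mc.
- apply/trivIsetP => /= i j _ _ ij; rewrite -preimage_setI.
  by move/trivIsetP : tF => /(_ _ _ _ _ ij) ->//; rewrite preimage_set0.
- by rewrite -preimage_bigcup; exact: mc.
Qed.

HB.instance Definition _ := isMeasure.Build _ _ _ lebesgue_succ
  lebesgue_succ0 lebesgue_succ_ge0 lebesgue_succ_sigma_additive.

Let row_uncons (x : 'rV[R]_n.+1) : R * 'rV[R]_n :=
  (x ord0 ord0, \row_j x ord0 (lift ord0 j)).

Let row_consK : cancel (@row_cons n) row_uncons.
Proof.
move=> x; rewrite /row_uncons row_cons0 [RHS]surjective_pairing; congr pair.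
by apply/rowP => j; rewrite mxE row_consS.
Qed.

Let measurable_row_uncons : measurable_fun setT row_uncons.
Proof.
apply/measurable_fun_pair; first exact: measurable_coord.
apply: measurable_fun_row => i; under eq_fun do rewrite mxE.
exact: measurable_coord.
Qed.

Let lebesgue_succ_sigma_finite : sigma_finite setT lebesgue_succ.
Proof.
have /sigma_finiteP[F [TF ndF Foo]] := sigma_finiteT (@lebesgue_measure R).
have /sigma_finiteP[G [TG ndG Goo]] := sigma_finiteT mu.
exists (fun k => row_uncons @^-1` (F k `*` G k)).
  apply/seteqP; split => // x _.
  have [k _ Fk] : (\bigcup_i F i) (row_uncons x).1 by rewrite -TF.
  have [l _ Gl] : (\bigcup_i G i) (row_uncons x).2 by rewrite -TG.
  exists (maxn k l) => //; split.
    by move: Fk; exact/subsetPset/ndF/leq_maxl.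
  by move: Gl; exact/subsetPset/ndG/leq_maxr.
move=> k; have [mF Fk] := Foo k; have [mG Gk] := Goo k; split.
  rewrite -[X in measurable X]setTI; apply: measurable_row_uncons => //.
  exact: measurableX.
rewrite /lebesgue_succ /pushforward -comp_preimage.
rewrite (_ : _ \o _ = id); last by apply/funext => x; exact: row_consK.
by rewrite product_measure1E// lte_mul_pinfty// ge0_fin_numE.
Qed.

HB.instance Definition _ := Measure_isSigmaFinite.Build _ _ _ lebesgue_succ
  lebesgue_succ_sigma_finite.

End lebesgue_succ.

Fixpoint lebesgue_row n : {sigma_finite_measure set 'rV[R]_n -> \bar R} :=
  match n with
  | 0%N => \d_(0 : 'rV[R]_0)
  | m.+1 => lebesgue_succ (lebesgue_row m)
  end.
End lebesgue.

Section euclidean.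
Variable R : realType.

(* The norm that the library puts on 'rV[R]_n is the sup norm. *)
Definition enorm n (x : 'rV[R]_n) : R := Num.sqrt (\sum_i x ord0 i ^+ 2).

Lemma measurable_enorm n : measurable_fun setT (@enorm n).
Proof.
apply: (measurableT_comp (continuous_measurable_fun (@sqrt_continuous R))).
apply: measurable_sum => i; apply: measurable_funX; exact: measurable_coord.
Qed.

Lemma lebesgue_row_box n (a b : 'rV[R]_n) :
  (forall i, a ord0 i <= b ord0 i) ->
  lebesgue_row R n [set x | forall i, a ord0 i <= x ord0 i <= b ord0 i] =
  (\prod_i (b ord0 i - a ord0 i))%:E.
Proof.
elim: n a b => [|n IH] a b ab.
  rewrite big_ord0 /= diracE mem_set// => i; by case: i.
pose tl (x : 'rV[R]_n.+1) : 'rV[R]_n := \row_j x ord0 (lift ord0 j).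
have mbox : measurable [set x : 'rV[R]_n |
    forall i, tl a ord0 i <= x ord0 i <= tl b ord0 i].
  rewrite (_ : [set _ | _] = \bigcap_(i in [set: 'I_n])
      (fun x : 'rV[R]_n => x ord0 i) @^-1` `[tl a ord0 i, tl b ord0 i]).
    apply: fin_bigcap_measurable => // i _.
    by rewrite -[X in measurable X]setTI; exact: measurable_coord.
  apply/seteqP; split => x /= xab i; last by have := xab i I; rewrite /= in_itv.
  by move=> _; rewrite /= in_itv /=; exact: xab.
transitivity ((@lebesgue_measure R \x lebesgue_row R n)%E
    (`[a ord0 ord0, b ord0 ord0]%classic `*` [set x : 'rV[R]_n |
      forall i, tl a ord0 i <= x ord0 i <= tl b ord0 i])).
  congr ((@lebesgue_measure R \x lebesgue_row R n)%E _).
  apply/seteqP; split => x /=.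
    move=> xab; split; first by rewrite /= in_itv /= -(row_cons0 x); exact: xab.
    by move=> j /=; rewrite !mxE -(row_consS x); exact: xab.
  move=> [x0 xS] i; case: (unliftP ord0 i) => [j ->|->].
    by rewrite row_consS; have := xS j; rewrite !mxE.
  by rewrite row_cons0; move: x0; rewrite /= in_itv.
rewrite product_measure1E// IH; last by move=> i; rewrite !mxE.
rewrite big_ord_recl EFinM; congr (_ * _)%E.
  rewrite [LHS](@lebesgue_measure_itv R) /= lte_fin.
  by case: ltgtP (ab ord0) => // -> _; rewrite subrr.
by congr EFin; apply: eq_bigr => i _; rewrite !mxE.
Qed.

Section surface_measure.
Variable n : nat.
Local Open Scope ereal_scope.

(* The surface measure of the unit sphere, as n times the Lebesgue measure of the
   cone over E: s(E) = n * |{t *: y | 0 < t <= 1, y \in E, |y| = 1}|. *)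
Definition surface_measure (E : set 'rV[R]_n) : \bar R :=
  n%:R%:E * lebesgue_row R n
    [set x | (0 < enorm x <= 1)%R /\ E ((enorm x)^-1 *: x)%R].

Let cone (E : set 'rV[R]_n) : set 'rV[R]_n :=
  [set x | (0 < enorm x <= 1)%R] `&` (fun x => (enorm x)^-1 *: x)%R @^-1` E.

Let measurable_cone E : measurable E -> measurable (cone E).
Proof.
move=> mE; apply: measurableI.
  rewrite (_ : [set _ | _] = @enorm n @^-1` `]0%R, 1%R]).
    by rewrite -[X in measurable X]setTI; exact: measurable_enorm.
  by apply/seteqP; split => x /=; rewrite in_itv.
rewrite -[X in measurable X]setTI.
suff: measurable_fun setT (fun x : 'rV[R]_n => (enorm x)^-1 *: x)%R by exact.
apply: measurable_fun_row => i; under eq_fun do rewrite mxE.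
apply: measurable_funM; last exact: measurable_coord.
under eq_fun do rewrite -powR_inv1 ?sqrtr_ge0//.
exact: (measurableT_comp (@measurable_powR R (-1)) (@measurable_enorm n)).
Qed.

Let surface_measure0 : surface_measure set0 = 0.
Proof.
rewrite /surface_measure (_ : [set _ | _] = set0) ?measure0 ?mule0//.
by apply/seteqP; split => x // -[].
Qed.

Let surface_measure_ge0 E : 0 <= surface_measure E.
Proof. by rewrite mule_ge0// lee_fin. Qed.

Let surface_measure_sigma_additive : semi_sigma_additive surface_measure.
Proof.
move=> F mF tF mUF.
have sE E : surface_measure E = n%:R%:E * lebesgue_row R n (cone E) by [].
have coneU : cone (\bigcup_k F k) = \bigcup_k cone (F k).
  apply/seteqP; split => x; first by move=> [x1 [k _ Fkx]]; exists k.
  by move=> [k _ [x1 Fkx]]; split => //; exists k.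
rewrite sE coneU [X in X @ \oo --> _](_ : _ =
    fun m => n%:R%:E * \sum_(0 <= k < m) lebesgue_row R n (cone (F k))); last first.
  by apply/funext => k; rewrite ge0_sume_distrr.
apply: cvgeZl => //; apply: measure_semi_sigma_additive.
- by move=> k; exact: measurable_cone.
- apply/trivIsetP => i j _ _ ij; apply/seteqP; split => // x [[_ Fi] [_ Fj]].
  move/trivIsetP : tF => /(_ i j Logic.I Logic.I ij)/seteqP[FiFj _].
  exact: (FiFj _ (conj Fi Fj)).
- by rewrite -coneU; exact: measurable_cone.
Qed.

HB.instance Definition _ := isMeasure.Build _ _ _ surface_measure
  surface_measure0 surface_measure_ge0 surface_measure_sigma_additive.

End surface_measure.
End euclidean.

Local Notation normc := ComplexField.Normc.normc.

Section complex_L2.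
Context d (T : measurableType d) (R : realType).
Variable mu : {measure set T -> \bar R}.

Definition cintegral (D : set T) (f : T -> R[i]) : R[i] :=
  (\int[mu]_(x in D) complex.Re (f x) +i*
   \int[mu]_(x in D) complex.Im (f x))%C.

Definition cmeasurable (f : T -> R[i]) :=
  measurable_fun setT (fun x => complex.Re (f x)) /\
  measurable_fun setT (fun x => complex.Im (f x)).

Definition L2norm (f : T -> R[i]) : \bar R :=
  Lnorm mu 2%:E (fun x => (normc (f x))%:E).

Definition L2 (f : T -> R[i]) := cmeasurable f /\ (L2norm f < +oo)%E.

(* Linear in the second argument, so that the numerical range of z * id
   is {z}. *)
Definition L2inner (u v : T -> R[i]) : R[i] :=
  cintegral setT (fun x => (u x)^*%C * v x).

(* An operator on L^2 is given by its graph on representatives: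
   A u v means that v is a representative of the image of u. *)
Definition numerical_range (A : (T -> R[i]) -> (T -> R[i]) -> Prop) :
    set R[i] :=
  [set z | exists u v, [/\ L2 u, L2 v, L2norm u = 1%E, A u v & z = L2inner u v]].

End complex_L2.

Section singular_integral.
Context (R : realType) (d : nat).
Local Notation leb := (lebesgue_row R d).

Definition truncated_integral (K u : 'rV[R]_d -> R[i]) (x : 'rV[R]_d) (e : R) :
    R[i] :=
  cintegral leb [set y | e < enorm (x - y)] (fun y => K (x - y) * u y).

Definition is_pv (K u : 'rV[R]_d -> R[i]) (x : 'rV[R]_d) (z : R[i]) :=
  truncated_integral K u x e @[e --> 0^'+] --> (z : (R[i])^o).

Definition singular_integral (K u v : 'rV[R]_d -> R[i]) :=
  {ae leb, forall x, is_pv K u x (v x)}.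

(* The value at 0, which is 0 / 0 = 0, is irrelevant. *)
Definition hkernel (p : mpoly.mpoly d R[i]) (x : 'rV[R]_d) : R[i] :=
  mpoly.meval (fun i => (x ord0 i)%:C%C) p / (enorm x ^+ (d + 2))%:C%C.

End singular_integral.

Section complex_l2.
Context (R : realType) (I : choiceType).
Implicit Types (D : set I) (u : I -> R[i]).

Definition rsum D (f : I -> R) : R :=
  fine (\esum_(i in D) ((fun j => (f j)%:E)^\+ i)%E) -
  fine (\esum_(i in D) ((fun j => (f j)%:E)^\- i)%E).

(* Sum of an absolutely summable family (a junk value otherwise). *)
Definition csum D u : R[i] :=
  (rsum D (fun i => complex.Re (u i)) +i* rsum D (fun i => complex.Im (u i)))%C.

Definition l2norm u : \bar R :=
  sqrte (\esum_(i in [set: I]) (normc (u i) ^+ 2)%:E).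

Definition l2 u := (l2norm u < +oo)%E.

Definition matrix_op (t : I -> I -> R[i]) u : I -> R[i] :=
  fun i => csum setT (fun j => t i j * u j).

(* Functions on all families stand for operators on l2: only their values on
   l2 matter. *)
Definition l2_opnorm (S : (I -> R[i]) -> (I -> R[i])) : \bar R :=
  ereal_sup [set l2norm (S u) | u in [set u | (l2norm u <= 1)%E]].

Definition l2_inverse (L S : (I -> R[i]) -> (I -> R[i])) :=
  (forall u, l2 u -> l2 (L u) /\ S (L u) = u) /\
  (forall u, l2 u -> l2 (S u) /\ L (S u) = u).

End complex_l2.

Definition cdist (R : realType) (z : R[i]) (C : set R[i]) : R :=
  inf [set normc (z - w) | w in C].

Section discretization.
Context (R : realType) (d : nat).
Variables (Omega : set 'rV[R]_d) (a : nat -> 'rV[R]_d).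

Definition grid_point (N : nat) (m : 'rV[int]_d) : 'rV[R]_d :=
  a N + N%:R^-1 *: map_mx intr m.

Definition grid_index (N : nat) : set 'rV[int]_d :=
  [set m | Omega (grid_point N m)].

Definition grid_matrix (K : 'rV[R]_d -> R[i]) (N : nat) (m n : grid_index N) :
    R[i] :=
  if m == n then 0
  else (N%:R ^- d)%:C%C * K (grid_point N (val m) - grid_point N (val n)).

End discretization.
Arguments grid_matrix {R d} Omega a K N m n.

(* Main.v *)
(* The set C may be a disc of large radius r around 0: it suffices that every
   T^N has norm at most r and that |(u, Au)| <= r for unit vectors u, since then
   the Neumann series bounds the resolvent by 1 / (|lambda| - r), and |lambda| - r
   is the distance from lambda to the disc.

   The real and imaginary parts of p are quadratic forms, and by the symmetries
   of the sphere the spherical mean of a quadratic form is a multiple of its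
   trace, so both traces vanish. For a quadratic form q of trace 0, the regularized
   kernel K_e(x) = q(x) / max(|x|, e)^(d+2) is a sum of dyadic pieces
   K_e - K_8e, K_8e - K_64e, ...; these are even, have integral 0, and are
   bounded and Lipschitz uniformly up to scaling. Convolution with them therefore
   gives commuting symmetric operators whose products decay geometrically in the
   difference of the scales, and a Cotlar-Stein argument bounds the sum on L^2
   uniformly in e. Replacing max(|x|, e) by a sharp cut-off changes the kernel by
   a bounded multiple of an approximate unit, and Fatou's lemma passes to the
   principal value.

   By homogeneity N^-d K(x_m - x_n) = K(m - n), so that T^N is a section of one
   matrix. It is compared with K_1 acting on functions that are constant on cubes
   attached to the lattice points: the difference is O(|m - n|^(-d-1)), which
   is summable. *)
From HB Require Import structures.
Require Import Defs.
From mathcomp Require Import all_boot all_order all_algebra.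
From mathcomp Require Import complex.
From mathcomp Require Import all_classical all_reals all_analysis.
From mathcomp Require Import measurable_realfun perm.
From mathcomp Require Import(canonicals,coercions) mpoly.
From mathcomp Require Import ring lra zify.

Set Implicit Arguments.
Unset Strict Implicit.
Unset Printing Implicit Defensive.

Import Order.TTheory GRing.Theory Num.Theory.
Import numFieldNormedType.Exports.

Local Open Scope classical_set_scope.
Local Open Scope ring_scope.

Local Notation normc := ComplexField.Normc.normc.

(** * Commuting families: the Cotlar-Stein bound *)

(** The analysis is real and elementary: K is split into real and imaginary part, there is no
    Fourier transform, and L^2 norms enter only through a positive semidefinite form, with the
    arithmetic-geometric mean inequality in place of Cauchy-Schwarz.

    The usual Cotlar-Stein proof takes high powers of an operator and lets the exponent tend to
    infinity. For commuting symmetric T_j with sum T, the square T^2 is enough: |T^2 u|^2 is a sum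
    over four indices that may be permuted freely, which bounds it by the square function, the sum
    of the |T_j u|^2; this in turn bounds itself. Sharing the decay of a term among three pairs of
    indices costs a cube, and the ratio 8 = 2^3 between successive scales pays for it.

    The cut-off max(|x|, e) comes before the sharp one because it keeps the kernel Lipschitz. This
    serves twice: for the cancellation between different scales, and for the comparison of the
    lattice with the continuum. Polar coordinates are avoided; negative powers of the norm are
    integrated over growing cubes. *)

Lemma sum_half_distn (R : realFieldType) (j n : nat) :
  \sum_(l < n) 2^-1 ^+ `|j - l|%N <= 3 :> R.
Proof.
have pow_gt0 k : 0 < 2^-1 ^+ k :> R by rewrite exprn_gt0 ?invr_gt0 ?ltr0n.
(* The terms to the left of j sum to at most 1 and those from j on to at most 2; keeping the last
   term in the bound lets the induction on n close. *)
suff [le_nj gt_nj] : ((n <= j)%N -> \sum_(l < n) 2^-1 ^+ `|j - l|%N <= 2^-1 ^+ (j - n) :> R) /\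
    ((j < n)%N -> \sum_(l < n) 2^-1 ^+ `|j - l|%N <= 3 - 2^-1 ^+ (n - j.+1) :> R).
  have [jn|nj] := ltnP j n.
    by apply: le_trans (gt_nj jn) _; rewrite gerBl ltW.
  apply: le_trans (le_nj nj) _; apply: (@le_trans _ _ 1); last by rewrite ler1n.
  by rewrite exprn_ile1 ?invr_ge0 ?invf_le1 ?ler0n ?ler1n ?ltr0n.
elim: n => [|n [IH1 IH2]]; first by split => // _; rewrite big_ord0 ltW.
have half k : 2^-1 ^+ k = 2^-1 ^+ k.+1 + 2^-1 ^+ k.+1 :> R.
  by rewrite exprS; lra.
split => [nj|jn]; rewrite big_ord_recr /=.
  rewrite distnEl; last by lia.
  have := IH1 (ltnW nj); have -> : (j - n = (j - n.+1).+1)%N by lia.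
  by rewrite [in X in _ -> X](half (j - n.+1)%N) => h; rewrite lerD2r.
have [lt_jn|] := ltnP j n.
  have := IH2 lt_jn; rewrite distnEr; last by lia.
  have -> : (n.+1 - j.+1 = (n - j.+1).+1)%N by lia.
  have -> : (n - j = (n - j.+1).+1)%N by lia.
  by rewrite (half (n - j.+1)%N); lra.
move=> le_nj; have e : j = n by lia.
by move: (IH1 le_nj); rewrite e distnn !subnn expr0; lra.
Qed.

Section commuting_cotlar_stein.
Variables (R : realFieldType) (V : lmodType R) (B : V -> V -> R).
Hypotheses (BC : forall u v, B u v = B v u)
  (BD : forall u v w, B (u + v) w = B u w + B v w)
  (BZ : forall a u v, B (a *: u) v = a * B u v)
  (B0 : forall u, 0 <= B u u).

Lemma form_sumr (I : Type) (s : seq I) (F : I -> V) v :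
  B v (\sum_(i <- s) F i) = \sum_(i <- s) B v (F i).
Proof.
apply: (big_morph (B v)) => [x y|]; first by rewrite ![B v _]BC BD.
by rewrite BC -[0 in LHS](scale0r 0) BZ mul0r.
Qed.

Lemma form_suml (I : Type) (s : seq I) (F : I -> V) v :
  B (\sum_(i <- s) F i) v = \sum_(i <- s) B (F i) v.
Proof. by rewrite BC form_sumr; apply: eq_bigr => i _; rewrite BC. Qed.

Let BZr a u v : B u (a *: v) = a * B u v. Proof. by rewrite ![B u _]BC BZ. Qed.

(** Expand the form at s x - y and divide by s. The weight s is free and is chosen at each use, so
    that no square roots are needed. *)
Lemma form_amgm (s : R) x y : 0 < s -> 2 * B x y <= s * B x x + s^-1 * B y y.
Proof.
move=> s0; have := B0 (s *: x + (-1) *: y).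
have BDr u v w : B u (v + w) = B u v + B u w by rewrite ![B u _]BC BD.
rewrite !(BD, BDr, BZ, BZr) (BC y x) => h.
rewrite -(ler_pM2l s0) mulrDr mulVKf ?gt_eqF//; lra.
Qed.

(** For v = a^-1 f u, half of the left side is absorbed by the last term on the right. *)
Lemma form_bound (f : V -> V) (a : R) u : 0 < a ->
  (forall v, `|B (f u) v| <= a * (B u u + B v v) / 2) ->
  B (f u) (f u) <= a ^+ 2 * B u u.
Proof.
move=> a0 /(_ (a^-1 *: f u)); rewrite !BZr !BZ => /ler_normlW h.
have := ler_wpM2l (ltW a0) h; rewrite mulVKf ?gt_eqF//.
have -> : a * (a * (B u u + a^-1 * (a^-1 * B (f u) (f u))) / 2) =
  (a ^+ 2 * B u u + B (f u) (f u)) / 2 by field; exact: lt0r_neq0.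
lra.
Qed.

Variables (T : nat -> V -> V) (c : R).
Hypotheses (TD : forall j u v, T j (u + v) = T j u + T j v)
  (Tsym : forall j u v, B (T j u) v = B u (T j v))
  (Tcom : forall j k u, T j (T k u) = T k (T j u))
  (c0 : 0 < c)
  (Tbound : forall j k u, B (T j (T k u)) (T j (T k u)) <=
     (c * (2^-1 ^+ `|j - k|%N) ^+ 3) ^+ 2 * B u u).

Let b (j k : nat) : R := 2^-1 ^+ `|j - k|%N.
Let b_gt0 j k : 0 < b j k. Proof. by rewrite exprn_gt0 ?invr_gt0 ?ltr0n. Qed.
Let b_le1 j k : b j k <= 1.
Proof. by rewrite exprn_ile1 ?invr_ge0 ?invf_le1 ?ler0n ?ler1n ?ltr0n. Qed.
Let a_gt0 j k : 0 < c * b j k ^+ 3. Proof. exact/mulr_gt0/exprn_gt0/b_gt0. Qed.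
Let bC j k : b j k = b k j. Proof. by rewrite /b distnC. Qed.
Let nrm u j := B (T j u) (T j u).

Let T_sum n j (F : 'I_n -> V) : T j (\sum_(i < n) F i) = \sum_(i < n) T j (F i).
Proof.
apply: (big_morph (T j)) => //; apply: (@addrI _ (T j 0)).
by rewrite -TD !addr0.
Qed.

(** Moving [T l] to the left gives the product [T j (T k _)] at [T l u], whose norm [Tbound]
    controls; the weight in [form_amgm] balances the two sides. *)
Let quad u j k l m : B (T j (T k u)) (T l (T m u)) <=
  c * b j k ^+ 3 * (nrm u l + nrm u m) / 2.
Proof.
rewrite -Tsym; have -> : T l (T j (T k u)) = T j (T k (T l u)).
  by rewrite Tcom (Tcom l).
have a0 := a_gt0 j k.
have := form_amgm (T j (T k (T l u))) (T m u) (_ : 0 < (c * b j k ^+ 3)^-1).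
rewrite invr_gt0 => /(_ a0); rewrite invrK => h.
rewrite -(ler_pM2l (_ : 0 < 2)) ?ltr0n// mulrCA divff ?pnatr_eq0// mulr1.
apply: le_trans h _; rewrite mulrDr lerD2r.
rewrite ler_pdivrMl// mulrA -expr2; exact: Tbound.
Qed.

(** With Q the sum of the T_j^2, the left side S equals <Q u, u>, and |Q u|^2 is the sum of all |T_j
    T_k u|^2, at most 3 c S by the decay. The weight (3 c)^-1 then gives 2 S <= S + 3 c |u|^2, where
    S can be subtracted. *)
Lemma square_function_bound n u :
  \sum_(j < n) B (T j u) (T j u) <= 3 * c * B u u.
Proof.
set S := \sum_(j < n) _.
have S_le : B (\sum_(j < n) T j (T j u)) (\sum_(j < n) T j (T j u)) <= 3 * c * S.
  have -> : B (\sum_(j < n) T j (T j u)) (\sum_(j < n) T j (T j u)) =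
     \sum_(j < n) \sum_(k < n) B (T j (T k u)) (T j (T k u)).
    rewrite form_suml; apply: eq_bigr => j _; rewrite form_sumr.
    apply: eq_bigr => k _.
    by rewrite Tsym (Tcom j k (T k u)) -Tsym (Tcom k j u).
  have {1}-> : S = 2^-1 * (S + S) by lra.
  apply: (@le_trans _ _ (\sum_(j < n) \sum_(k < n)
      c * b j k * (nrm u j + nrm u k) / 2)).
    apply: ler_sum => j _; apply: ler_sum => k _.
    apply: le_trans (quad u j k j k) _; rewrite ler_pM2r ?invr_gt0 ?ltr0n//.
    rewrite ler_wpM2r ?addr_ge0 ?B0//  ler_pM2l//.
    rewrite exprS ler_piMr//; first exact/ltW/b_gt0.
    by apply: exprn_ile1; rewrite ?b_le1// ltW.
  have bsum j : \sum_(k < n) b j k <= 3 by exact: sum_half_distn.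
  have half : \sum_(j < n) \sum_(k < n) b j k * nrm u j <= 3 * S.
    rewrite mulr_sumr; apply: ler_sum => j _; rewrite -mulr_suml.
    by rewrite ler_wpM2r ?B0.
  have half' : \sum_(j < n) \sum_(k < n) b j k * nrm u k <= 3 * S.
    rewrite exchange_big /=; apply: le_trans half; apply: ler_sum => j _.
    by apply: ler_sum => k _; rewrite bC.
  have -> : \sum_(j < n) \sum_(k < n) c * b j k * (nrm u j + nrm u k) / 2 =
      c / 2 * (\sum_(j < n) \sum_(k < n) b j k * nrm u j +
       \sum_(j < n) \sum_(k < n) b j k * nrm u k).
    rewrite -big_split /= mulr_sumr; apply: eq_bigr => j _.
    rewrite -big_split /= mulr_sumr; apply: eq_bigr => k _; lra.
  have : c / 2 * (\sum_(j < n) \sum_(k < n) b j k * nrm u j +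
       \sum_(j < n) \sum_(k < n) b j k * nrm u k) <= c / 2 * (3 * S + 3 * S).
    by rewrite ler_pM2l ?divr_gt0 ?ltr0n// lerD.
  by move=> h; apply: le_trans h _; lra.
have SE : B (\sum_(j < n) T j (T j u)) u = S.
  by rewrite form_suml; apply: eq_bigr => j _; rewrite Tsym.
have k0 : 0 < 3 * c by rewrite mulr_gt0.
have k1 : 0 < (3 * c)^-1 by rewrite invr_gt0.
have := form_amgm (\sum_(j < n) T j (T j u)) u k1.
rewrite SE invrK.
have : (3 * c)^-1 * B (\sum_(j < n) T j (T j u)) (\sum_(j < n) T j (T j u)) <= S.
  by rewrite ler_pdivrMl.
lra.
Qed.

(* Every 4-fold term is controlled by each of its pairs, so its decay may be
   shared among the three pairs containing the first index. *)
Let quad_decay u j k l m : B (T j (T k u)) (T l (T m u)) <=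
  c * (b j k * b j l * b j m) * (nrm u j + nrm u k + nrm u l + nrm u m).
Proof.
have n0 i : 0 <= nrm u i by exact: B0.
(* The value depends only on the multiset of the four indices, so the decay of any pair is
   available. *)
have perm1 i1 i2 i3 i4 :
    B (T i1 (T i2 u)) (T i3 (T i4 u)) = B (T i1 (T i3 u)) (T i2 (T i4 u)).
  by rewrite (Tcom i1 i2 u) Tsym (Tcom i2 i3) -Tsym (Tcom i3 i1).
have perm2 : B (T j (T k u)) (T l (T m u)) = B (T j (T m u)) (T l (T k u)).
  by rewrite (Tcom l m) perm1 (Tcom k l).
set s := nrm u j + _ + _ + _.
have le_s (x y : R) : x + y <= s -> 0 <= x + y -> (x + y) / 2 <= s by lra.
have [h1 h2 h3] : [/\ B (T j (T k u)) (T l (T m u)) <= c * b j k ^+ 3 * s,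
   B (T j (T k u)) (T l (T m u)) <= c * b j l ^+ 3 * s &
   B (T j (T k u)) (T l (T m u)) <= c * b j m ^+ 3 * s].
  have := (n0 j, n0 k, n0 l, n0 m) => -[[[n1 n2] n3] n4].
  split; [|rewrite (perm1 j)|rewrite perm2]; apply: le_trans (quad _ _ _ _ _) _;
    by rewrite -mulrA ler_pM2l// /s; lra.
have s0 : 0 <= s by rewrite !addr_ge0.
(* The cube of the smallest of three positive numbers is at most their product, so the pair with the
   smallest [b] gives the claim. *)
have min3 (x y z : R) : 0 < x -> 0 < y -> 0 < z ->
    [\/ x ^+ 3 <= x * y * z, y ^+ 3 <= x * y * z | z ^+ 3 <= x * y * z].
  have min1 r s' t : 0 < r -> r <= s' -> r <= t -> r ^+ 3 <= r * s' * t.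
    move=> r0 rs rt; rewrite exprSr expr2.
    by apply: ler_pM => //; [rewrite mulr_ge0 ?ltW|exact: ltW|rewrite ler_pM2l].
  move=> x0 y0 z0; have [xy|/ltW yx] := leP x y.
    have [xz|/ltW zx] := leP x z; first by constructor 1; exact: min1.
    by constructor 3; rewrite mulrC mulrA min1// (le_trans zx).
  have [yz|/ltW zy] := leP y z; first by constructor 2; rewrite (mulrC x) min1.
  by constructor 3; rewrite mulrC mulrA min1// (le_trans zy).
have [h|h|h] := min3 _ _ _ (b_gt0 j k) (b_gt0 j l) (b_gt0 j m);
  [apply: le_trans h1 _|apply: le_trans h2 _|apply: le_trans h3 _];
  by rewrite ler_wpM2r// ler_pM2l.
Qed.

(** With T the sum, 2 |T u|^2 = 2 <T^2 u, u> <= |T^2 u|^2 + |u|^2. The four-fold expansion of |T^2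
    u|^2 is summed by [quad_decay] and leaves the square function, so |T^2 u|^2 <= 108 c * 3 c
    |u|^2. *)
Lemma commuting_cotlar_stein n u :
  B (\sum_(j < n) T j u) (\sum_(j < n) T j u) <= (162 * c ^+ 2 + 1) * B u u.
Proof.
set S := \sum_(j < n) T j u.
pose SS := \sum_(j < n) T j S.
have SSE : B SS SS <= 108 * c * \sum_(j < n) nrm u j.
  have -> : B SS SS = \sum_(j < n) \sum_(k < n) \sum_(l < n) \sum_(m < n)
      B (T j (T k u)) (T l (T m u)).
    rewrite form_suml; apply: eq_bigr => j _; rewrite T_sum form_suml.
    apply: eq_bigr => k _; rewrite form_sumr; apply: eq_bigr => l _.
    by rewrite T_sum form_sumr.
  pose N := \sum_(j < n) nrm u j.
  have bsum j : \sum_(k < n) b j k <= 3 by exact: sum_half_distn.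
  have bsum0 j : 0 <= \sum_(k < n) b j k by apply: sumr_ge0 => k _; apply: ltW.
  have n0 i : 0 <= nrm u i by exact: B0.
  have bn0 j : 0 <= \sum_(k < n) b j k * nrm u k.
    by apply: sumr_ge0 => k _; rewrite mulr_ge0 // ltW.
  have wsum : \sum_(j < n) \sum_(k < n) b j k * nrm u k <= 3 * N.
    rewrite exchange_big /= /N mulr_sumr; apply: ler_sum => k _.
    rewrite -mulr_suml ler_wpM2r//; under eq_bigr do rewrite bC; exact: bsum.
  (* Each [f j] is at most 3 and the [g j] add up to at most 3 N. The norm with index j contributes
     27 c N and the other three together 27 c * 3 N, which makes 108 c N. *)
  pose f j := \sum_(k < n) b j k; pose g j := \sum_(k < n) b j k * nrm u k.
  apply: (@le_trans _ _ (\sum_(j < n) c *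
     (nrm u j * f j ^+ 3 + 3 * g j * f j ^+ 2))).
    apply: ler_sum => j _.
    apply: (@le_trans _ _ (\sum_(k < n) \sum_(l < n) \sum_(m < n)
       c * (b j k * b j l * b j m) * (nrm u j + nrm u k + nrm u l + nrm u m))).
      by do 3!(apply: ler_sum => ? _); exact: quad_decay.
    rewrite le_eqVlt; apply/orP; left; apply/eqP.
    transitivity (\sum_(k < n) c * (nrm u j * b j k * f j ^+ 2 +
        b j k * nrm u k * f j ^+ 2 + 2 * b j k * g j * f j)).
      apply: eq_bigr => k _.
      transitivity (\sum_(l < n) c * (nrm u j * b j k * b j l * f j +
        b j k * nrm u k * b j l * f j + b j k * (b j l * nrm u l) * f j +
        b j k * b j l * g j)).
        apply: eq_bigr => l _; rewrite /f /g !mulr_sumr -!big_split /= mulr_sumr.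
        by apply: eq_bigr => m _; ring.
      rewrite -mulr_sumr !big_split /= -!mulr_suml -!mulr_sumr -/(f j) -/(g j).
      by congr (_ * _); ring.
    rewrite -mulr_sumr !big_split /= -!mulr_suml -!mulr_sumr -/(f j) -/(g j).
    by congr (_ * _); ring.
  apply: (@le_trans _ _ (\sum_(j < n) c * (27 * nrm u j + 27 * g j))).
    apply: ler_sum => j _; rewrite ler_pM2l//; apply: lerD.
      rewrite mulrC ler_wpM2r//.
      rewrite (_ : 27 = 3 ^+ 3); last by ring.
      by rewrite lerXn2r ?nnegrE ?bsum0 ?bsum.
    rewrite mulrAC ler_wpM2r//; first exact: bn0.
    have : f j ^+ 2 <= 3 ^+ 2 by rewrite lerXn2r ?nnegrE ?bsum0 ?bsum.
    by have -> : 3 ^+ 2 = 9 :> R; [ring|lra].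
  rewrite -mulr_sumr big_split /= -!mulr_sumr -/N.
  have -> : 108 * c * N = c * (27 * N + 27 * (3 * N)) by ring.
  by rewrite ler_pM2l// lerD2l ler_pM2l.
have {}SSE : B SS SS <= 324 * c ^+ 2 * B u u.
  apply: le_trans SSE _; have := square_function_bound n u.
  rewrite -(ler_pM2l (_ : 0 < 108 * c)) ?mulr_gt0// => h.
  by apply: le_trans h _; rewrite le_eqVlt; apply/orP; left; apply/eqP; ring.
have := form_amgm SS u ltr01; rewrite invr1 !mul1r.
have -> : B SS u = B S S.
  by rewrite form_suml {2}/S form_sumr; apply: eq_bigr => j _; rewrite Tsym.
have := B0 u; move: SSE; lra.
Qed.

End commuting_cotlar_stein.

(** * Invariance of Lebesgue measure under signed permutations *)

(** Positive and negative parts are transported separately, so integrability is not asked for: both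
    sides agree even where the value is a convention. *)
Lemma integral_measure_preserving d (T : measurableType d) (R : realType)
    (mu : {measure set T -> \bar R}) (phi : T -> T) (f : T -> R) :
  measurable_fun setT phi -> (forall A, measurable A -> mu (phi @^-1` A) = mu A) ->
  measurable_fun setT f ->
  (\int[mu]_x (f (phi x))%:E = \int[mu]_x (f x)%:E)%E.
Proof.
move=> mp inv mf.
have ge0 (g : T -> \bar R) : measurable_fun setT g -> (forall x, 0 <= g x)%E ->
  (\int[mu]_x g (phi x) = \int[mu]_x g x)%E.
  move=> mg g0.
  rewrite -[LHS](@ge0_integral_pushforward _ _ _ _ _ _ mp mu setT g)//.
  by apply: eq_measure_integral => A mA _; exact: inv.
rewrite integralE [RHS]integralE; congr (_ - _)%E.
  transitivity (\int[mu]_x (EFin \o f)^\+ (phi x))%E.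
    by apply: eq_integral => x _; rewrite !unlock.
  apply: ge0; last by move=> x; exact: funepos_ge0.
  exact/measurable_funepos/measurable_EFinP.
transitivity (\int[mu]_x (EFin \o f)^\- (phi x))%E.
  by apply: eq_integral => x _; rewrite !unlock.
apply: ge0; last by move=> x; exact: funeneg_ge0.
exact/measurable_funeneg/measurable_EFinP.
Qed.

Section box.
Variables (R : realType) (n : nat).
Local Notation X := 'rV[R]_n.

Definition box (a b : X) : set X :=
  [set x | forall i, a ord0 i <= x ord0 i <= b ord0 i].

Lemma measurable_box a b : measurable (box a b).
Proof.
rewrite (_ : box a b = \bigcap_(i in [set: 'I_n])
    (fun x : X => x ord0 i) @^-1` `[a ord0 i, b ord0 i]).
  apply: fin_bigcap_measurable => // i _.
  by rewrite -[X in measurable X]setTI; exact: measurable_coord.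
apply/seteqP; split => x xab i; last by have := xab i I; rewrite /= in_itv.
by move=> _; rewrite /= in_itv /=; exact: xab.
Qed.

(** The corners are unconstrained: a box whose bounds are in the wrong order is empty, so that
    disjoint boxes also intersect in a box. *)
Definition boxes : set (set X) := [set A | exists a b, A = box a b].

Lemma boxes_setI : setI_closed boxes.
Proof.
move=> _ _ [a [b ->]] [a' [b' ->]].
exists (\row_i Num.max (a ord0 i) (a' ord0 i)).
exists (\row_i Num.min (b ord0 i) (b' ord0 i)).
apply/seteqP; split => x /=.
  by move=> [h h'] i; rewrite !mxE ge_max le_min; 
    have /andP[-> ->] := h i; have /andP[-> ->] := h' i.
by move=> h; split => i; have := h i; rewrite !mxE ge_max le_min;
  move=> /andP[/andP[h1 h2] /andP[h3 h4]]; apply/andP.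
Qed.

Definition centered_box (k : nat) : set X := box (const_mx (- k%:R)) (const_mx k%:R).

Lemma bigcup_centered_box : \bigcup_k centered_box k = setT.
Proof.
apply/seteqP; split => // x _.
exists (\max_i (Num.truncn `|x ord0 i|).+1)%N => // i /=; rewrite !mxE -ler_norml.
have := @leq_bigmax _ (fun i => (Num.truncn `|x ord0 i|).+1) i.
rewrite -(ler_nat R); apply: le_trans; apply/ltW/truncnS_gt.
Qed.

Lemma sigma_boxes : measurable = <<s boxes >> :> set (set X).
Proof.
apply/seteqP; split; last first.
  apply: smallest_sub; first exact: sigma_algebra_measurable.
  by move=> _ [a [b ->]]; exact: measurable_box.
apply: smallest_sub; first exact: smallest_sigma_algebra.
move=> B; rewrite -bigcup_seq => -[i _ [Y mY <-]] /=; rewrite setTI.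
pose G := [set Y : set R | <<s boxes >> ((fun x : X => x ord0 i) @^-1` Y)].
suff: (@ocitv R).-sigma.-measurable `<=` G by exact.
rewrite RGenCInfty.measurableE; apply: smallest_sub.
  split.
  - by rewrite /G /= preimage_set0; exact: sigma_algebra0.
  - move=> A GA; rewrite /G /= setTD preimage_setC -setTD.
    exact: sigma_algebraCD.
  - by move=> F GF; rewrite /G /= preimage_bigcup; exact: sigma_algebra_bigcup.
move=> _ [x ->] /=.
(* A closed half-space is a countable union of boxes, and the half-lines below it generate the
   sigma-algebra of the coordinate. *)
rewrite /G /= (_ : _ @^-1` _ = \bigcup_k box (\row_j if j == i then x else - k%:R)
  (const_mx k%:R)).
  apply: sigma_algebra_bigcup => k; apply: sub_sigma_algebra; eexists; eexists; reflexivity.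
apply/seteqP; split => y /=; rewrite in_itv/= andbT.
  move=> xy; have : (\bigcup_k centered_box k) y by rewrite bigcup_centered_box.
  move=> [k _ yk]; exists k => // j; have := yk j; rewrite !mxE => /andP[l ->].
  by rewrite andbT; case: eqP => // ->.
by move=> [k _ /(_ i)]; rewrite !mxE eqxx => /andP[].
Qed.

(** Boxes are stable under intersection, generate the sigma-algebra and include an exhaustion by
    cubes of finite measure; hence their volumes determine a measure. *)
Lemma lebesgue_row_unique (m : {measure set X -> \bar R}) :
  (forall a b : X, (forall i, a ord0 i <= b ord0 i) ->
     m (box a b) = (\prod_i (b ord0 i - a ord0 i))%:E) ->
  forall A, measurable A -> m A = lebesgue_row R n A.
Proof.
move=> mbox A mA.
have mE a b : m (box a b) = lebesgue_row R n (box a b).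
  have [ab|/existsNP[i /negP]] := pselect (forall i, a ord0 i <= b ord0 i).
    by rewrite mbox// lebesgue_row_box.
  rewrite -ltNge => ba; rewrite (_ : box a b = set0) ?measure0//.
  apply/seteqP; split => // x /(_ i) /andP[ax xb].
  by move: (le_lt_trans (le_trans ax xb) ba); rewrite ltxx.
apply: (measure_unique boxes centered_box) => //.
- exact: sigma_boxes.
- exact: boxes_setI.
- by move=> k; eexists; eexists; reflexivity.
- exact: bigcup_centered_box.
- by move=> _ [a [b ->]].
- move=> k; rewrite mbox ?ltry// => i; rewrite !mxE.
  by rewrite lerNl (le_trans (_ : _ <= 0)) ?oppr_le0 ?ler0n.
Qed.

(** One family for all the symmetries in use: translations, the reflections y -> x - y, sign changes
    of a coordinate and swaps of two coordinates. *)
Definition signed_perm (c : X) (e : 'I_n -> bool) (s : {perm 'I_n}) (x : X) : X :=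
  \row_i (c ord0 i + (-1) ^+ e i * x ord0 (s i)).

Lemma measurable_signed_perm c e s : measurable_fun setT (signed_perm c e s).
Proof.
apply: measurable_fun_row => i; under eq_fun do rewrite mxE.
apply: measurable_funD => //; apply: measurable_funM => //.
exact: measurable_coord.
Qed.

Lemma lebesgue_row_signed_perm c e s A : measurable A ->
  lebesgue_row R n (signed_perm c e s @^-1` A) = lebesgue_row R n A.
Proof.
move=> mA.
pose f : {mfun X >-> X} := HB.pack (signed_perm c e s)
  (isMeasurableFun.Build _ _ _ _ _ (measurable_signed_perm c e s)).
apply: (lebesgue_row_unique (m := pushforward (lebesgue_row R n) f)) => // a b ab.
rewrite /pushforward /=.
(* A sign change exchanges the two ends of an interval. *)
pose lo i := if e i then c ord0 i - b ord0 i else a ord0 i - c ord0 i.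
pose hi i := if e i then c ord0 i - a ord0 i else b ord0 i - c ord0 i.
transitivity (lebesgue_row R n
    (box (\row_i lo ((s^-1)%g i)) (\row_i hi ((s^-1)%g i)))); last first.
  rewrite lebesgue_row_box; last first.
    by move=> i; rewrite !mxE /lo /hi; case: ifP => _; have := ab ((s^-1)%g i); lra.
  congr EFin; rewrite (reindex_inj (@perm_inj _ s)) /=; apply: eq_bigr => i _.
  by rewrite !mxE permK /lo /hi; case: ifP => _; ring.
congr (lebesgue_row R n _).
apply/seteqP; split => x /= h i.
  have := h ((s^-1)%g i); rewrite !mxE permKV /lo /hi.
  by case: (e _); rewrite ?expr1 ?expr0 ?mulN1r ?mul1r => /andP[h1 h2]; apply/andP; split; lra.
have := h (s i); rewrite !mxE permK /lo /hi.
by case: (e _); rewrite ?expr1 ?expr0 ?mulN1r ?mul1r => /andP[h1 h2]; apply/andP; split; lra.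
Qed.

Lemma integral_signed_perm c e s (f : X -> R) : measurable_fun setT f ->
  (\int[lebesgue_row R n]_x (f (signed_perm c e s x))%:E =
  \int[lebesgue_row R n]_x (f x)%:E)%E.
Proof.
apply: integral_measure_preserving; first exact: measurable_signed_perm.
exact: lebesgue_row_signed_perm.
Qed.

Lemma Rintegral_signed_perm c e s (f : X -> R) : measurable_fun setT f ->
  \int[lebesgue_row R n]_x f (signed_perm c e s x) = \int[lebesgue_row R n]_x f x.
Proof. by move=> mf; rewrite /Rintegral integral_signed_perm. Qed.

End box.

(** * Bounded functions of bounded support *)

Section bounded_support.
Variables (R : realType) (n : nat).
Local Notation X := 'rV[R]_n.
Local Notation leb := (lebesgue_row R n).

Lemma ge_rV_norm (r : R) (x : X) : 0 <= r ->
  (`|x| <= r) <-> (forall i, `|x ord0 i| <= r).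
Proof.
move=> r0; rewrite [`|x|]mx_normrE; split.
  move=> h i; apply: le_trans h; exact: (le_bigmax _ _ (ord0, i)).
by move=> h; apply/bigmax_leP; split => // -[i j] _ /=; rewrite (ord1 i).
Qed.

Lemma rV_coord_norm (x : X) i : `|x ord0 i| <= `|x|.
Proof. by have /(_ i) := (ge_rV_norm x (normr_ge0 x)).1 (lexx _). Qed.

Definition cube (r : R) : set X := box (const_mx (- r)) (const_mx r).

Lemma cubeE r x : 0 <= r -> cube r x <-> `|x| <= r.
Proof.
move=> r0; split.
  by move=> h; apply/ge_rV_norm => // i; have := h i; rewrite !mxE ler_norml.
by move/ge_rV_norm => h i; rewrite !mxE -ler_norml; exact: h.
Qed.

Lemma measurable_cube r : measurable (cube r).
Proof. exact: measurable_box. Qed.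

Lemma lebesgue_cube r : 0 <= r -> leb (cube r) = ((2 * r) ^+ n)%:E.
Proof.
move=> r0; rewrite lebesgue_row_box; last by move=> i; rewrite !mxE; lra.
congr EFin; under eq_bigr do rewrite !mxE opprK.
by rewrite prodr_const card_ord; congr (_ ^+ _); lra.
Qed.

Lemma lebesgue_cube_fin r : 0 <= r -> (leb (cube r) < +oo)%E.
Proof. by move=> r0; rewrite lebesgue_cube// ltry. Qed.

Lemma integrable_indic_fin d (T : measurableType d)
    (mu : {measure set T -> \bar R}) (A : set T) : measurable A ->
  (mu A < +oo)%E -> mu.-integrable setT (fun x => (\1_A x)%:E).
Proof.
move=> mA Aoo; apply/integrableP; split; first exact/measurable_EFinP.
under eq_integral do rewrite gee0_abs ?lee_fin//.
by rewrite integral_indic// setIT.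
Qed.

(** One constant bounds the values and, in the sup norm, the support. The class is stable under
    sums, products and convolution, and integrability and Fubini are automatic on it; the L^2 bounds
    are first shown here. *)
Definition bsf (f : X -> R) := measurable_fun setT f /\
  exists c : R, forall x, `|f x| <= c /\ (c < `|x| -> f x = 0).

Definition bsf2 (F : X * X -> R) := measurable_fun setT F /\
  exists c : R, forall x y, `|F (x, y)| <= c /\
    (c < `|x| \/ c < `|y| -> F (x, y) = 0).

Lemma bsf_integrable f : bsf f -> leb.-integrable setT (EFin \o f).
Proof.
move=> [mf [c cf]].
have c0 : 0 <= c by apply: le_trans (normr_ge0 _) (cf 0).1.
apply: (@le_integrable _ _ _ _ _ measurableT _ (EFin \o (fun x => c * \1_(cube c) x))).
- exact/measurable_EFinP.
- move=> x _; rewrite /= lee_fin [leRHS]ger0_norm ?mulr_ge0 ?indicE//.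
  have [fc fc0] := cf x; case: (boolP (x \in cube c)) => [_|/negP xc]; first by rewrite mulr1.
  rewrite fc0 ?normr0 ?mulr0// ltNge; apply/negP => /cubeE h; apply: xc.
  by rewrite inE; apply: h.
- rewrite (_ : EFin \o _ = fun x => c%:E * (\1_(cube c) x)%:E)%E; last first.
    by apply/funext => x /=; rewrite EFinM.
  apply: integrableZl => //; apply: integrable_indic_fin; first exact: measurable_cube.
  exact: lebesgue_cube_fin.
Qed.

Lemma bsf2_integrable F : bsf2 F -> (leb \x leb)%E.-integrable setT (EFin \o F).
Proof.
move=> [mF [c cF]].
have c0 : 0 <= c by apply: le_trans (normr_ge0 _) (cF 0 0).1.
have mc := measurable_cube c.
have cc_fin : ((leb \x leb)%E (cube c `*` cube c) < +oo)%E.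
  rewrite product_measure1E//; apply: lte_mul_pinfty => //.
    by rewrite ge0_fin_numE//; exact: lebesgue_cube_fin.
  exact: lebesgue_cube_fin.
apply: (@le_integrable _ _ _ _ _ measurableT _
  (EFin \o (fun z => c * \1_(cube c `*` cube c) z))).
- exact/measurable_EFinP.
- move=> [x y] _; rewrite /= lee_fin [leRHS]ger0_norm ?mulr_ge0 ?indicE//.
  have [fc fc0] := cF x y; case: (boolP (_ \in _)) => [_|/negP xc]; first by rewrite mulr1.
  rewrite fc0 ?normr0 ?mulr0//; apply: contrapT => /not_orP[/negP h1 /negP h2].
  by apply: xc; rewrite inE; split; apply/cubeE => //=; rewrite leNgt.
- rewrite (_ : EFin \o _ = fun x => c%:E * (\1_(cube c `*` cube c) x)%:E)%E; last first.
    by apply/funext => x /=; rewrite EFinM.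
  apply: integrableZl => //; apply: integrable_indic_fin; first exact: measurableX.
  exact: cc_fin.
Qed.

Lemma measurable_Rintegral2 (F : X * X -> R) : measurable_fun setT F ->
  measurable_fun setT (fun x => \int[leb]_y F (x, y)).
Proof.
move=> mF; rewrite /Rintegral.
apply: (measurableT_comp (fine_measurable measurableT)) => //.
under eq_fun do rewrite integralE.
have mEF : measurable_fun setT (EFin \o F) by exact/measurable_EFinP.
apply: emeasurable_funB.
  rewrite (_ : (fun _ => _) = fun x => \int[leb]_y (EFin \o F)^\+ (x, y))%E.
    apply: (measurable_fun_fubini_tonelli_F (EFin \o F)^\+%E) => //.
    exact: measurable_funepos.
  by apply/funext => x; apply: eq_integral => y _; rewrite !unlock.
rewrite (_ : (fun _ => _) = fun x => \int[leb]_y (EFin \o F)^\- (x, y))%E.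
  apply: (measurable_fun_fubini_tonelli_F (EFin \o F)^\-%E) => //.
  exact: measurable_funeneg.
by apply/funext => x; apply: eq_integral => y _; rewrite !unlock.
Qed.

Lemma bsf_slice1 F x : bsf2 F -> bsf (fun y => F (x, y)).
Proof.
move=> [mF [c cF]]; split.
  by apply: (measurableT_comp mF); exact: measurable_pair1.
by exists c => y; have [h1 h2] := cF x y; split => // cy; apply: h2; right.
Qed.

Lemma bsf_slice2 F y : bsf2 F -> bsf (fun x => F (x, y)).
Proof.
move=> [mF [c cF]]; split.
  by apply: (measurableT_comp mF); exact: measurable_pair2.
by exists c => x; have [h1 h2] := cF x y; split => // cy; apply: h2; left.
Qed.

Lemma EFin_Rintegral f : bsf f -> (\int[leb]_x f x)%:E = (\int[leb]_x (f x)%:E)%E.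
Proof.
by move=> bf; rewrite /Rintegral fineK//; exact: (integrable_fin_num _ (bsf_integrable bf)).
Qed.

Lemma Rintegral_swap F : bsf2 F ->
  \int[leb]_x \int[leb]_y F (x, y) = \int[leb]_y \int[leb]_x F (x, y).
Proof.
move=> bF; rewrite /Rintegral; congr fine.
transitivity (\int[leb]_x \int[leb]_y (F (x, y))%:E)%E.
  by apply: eq_integral => x _; rewrite -EFin_Rintegral//; exact: bsf_slice1.
rewrite (Fubini (bsf2_integrable bF)).
by apply: eq_integral => y _; exact: esym (EFin_Rintegral (bsf_slice2 y bF)).
Qed.

Lemma bsf_abs_bound f c r : bsf f -> 0 <= c -> 0 <= r -> (forall x, `|f x| <= c) ->
  (forall x, r < `|x| -> f x = 0) -> \int[leb]_x `|f x| <= c * (2 * r) ^+ n.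
Proof.
move=> bf c0 r0 fc fr.
have mc := measurable_cube r.
have i1 : leb.-integrable setT (EFin \o \1_(cube r)).
  by apply: integrable_indic_fin => //; exact: lebesgue_cube_fin.
have -> : c * (2 * r) ^+ n = \int[leb]_x (c * \1_(cube r) x).
  rewrite RintegralZl//; congr (_ * _); rewrite /Rintegral integral_indic// setIT.
  exact: esym (congr1 fine (lebesgue_cube r0)).
apply: le_Rintegral => //.
- by apply: integrable_norm; exact: bsf_integrable.
- rewrite (_ : EFin \o _ = fun x => c%:E * (\1_(cube r) x)%:E)%E; last first.
    by apply/funext => x /=; rewrite EFinM.
  exact: integrableZl.
move=> x _; rewrite indicE; case: (boolP (x \in cube r)) => [_|/negP xc].
  by rewrite mulr1.
rewrite fr ?normr0 ?mulr0// ltNge; apply/negP => h; apply: xc.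
by rewrite inE; apply/cubeE.
Qed.

Lemma bsf_bound f c r : bsf f -> 0 <= c -> 0 <= r -> (forall x, `|f x| <= c) ->
  (forall x, r < `|x| -> f x = 0) -> `|\int[leb]_x f x| <= c * (2 * r) ^+ n.
Proof.
move=> bf c0 r0 fc fr; apply: le_trans (bsf_abs_bound bf c0 r0 fc fr).
by apply: le_normr_Rintegral => //; exact: bsf_integrable.
Qed.

End bounded_support.

(** * Convolution of bounded functions of bounded support *)

Section convolution.
Variables (R : realType) (n : nat).
Local Notation X := 'rV[R]_n.
Local Notation leb := (lebesgue_row R n).
Implicit Types f g k l u v w : X -> R.

(** Room for kernels of unbounded support, such as [reg_kernel] below; times a [bsf] function they
    become [bsf] again. *)
Definition bounded_measurable f := measurable_fun setT f /\
  exists c : R, forall x, `|f x| <= c.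

Lemma bsf_bounded f : bsf f -> bounded_measurable f.
Proof. by move=> [mf [c cf]]; split => //; exists c => x; case: (cf x). Qed.

Lemma bsf_measurable f : bsf f -> measurable_fun setT f. Proof. by case. Qed.

Lemma bsf0 : bsf (fun _ : X => 0 : R).
Proof. by split => //; exists 0 => x; rewrite normr0. Qed.

Lemma bsfD f g : bsf f -> bsf g -> bsf (fun x => f x + g x).
Proof.
move=> [mf [c cf]] [mg [c' cg]]; split; first exact: measurable_funD.
have c0 : 0 <= c by apply: le_trans (normr_ge0 _) (cf 0).1.
have c0' : 0 <= c' by apply: le_trans (normr_ge0 _) (cg 0).1.
exists (c + c') => x; have [f1 f2] := cf x; have [g1 g2] := cg x; split.
  by apply: le_trans (ler_normD _ _) _; exact: lerD.
by move=> h; rewrite f2 ?g2 ?addr0//; apply: le_lt_trans h; rewrite ?lerDl ?lerDr.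
Qed.

Lemma bsfM f g : bounded_measurable f -> bsf g -> bsf (fun x => f x * g x).
Proof.
move=> [mf [c cf]] [mg [c' cg]]; split; first exact: measurable_funM.
have c0 : 0 <= c by apply: le_trans (normr_ge0 _) (cf 0).
have c0' : 0 <= c' by apply: le_trans (normr_ge0 _) (cg 0).1.
exists (Num.max (c * c') c') => x; have [g1 g2] := cg x; split.
  by rewrite normrM le_max ler_pM.
by rewrite gt_max => /andP[_ /g2 ->]; rewrite mulr0.
Qed.

Lemma bounded_cst (a : R) : bounded_measurable (fun=> a).
Proof. by split => //; exists `|a|. Qed.

Lemma bsfZ (a : R) f : bsf f -> bsf (fun x => a * f x).
Proof. by apply: bsfM; exact: bounded_cst. Qed.

Lemma bsfB f g : bsf f -> bsf g -> bsf (fun x => f x - g x).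
Proof.
move=> bf bg; rewrite (_ : (fun x => f x - g x) = fun x => f x + -1 * g x).
  by apply: bsfD => //; exact: bsfZ.
by apply/funext => x; rewrite mulN1r.
Qed.

Lemma bsf_abs f : bsf f -> bsf (fun x => `|f x|).
Proof.
move=> [mf [c cf]]; split; first exact: measurableT_comp.
by exists c => x; have [h1 h2] := cf x; split; rewrite ?normr_id// => /h2 ->; rewrite normr0.
Qed.

Lemma Rintegral_bsfD f g : bsf f -> bsf g ->
  \int[leb]_x (f x + g x) = \int[leb]_x f x + \int[leb]_x g x.
Proof. by move=> bf bg; rewrite RintegralD//; exact: bsf_integrable. Qed.

Lemma Rintegral_bsfB f g : bsf f -> bsf g ->
  \int[leb]_x (f x - g x) = \int[leb]_x f x - \int[leb]_x g x.
Proof. by move=> bf bg; rewrite RintegralB//; exact: bsf_integrable. Qed.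

Lemma Rintegral_bsfZ (a : R) f : bsf f ->
  \int[leb]_x (a * f x) = a * \int[leb]_x f x.
Proof. by move=> bf; rewrite RintegralZl//; exact: bsf_integrable. Qed.

Lemma le_Rintegral_bsf f g : bsf f -> bsf g -> (forall x, f x <= g x) ->
  \int[leb]_x f x <= \int[leb]_x g x.
Proof. by move=> bf bg fg; apply: le_Rintegral => //; exact: bsf_integrable. Qed.

Let sub_signed_perm (x y : X) : signed_perm x xpredT 1%g y = x - y.
Proof. by apply/rowP => i; rewrite !mxE perm1 mulN1r. Qed.

Let shift_signed_perm (z y : X) : signed_perm (- z) xpred0 1%g y = y - z.
Proof. by apply/rowP => i; rewrite !mxE perm1 expr0 mul1r addrC. Qed.

Lemma measurable_subl (x : X) : measurable_fun setT (fun y : X => x - y).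
Proof.
by rewrite -(funext (sub_signed_perm x)); exact: measurable_signed_perm.
Qed.

Lemma Rintegral_subl f (x : X) : measurable_fun setT f ->
  \int[leb]_y f (x - y) = \int[leb]_y f y.
Proof.
move=> mf; rewrite -[RHS](Rintegral_signed_perm x xpredT 1%g)//.
by apply: eq_Rintegral => y _; rewrite sub_signed_perm.
Qed.

Lemma Rintegral_subr f (z : X) : measurable_fun setT f ->
  \int[leb]_y f (y - z) = \int[leb]_y f y.
Proof.
move=> mf; rewrite -[RHS](Rintegral_signed_perm (- z) xpred0 1%g)//.
by apply: eq_Rintegral => y _; rewrite shift_signed_perm.
Qed.

Lemma measurable_sub2 : measurable_fun setT (fun z : X * X => z.1 - z.2).
Proof.
apply: measurable_fun_row => i; under eq_fun do rewrite !mxE.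
apply: measurable_funB.
  exact: (measurableT_comp (measurable_coord i) measurable_fst).
exact: (measurableT_comp (measurable_coord i) measurable_snd).
Qed.

Lemma bounded_subl k (x : X) : bounded_measurable k ->
  bounded_measurable (fun y => k (x - y)).
Proof.
move=> [mk [c ck]]; split; last by exists c.
exact: measurableT_comp (measurable_subl x).
Qed.

Lemma bsf_subl k (x : X) : bsf k -> bsf (fun y => k (x - y)).
Proof.
move=> [mk [c ck]]; split; first exact: measurableT_comp (measurable_subl x).
exists (c + `|x|) => y; have [h1 h2] := ck (x - y); split.
  by apply: le_trans h1 _; rewrite lerDl.
move=> h; apply: h2; have := ler_normB x (x - y); rewrite subKr; lra.
Qed.

Definition convol k u (x : X) : R := \int[leb]_y (k (x - y) * u y).

Definition inner u v : R := \int[leb]_x (u x * v x).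

Lemma bsf2M (G : X * X -> R) u v : measurable_fun setT G ->
  (exists c : R, forall z, `|G z| <= c) -> bsf u -> bsf v ->
  bsf2 (fun z => G z * u z.2 * v z.1).
Proof.
move=> mG [c cG] [mu [cu cuP]] [mv [cv cvP]]; split.
  apply: measurable_funM; last exact: measurableT_comp measurable_fst.
  by apply: measurable_funM => //; exact: measurableT_comp measurable_snd.
have c0 : 0 <= c by apply: le_trans (normr_ge0 _) (cG (0, 0)).
have cu0 : 0 <= cu by apply: le_trans (normr_ge0 _) (cuP 0).1.
have cv0 : 0 <= cv by apply: le_trans (normr_ge0 _) (cvP 0).1.
exists (c * cu * cv + cu + cv) => x y /=.
have [u1 u2] := cuP y; have [v1 v2] := cvP x; split.
  rewrite !normrM -addrA; apply: (@le_trans _ _ (c * cu * cv)).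
    by rewrite !ler_pM ?mulr_ge0.
  by rewrite lerDl addr_ge0.
have ccc : 0 <= c * cu * cv by rewrite !mulr_ge0.
move=> [h|h]; [rewrite v2 ?mulr0//|rewrite u2 ?mulr0 ?mul0r//]; lra.
Qed.

Lemma bounded_sub2 k : bounded_measurable k ->
  measurable_fun setT (fun z : X * X => k (z.1 - z.2)) /\
  (exists c : R, forall z : X * X, `|k (z.1 - z.2)| <= c).
Proof.
move=> [mk [c ck]]; split; last by exists c.
exact: measurableT_comp measurable_sub2.
Qed.

Lemma bsf_convol_integrand k u x : bounded_measurable k -> bsf u ->
  bsf (fun y => k (x - y) * u y).
Proof. by move=> bk bu; apply: bsfM => //; exact: bounded_subl. Qed.

Lemma measurable_convol k u : measurable_fun setT k -> measurable_fun setT u ->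
  measurable_fun setT (convol k u).
Proof.
move=> mk mu; apply: (measurable_Rintegral2 (F := fun z => k (z.1 - z.2) * u z.2)).
apply: measurable_funM; first exact: measurableT_comp measurable_sub2.
exact: measurableT_comp measurable_snd.
Qed.

Lemma bsf_convol k u : bsf k -> bsf u -> bsf (convol k u).
Proof.
move=> bk bu; have [mk [c ckP]] := bk; have [mu [c' cuP]] := bu; split.
  exact: measurable_convol.
have c0 : 0 <= c by apply: le_trans (normr_ge0 _) (ckP 0).1.
have c0' : 0 <= c' by apply: le_trans (normr_ge0 _) (cuP 0).1.
have cc0 : 0 <= c * c' * (2 * c') ^+ n by rewrite !mulr_ge0// exprn_ge0// mulr_ge0.
exists (c * c' * (2 * c') ^+ n + (c + c')) => x; split.
  apply: (@le_trans _ _ (c * c' * (2 * c') ^+ n)); last by rewrite lerDl addr_ge0.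
  apply: bsf_bound => //; rewrite ?mulr_ge0//.
  - by apply: bsf_convol_integrand => //; exact: bsf_bounded.
  - by move=> y; rewrite normrM ler_pM ?(ckP _).1 ?(cuP _).1.
  - by move=> y h; rewrite (cuP _).2// mulr0.
move=> h; rewrite /convol [LHS](_ : _ = \int[leb]_y 0); last first.
  apply: eq_Rintegral => y _.
  have [yc|yc] := ltP c' `|y|; first by rewrite (cuP y).2// mulr0.
  by rewrite (ckP _).2 ?mul0r//; have := lerB_dist x y; lra.
by rewrite /Rintegral integral0.
Qed.

Lemma inner_convol_sym k u v : bounded_measurable k -> (forall x, k (- x) = k x) ->
  bsf u -> bsf v -> inner (convol k u) v = inner u (convol k v).
Proof.
move=> bk ek bu bv; have [m2 b2] := bounded_sub2 bk.
transitivity (\int[leb]_x \int[leb]_y (k (x - y) * u y * v x)).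
  apply: eq_Rintegral => x _; rewrite mulrC -Rintegral_bsfZ.
    by apply: eq_Rintegral => y _; rewrite mulrC.
  exact: bsf_convol_integrand.
rewrite (Rintegral_swap (bsf2M m2 b2 bu bv)) /=.
apply: eq_Rintegral => y _; rewrite -Rintegral_bsfZ; last exact: bsf_convol_integrand.
by apply: eq_Rintegral => x _; rewrite -ek opprB; ring.
Qed.

Lemma convolA k l u : bsf k -> bsf l -> bsf u ->
  convol k (convol l u) = convol (convol k l) u.
Proof.
move=> bk bl bu; apply/funext => x.
have [m2 b2] := bounded_sub2 (bsf_bounded bl).
have bkx := bsf_subl x bk.
transitivity (\int[leb]_y \int[leb]_z (l (y - z) * u z * k (x - y))).
  apply: eq_Rintegral => y _; rewrite -Rintegral_bsfZ; last first.
    by apply: bsf_convol_integrand => //; exact: bsf_bounded.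
  by apply: eq_Rintegral => z _; rewrite mulrC.
rewrite (Rintegral_swap (bsf2M m2 b2 bu bkx)) /=.
apply: eq_Rintegral => z _.
have bh : bsf (fun y => k (x - z - y) * l y).
  by apply: bsf_convol_integrand => //; exact: bsf_bounded.
rewrite /convol -(Rintegral_subr z (bsf_measurable bh)) mulrC -Rintegral_bsfZ.
  by apply: eq_Rintegral => y _; rewrite opprB addrA subrK; ring.
apply: bsfM; first by apply: bsf_bounded; rewrite (_ : (fun _ => _) = fun y => k (x - y));
  [exact: bsf_subl|apply/funext => y; rewrite opprB addrA subrK].
have [ml [c cl]] := bl; split.
  rewrite -[X in measurable_fun _ X]/(l \o (fun y => y - z)).
  apply: measurableT_comp => //; rewrite -(funext (shift_signed_perm z)).
  exact: measurable_signed_perm.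
exists (c + `|z|) => y; have [h1 h2] := cl (y - z); split.
  by apply: le_trans h1 _; rewrite lerDl.
by move=> h; apply: h2; have := lerB_dist y z; lra.
Qed.

Lemma convolC k l : bsf k -> bsf l -> convol k l = convol l k.
Proof.
move=> bk bl; apply/funext => x.
have bi := bsf_convol_integrand x (bsf_bounded bk) bl.
rewrite /convol -(Rintegral_subl x (bsf_measurable bi)).
by apply: eq_Rintegral => y _; rewrite subKr mulrC.
Qed.

(** Pointwise |f(x - y) u(y) v(x)| <= |f(x - y)| (u(y)^2 + v(x)^2) / 2, and integration gives the
    L^1 norm of f in both terms, which is at most c (2 r)^n. The right side has the shape that
    [form_bound] takes. *)
Lemma convol_inner_bound f u v (c r : R) : bsf f -> bsf u -> bsf v -> 0 <= c ->
  0 <= r -> (forall x, `|f x| <= c) -> (forall x, r < `|x| -> f x = 0) ->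
  `|inner (convol f u) v| <= c * (2 * r) ^+ n * (inner u u + inner v v) / 2.
Proof.
move=> bf bu bv c0 r0 fc fr.
pose N := \int[leb]_x `|f x|.
have bfa := bsf_abs bf.
have Nle : N <= c * (2 * r) ^+ n by exact: bsf_abs_bound.
have bsq w : bsf w -> bsf (fun x => w x * w x) by move=> bw; apply: bsfM => //; exact: bsf_bounded.
have sq0 w : 0 <= inner w w by apply: Rintegral_ge0 => x _; rewrite -expr2 sqr_ge0.
suff h : `|inner (convol f u) v| <= (N * inner u u + N * inner v v) / 2.
  apply: le_trans h _; rewrite -mulrDr ler_pM2r ?invr_gt0 ?ltr0n//.
  by rewrite ler_wpM2r// addr_ge0.
have bci x : bsf (fun y => f (x - y) * u y).
  by apply: bsf_convol_integrand => //; exact: bsf_bounded.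
have bcia x w : bsf w -> bsf (fun y => `|f (x - y)| * w y).
  by move=> bw; exact: (bsf_convol_integrand x (bsf_bounded bfa) bw).
have bconv2 : bsf (convol (fun x => `|f x|) (fun y => u y * u y)).
  by apply: bsf_convol => //; exact: bsq.
(* After exchanging the integrals, each y contributes u(y)^2 times the translation invariant
   integral of |f|. *)
have -> : N * inner u u = \int[leb]_x convol (fun x => `|f x|) (fun y => u y * u y) x.
  have [m2 b2] := bounded_sub2 (bsf_bounded bfa).
  transitivity (\int[leb]_y (N * (u y * u y))).
    by rewrite Rintegral_bsfZ//; exact: bsq.
  have [c1 c1P] := (bsf_convol bfa (bsq u bu)).2.
  have [cf cfP] := bf.2; have [cu cuP] := bu.2.
  have bF : bsf2 (fun z : X * X => `|f (z.1 - z.2)| * (u z.2 * u z.2)).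
    split.
      apply: measurable_funM => //; rewrite -[X in measurable_fun _ X]/((fun y => u y * u y) \o snd).
      apply: measurableT_comp; last exact: measurable_snd.
      exact: bsf_measurable (bsq u bu).
    have cf0 : 0 <= cf by apply: le_trans (normr_ge0 _) (cfP 0).1.
    have cu0 : 0 <= cu by apply: le_trans (normr_ge0 _) (cuP 0).1.
    have k0 : 0 <= cf * (cu * cu) by rewrite !mulr_ge0.
    exists (cf * (cu * cu) + cf + cu) => x y /=.
    have [u1 u2] := cuP y; have [f1 f2] := cfP (x - y); split.
      rewrite !normrM normr_id -addrA.
      apply: (@le_trans _ _ (cf * (cu * cu))); last by rewrite lerDl addr_ge0.
      by rewrite ler_pM ?mulr_ge0// ler_pM.
    move=> h; have [yc|yc] := ltP cu `|y|; first by rewrite u2// !mulr0.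
    by rewrite f2 ?normr0 ?mul0r//; have := lerB_dist x y; case: h; lra.
  rewrite -[RHS]/(\int[leb]_x \int[leb]_y (`|f (x - y)| * (u y * u y))).
  rewrite (Rintegral_swap bF) /=; apply: eq_Rintegral => y _.
  rewrite mulrC /N -(Rintegral_subr y (bsf_measurable bfa)) -Rintegral_bsfZ.
    by apply: eq_Rintegral => x _; rewrite mulrC.
  rewrite (_ : (fun _ => _) = fun x => `|f (- y - - x)|); last first.
    by apply/funext => x; rewrite opprK addrC.
  have [mf _] := bf; split.
    rewrite (_ : (fun _ => _) = (fun x => `|f x|) \o (fun x => x - y)).
      apply: measurableT_comp; first exact: bsf_measurable.
      rewrite -(funext (shift_signed_perm y)); exact: measurable_signed_perm.
    by apply/funext => x /=; rewrite opprK addrC.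
  have cf0 : 0 <= cf by apply: le_trans (normr_ge0 _) (cfP 0).1.
  exists (cf + `|y|) => x; rewrite opprK addrC normr_id.
  have [h1 h2] := cfP (x - y); split; first by apply: le_trans h1 _; rewrite lerDl.
  by move=> h; rewrite h2 ?normr0//; have := lerB_dist x y; lra.
have -> : N * inner v v = \int[leb]_x (v x * v x * N).
  rewrite -Rintegral_bsfZ; last exact: bsq.
  by apply: eq_Rintegral => x _; rewrite mulrC.
rewrite -Rintegral_bsfD//; last first.
  by under eq_fun do rewrite mulrC; apply: bsfZ; exact: bsq.
rewrite mulrC -Rintegral_bsfZ; last first.
  apply: bsfD => //; by under eq_fun do rewrite mulrC; apply: bsfZ; exact: bsq.
have bcv : bsf (fun x => convol f u x * v x).
  by apply: bsfM => //; apply/bsf_bounded/bsf_convol.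
apply: le_trans (le_normr_Rintegral _ _) _ => //; first exact: bsf_integrable.
apply: le_Rintegral_bsf; first exact: bsf_abs.
  apply: bsfZ; apply: bsfD => //.
  by under eq_fun do rewrite mulrC; apply: bsfZ; exact: bsq.
move=> x; have -> : v x * v x * N = \int[leb]_y (`|f (x - y)| * (v x * v x)).
  rewrite /N -(Rintegral_subl x (bsf_measurable bfa)) -Rintegral_bsfZ.
    by apply: eq_Rintegral => y _; rewrite mulrC.
  exact: (bsf_subl x bfa).
have bfx : bsf (fun y => `|f (x - y)| * (v x * v x)).
  by under eq_fun do rewrite mulrC; apply: bsfZ; exact: (bsf_subl x bfa).
rewrite -Rintegral_bsfD//; last by apply: bcia; exact: bsq.
rewrite -Rintegral_bsfZ; last by apply: bsfD => //; apply: bcia; exact: bsq.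
rewrite mulrC -Rintegral_bsfZ//.
apply: le_trans (le_normr_Rintegral _ _) _ => //.
  exact: bsf_integrable (bsfZ (v x) (bci x)).
apply: le_Rintegral_bsf; first exact: bsf_abs (bsfZ (v x) (bci x)).
  by apply: bsfZ; apply: bsfD => //; apply: bcia; exact: bsq.
move=> y; rewrite !normrM -mulrDr [leRHS]mulrCA [leLHS]mulrCA ler_wpM2l//.
have := sqr_ge0 (`|u y| - `|v x|) => h.
have e (t : R) : `|t| * `|t| = t * t by rewrite -normrM ger0_norm// -expr2 sqr_ge0.
have := e (u y); have := e (v x); move: h; rewrite expr2; lra.
Qed.

End convolution.

(** * Quadratic forms and the regularized kernels *)

Section enorm.
Variables (R : realType) (n : nat).
Local Notation X := 'rV[R]_n.
Implicit Types x y : X.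

Lemma enorm_ge0 x : 0 <= enorm x. Proof. exact: sqrtr_ge0. Qed.

Lemma sqr_enorm x : enorm x ^+ 2 = \sum_i x ord0 i ^+ 2.
Proof. by rewrite sqr_sqrtr//; apply: sumr_ge0 => i _; exact: sqr_ge0. Qed.

Lemma coord_le_enorm x i : `|x ord0 i| <= enorm x.
Proof.
rewrite -(ler_pXn2r (n := 2)) ?nnegrE ?enorm_ge0// sqr_enorm.
rewrite (bigD1 i)//= real_normK ?num_real// lerDl.
by apply: sumr_ge0 => j _; exact: sqr_ge0.
Qed.

Lemma norm_le_enorm x : `|x| <= enorm x.
Proof. by apply/ge_rV_norm; [exact: enorm_ge0|exact: coord_le_enorm]. Qed.

(** |x|^2 - |y|^2 is the sum of (x_i - y_i)(x_i + y_i); divide by |x| + |y|. The factor n is the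
    price of measuring x - y in the sup norm, as is done throughout. *)
Lemma enorm_dist x y : `|enorm x - enorm y| <= n%:R * `|x - y|.
Proof.
have [s0|s0] := eqVneq (enorm x + enorm y) 0.
  have -> : enorm x = 0 by have := enorm_ge0 x; have := enorm_ge0 y; lra.
  have -> : enorm y = 0 by have := enorm_ge0 x; have := enorm_ge0 y; lra.
  by rewrite subrr normr0 mulr_ge0.
have s_gt0 : 0 < enorm x + enorm y by rewrite lt0r s0 addr_ge0 ?enorm_ge0.
rewrite -(ler_pM2r s_gt0) -[X in _ * X <= _]gtr0_norm// -normrM -subr_sqr.
rewrite !sqr_enorm -sumrB; apply: le_trans (ler_norm_sum _ _ _) _.
rewrite -mulrA -[n in n%:R]card_ord mulr_natl -sumr_const; apply: ler_sum => i _.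
rewrite subr_sqr normrM ler_pM//.
  by have := rV_coord_norm (x - y) i; rewrite !mxE.
by apply: le_trans (ler_normD _ _) _; rewrite lerD ?coord_le_enorm.
Qed.

Lemma enorm_signed_perm e s x : enorm (signed_perm 0 e s x) = enorm x.
Proof.
rewrite /enorm; congr Num.sqrt; rewrite [RHS](reindex_inj (@perm_inj _ s)) /=.
by apply: eq_bigr => i _; rewrite !mxE add0r exprMn sqrr_sign mul1r.
Qed.

Lemma enormN x : enorm (- x) = enorm x.
Proof.
by rewrite /enorm; congr Num.sqrt; apply: eq_bigr => i _; rewrite mxE sqrrN.
Qed.

End enorm.

Section quadratic_form.
Variables (R : realType) (n : nat) (a : 'M[R]_n).
Local Notation X := 'rV[R]_n.
Local Notation leb := (lebesgue_row R n).

Definition qform (x : X) : R := \sum_i \sum_j a i j * (x ord0 i * x ord0 j).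

Definition qsize : R := \sum_i \sum_j `|a i j|.

Lemma qsize_ge0 : 0 <= qsize.
Proof. by do 2!(apply: sumr_ge0 => ? _). Qed.

Lemma qformN x : qform (- x) = qform x.
Proof.
by apply: eq_bigr => i _; apply: eq_bigr => j _; rewrite !mxE mulrNN.
Qed.

Lemma measurable_qform : measurable_fun setT qform.
Proof.
apply: measurable_sum => i; apply: measurable_sum => j.
apply: measurable_funM => //; apply: measurable_funM; exact: measurable_coord.
Qed.

Lemma qform_le (b : R) x : enorm x <= b -> `|qform x| <= qsize * b ^+ 2.
Proof.
move=> xb; rewrite mulr_suml; apply: le_trans (ler_norm_sum _ _ _) _.
apply: ler_sum => i _; rewrite mulr_suml; apply: le_trans (ler_norm_sum _ _ _) _.
apply: ler_sum => j _; rewrite !normrM expr2 ler_wpM2l// ler_pM//;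
  exact: le_trans (coord_le_enorm _ _) xb.
Qed.

Lemma qform_dist (b c : R) x y : enorm x <= b -> enorm y <= c ->
  `|qform x - qform y| <= qsize * (`|x - y| * (b + c)).
Proof.
move=> xb yc; rewrite -sumrB mulr_suml; apply: le_trans (ler_norm_sum _ _ _) _.
apply: ler_sum => i _; rewrite mulr_suml -sumrB.
apply: le_trans (ler_norm_sum _ _ _) _.
apply: ler_sum => j _; rewrite -mulrBr normrM ler_wpM2l//.
have -> : x ord0 i * x ord0 j - y ord0 i * y ord0 j =
  x ord0 i * (x ord0 j - y ord0 j) + (x ord0 i - y ord0 i) * y ord0 j by ring.
have d k : `|x ord0 k - y ord0 k| <= `|x - y|.
  by have := rV_coord_norm (x - y) k; rewrite !mxE.
apply: le_trans (ler_normD _ _) _; rewrite [leRHS]mulrDr !normrM; apply: lerD.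
  by rewrite mulrC ler_pM//; exact: le_trans (coord_le_enorm _ _) xb.
by rewrite ler_pM//; exact: le_trans (coord_le_enorm _ _) yc.
Qed.

Lemma onem_expr_le (t : R) m : 0 <= t -> t <= 1 -> 1 - t ^+ m <= m%:R * (1 - t).
Proof.
move=> t0 t1; elim: m => [|m IH]; first by rewrite expr0 subrr mul0r.
have -> : 1 - t ^+ m.+1 = (1 - t) + t * (1 - t ^+ m) by rewrite exprS; ring.
rewrite -natr1 mulrDl mul1r addrC lerD2r; apply: le_trans IH.
by rewrite ler_piMl// subr_ge0 exprn_ile1.
Qed.

(** Here b and c stand for the cut-off norms of x and y. The change of the numerator is bounded by
    [qform_dist], that of the denominator by Bernoulli's inequality [onem_expr_le] at c / b. *)
Lemma qform_div_dist (b c : R) m x y : 0 < c -> c <= b -> enorm x <= b ->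
  enorm y <= c -> b - c <= n%:R * `|x - y| ->
  `|qform x / b ^+ m.+2 - qform y / c ^+ m.+2| <=
  qsize * (2 + n%:R * m.+2%:R) * `|x - y| / c ^+ m.+1.
Proof.
move=> c0 cb xb yc bc; have b0 : 0 < b by exact: lt_le_trans cb.
have -> : qform x / b ^+ m.+2 - qform y / c ^+ m.+2 =
  (qform x - qform y) / b ^+ m.+2 - qform y * (c ^- m.+2 - b ^- m.+2) by ring.
apply: le_trans (ler_normB _ _) _.
have -> : qsize * (2 + n%:R * m.+2%:R) * `|x - y| / c ^+ m.+1 =
  qsize * `|x - y| * 2 / c ^+ m.+1 + qsize * n%:R * m.+2%:R * `|x - y| / c ^+ m.+1 by ring.
have inv_le k : b ^- k <= c ^- k.
  by rewrite lef_pV2 ?posrE ?exprn_gt0// lerXn2r// nnegrE ltW.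
apply: lerD.
  rewrite normrM [X in _ * X]gtr0_norm ?invr_gt0 ?exprn_gt0//.
  apply: (@le_trans _ _ (qsize * (`|x - y| * (b + b)) / b ^+ m.+2)).
    rewrite ler_pM2r ?invr_gt0 ?exprn_gt0//; apply: le_trans (qform_dist xb yc) _.
    by rewrite ler_wpM2l ?qsize_ge0// ler_wpM2l// lerD2l.
  have -> : qsize * (`|x - y| * (b + b)) / b ^+ m.+2 =
      qsize * `|x - y| * 2 / b ^+ m.+1.
    by rewrite [b ^+ m.+2]exprS invfM; field; rewrite expf_neq0 gt_eqF.
  by rewrite ler_wpM2l// !mulr_ge0// qsize_ge0.
rewrite normrM [X in _ * X]ger0_norm ?subr_ge0//.
have t1 : c / b <= 1 by rewrite ler_pdivrMr// mul1r.
have t0 : 0 <= c / b by rewrite divr_ge0 ?ltW.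
have B := onem_expr_le m.+2 t0 t1.
have d : c ^- m.+2 - b ^- m.+2 <= m.+2%:R * (n%:R * `|x - y|) / c ^+ m.+3.
  have -> : c ^- m.+2 - b ^- m.+2 = (1 - (c / b) ^+ m.+2) / c ^+ m.+2.
    by rewrite expr_div_n; field; rewrite !expf_neq0 ?gt_eqF.
  have -> : m.+2%:R * (n%:R * `|x - y|) / c ^+ m.+3 =
     m.+2%:R * ((n%:R * `|x - y|) / c) / c ^+ m.+2 :> R.
    by rewrite [c ^+ m.+3]exprS; field; rewrite !expf_neq0 ?gt_eqF.
  rewrite ler_pM2r ?invr_gt0 ?exprn_gt0//; apply: le_trans B _.
  rewrite ler_wpM2l//; have -> : 1 - c / b = (b - c) / b by field; rewrite gt_eqF.
  by rewrite ler_pM ?subr_ge0 ?invr_ge0 ?(ltW b0)// lef_pV2.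
apply: (@le_trans _ _ (qsize * c ^+ 2 * (m.+2%:R * (n%:R * `|x - y|) / c ^+ m.+3))).
  by rewrite ler_pM ?subr_ge0// qform_le.
rewrite le_eqVlt; apply/orP; left; apply/eqP.
by rewrite [c ^+ m.+3]exprS [c ^+ m.+2]exprS; field; rewrite !expf_neq0 ?gt_eqF.
Qed.

Hypothesis tr0 : \tr a = 0.

(* Flipping one coordinate kills the off-diagonal terms, and swapping two
   coordinates makes the diagonal terms equal. *)
Lemma Rintegral_qform_radial (g : R -> R) :
  (forall i j, bsf (fun x : X => x ord0 i * x ord0 j * g (enorm x))) ->
  \int[leb]_x (qform x * g (enorm x)) = 0.
Proof.
move=> bg; pose I i j := \int[leb]_x (x ord0 i * x ord0 j * g (enorm x)).
have off i j : i != j -> I i j = 0.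
  move=> ij; suff : I i j = - I i j by lra.
  rewrite {1}/I -(Rintegral_signed_perm 0 (pred1 i) 1%g (bsf_measurable (bg i j))).
  rewrite -[RHS]mulN1r -Rintegral_bsfZ//; apply: eq_Rintegral => x _.
  rewrite enorm_signed_perm !mxE !perm1 !add0r /= eqxx eq_sym (negbTE ij).
  by rewrite expr1 expr0; ring.
have diag i j : I i i = I j j.
  rewrite {1}/I -(Rintegral_signed_perm 0 xpred0 (tperm i j) (bsf_measurable (bg i i))).
  apply: eq_Rintegral => x _; rewrite enorm_signed_perm !mxE tpermL add0r expr0.
  by rewrite mul1r.
transitivity (\sum_i \sum_j a i j * I i j).
  rewrite (_ : (fun x : X => qform x * g (enorm x)) = fun x : X => \sum_i \sum_j
      a i j * (x ord0 i * x ord0 j * g (enorm x))); last first.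
    apply/funext => x; rewrite mulr_suml; apply: eq_bigr => i _.
    by rewrite mulr_suml; apply: eq_bigr => j _; ring.
  have sumR (J : finType) (F : J -> X -> R) : (forall j, bsf (F j)) ->
     bsf (fun x => \sum_j F j x) /\
     \int[leb]_x (\sum_j F j x) = \sum_j \int[leb]_x F j x.
    move=> bF; elim: (index_enum J) => [|j s [b IH]].
      rewrite (_ : (fun x => _) = fun=> 0); last by apply/funext => x; rewrite big_nil.
      by rewrite big_nil /Rintegral integral0; split => //; exact: bsf0.
    rewrite (_ : (fun x => _) = fun x => F j x + \sum_(j <- s) F j x).
      by rewrite big_cons Rintegral_bsfD// IH; split => //; exact: bsfD.
    by apply/funext => x; rewrite big_cons.
  have [_ ->] := sumR _ _ (fun i => (sumR _ _ (fun j => bsfZ (a i j) (bg i j))).1).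
  apply: eq_bigr => i _.
  have [_ ->] := sumR _ _ (fun j => bsfZ (a i j) (bg i j)).
  by apply: eq_bigr => j _; rewrite Rintegral_bsfZ.
transitivity (\sum_i a i i * I i i).
  apply: eq_bigr => i _; rewrite (bigD1 i)//= big1 ?addr0// => j ji.
  by rewrite off ?mulr0// eq_sym.
(* An index to compare with exists unless n = 0, when the sum is empty. *)
case: (pickP (@predT 'I_n)) => [i0 _|no]; last by rewrite big1// => i; have := no i.
under eq_bigr => i _ do rewrite (diag i i0).
by rewrite -mulr_suml -/(\tr a) tr0 mul0r.
Qed.

End quadratic_form.

(** * The Cotlar-Stein bound for convolution operators *)

Section bsfun.
Variables (R : realType) (n : nat).
Local Notation X := 'rV[R]_n.

Definition bsf_pred : {pred (X -> R)} := mem [set f | bsf f].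

Lemma bsf_predP f : (f \in bsf_pred) <-> bsf f.
Proof. by rewrite inE. Qed.

Lemma bsf_submod_closed : submod_closed bsf_pred.
Proof.
split; first by apply/bsf_predP; exact: bsf0.
by move=> a f g /bsf_predP bf /bsf_predP bg; apply/bsf_predP/bsfD => //; exact: bsfZ.
Qed.

HB.instance Definition _ :=
  GRing.isSubmodClosed.Build R (X -> R) bsf_pred bsf_submod_closed.

(** The vector space to which the abstract bound is applied. Its elements are functions rather than
    classes modulo null sets, as the form has only to be semidefinite. *)
Record bsfun := BSFun { bsfun_val :> X -> R; _ : bsfun_val \in bsf_pred }.

HB.instance Definition _ := [isSub for bsfun_val].
HB.instance Definition _ := [Choice of bsfun by <:].
HB.instance Definition _ := [SubChoice_isSubLmodule of bsfun by <:].

Lemma bsfunP (f : bsfun) : bsf f.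
Proof. by case: f => f /= /bsf_predP. Qed.

Definition mk_bsfun (f : X -> R) (bf : bsf f) : bsfun := BSFun ((bsf_predP f).2 bf).

End bsfun.

Section convol_cotlar_stein.
Variables (R : realType) (n : nat).
Local Notation X := 'rV[R]_n.
Variables (k : nat -> X -> R) (c : R).
Hypotheses (bk : forall j, bsf (k j)) (ek : forall j x, k j (- x) = k j x)
  (c0 : 0 < c)
  (kk_bound : forall i j, (i <= j)%N -> exists e r : R,
    [/\ 0 <= e, 0 <= r, forall x, `|convol (k i) (k j) x| <= e,
        forall x, r < `|x| -> convol (k i) (k j) x = 0 &
        e * (2 * r) ^+ n <= c * (2^-1 ^+ (j - i)) ^+ 3]).

(** Even kernels give symmetric operators, and convolutions commute. [kk_bound] bounds the L^1 norm
    of the convolution of two kernels, and with it the norm of the product of the two operators. *)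
Lemma convol_cotlar_stein (N : nat) (u : X -> R) : bsf u ->
  inner (convol (fun x => \sum_(j < N) k j x) u)
        (convol (fun x => \sum_(j < N) k j x) u) <=
  (162 * c ^+ 2 + 1) * inner u u.
Proof.
move=> bu.
pose T j (f : bsfun R n) : bsfun R n := mk_bsfun (bsf_convol (bk j) (bsfunP f)).
pose B (f g : bsfun R n) := inner f g.
have bm (f : bsfun R n) := bsf_bounded (bsfunP f).
have BC f g : B f g = B g f by apply: eq_Rintegral => x _; rewrite mulrC.
have BD f g h : B (f + g) h = B f h + B g h.
  rewrite /B /inner -Rintegral_bsfD; [|exact: bsfM (bm _) (bsfunP _)..].
  by apply: eq_Rintegral => x _; rewrite mulrDl.
have BZ a f g : B (a *: f) g = a * B f g.
  rewrite /B /inner -Rintegral_bsfZ; last exact: bsfM (bm _) (bsfunP _).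
  by apply: eq_Rintegral => x _; rewrite mulrA.
have B0 f : 0 <= B f f.
  by apply: Rintegral_ge0 => x _; rewrite -expr2 sqr_ge0.
have TD j f g : T j (f + g) = T j f + T j g.
  apply: val_inj; apply/funext => x.
  change (convol (k j) (fun y => f y + g y) x = convol (k j) f x + convol (k j) g x).
  rewrite /convol -Rintegral_bsfD; [|exact: bsf_convol_integrand (bsf_bounded (bk j)) (bsfunP _)..].
  by apply: eq_Rintegral => y _; rewrite mulrDr.
have Tsym j f g : B (T j f) g = B f (T j g).
  exact: inner_convol_sym (bsf_bounded (bk j)) (ek j) (bsfunP f) (bsfunP g).
have Tcom i j f : T i (T j f) = T j (T i f).
  apply: val_inj; change (convol (k i) (convol (k j) f) = convol (k j) (convol (k i) f)).
  rewrite !convolA ?(convolC (bk i) (bk j))//; exact: bsfunP.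
have Tbound0 i j f : (i <= j)%N -> B (T i (T j f)) (T i (T j f)) <=
    (c * (2^-1 ^+ `|i - j|%N) ^+ 3) ^+ 2 * B f f.
  move=> ij; have [e [r [e0 r0 ke kr ce]]] := kk_bound ij.
  rewrite (distnEr ij).
  apply: (form_bound BC BZ (f := fun f => T i (T j f))).
    by rewrite mulr_gt0// !exprn_gt0// invr_gt0.
  move=> g; have bkk := bsf_convol (bk i) (bk j).
  have -> : B (T i (T j f)) g = inner (convol (convol (k i) (k j)) f) g.
    by rewrite -convolA//; exact: bsfunP.
  apply: le_trans (convol_inner_bound bkk (bsfunP f) (bsfunP g) e0 r0 ke kr) _.
  rewrite ler_pM2r ?invr_gt0 ?ltr0n// ler_wpM2r//.
  by rewrite addr_ge0 ?(B0 f) ?(B0 g).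
have Tbound i j f : B (T i (T j f)) (T i (T j f)) <=
    (c * (2^-1 ^+ `|i - j|%N) ^+ 3) ^+ 2 * B f f.
  have [ij|/ltnW ji] := leqP i j; first exact: Tbound0.
  by rewrite Tcom distnC Tbound0.
have := commuting_cotlar_stein BC BD BZ B0 TD Tsym Tcom c0 Tbound N (mk_bsfun bu).
rewrite /B; suff -> : \sum_(j < N) T j (mk_bsfun bu) =
   convol (fun x => \sum_(j < N) k j x) u :> (X -> R) by [].
elim: N => [|N IH]; apply/funext => x.
  rewrite big_ord0 /convol; under eq_Rintegral do rewrite big_ord0 mul0r.
  by rewrite /Rintegral integral0.
rewrite big_ord_recr /=.
change (bsfun_val (\sum_(j < N) T j (mk_bsfun bu)) x + convol (k N) u x =
  convol (fun y => \sum_(j < N.+1) k j y) u x).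
rewrite IH /convol -Rintegral_bsfD.
- by apply: eq_Rintegral => y _; rewrite big_ord_recr /= mulrDl.
- suff bS : bsf (fun y => \sum_(j < N) k j y).
    exact: bsf_convol_integrand x (bsf_bounded bS) bu.
  elim: N {IH} => [|N IH].
    by rewrite (_ : (fun _ => _) = fun=> 0); [exact: bsf0|apply/funext => y; rewrite big_ord0].
  rewrite (_ : (fun _ => _) = fun y => \sum_(j < N) k j y + k N y); first exact: bsfD.
  by apply/funext => y; rewrite big_ord_recr.
- exact: bsf_convol_integrand (bsf_bounded (bk N)) bu.
Qed.

End convol_cotlar_stein.

(** * Regularized kernels and their dyadic bands *)

Section regularized_kernel.
Variables (R : realType) (n : nat) (a : 'M[R]_n).
Local Notation X := 'rV[R]_n.
Local Notation leb := (lebesgue_row R n).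
Implicit Types (x y : X) (e : R).

Definition cut_enorm e x : R := Num.max (enorm x) e.

Definition reg_kernel e x : R := qform a x / cut_enorm e x ^+ n.+2.

Definition lip_const : R := qsize a * (2 + n%:R * n.+2%:R).

Lemma lip_const_ge0 : 0 <= lip_const.
Proof. by rewrite mulr_ge0 ?qsize_ge0// addr_ge0// mulr_ge0. Qed.

Lemma cut_enorm_ge e x : e <= cut_enorm e x.
Proof. by rewrite le_max lexx orbT. Qed.

Lemma enorm_le_cut e x : enorm x <= cut_enorm e x.
Proof. by rewrite le_max lexx. Qed.

Lemma cut_enorm_gt0 e x : 0 < e -> 0 < cut_enorm e x.
Proof. by move=> e0; apply: lt_le_trans (cut_enorm_ge e x). Qed.

Lemma cut_enorm_dist e x y :
  cut_enorm e x - cut_enorm e y <= n%:R * `|x - y|.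
Proof.
have := enorm_dist x y; rewrite ler_norml => /andP[_ h].
rewrite lerBlDr /cut_enorm ge_max; apply/andP; split.
  by apply: (@le_trans _ _ (n%:R * `|x - y| + enorm y)); [lra|rewrite lerD2l le_max lexx].
by rewrite (@le_trans _ _ (cut_enorm e y)) ?cut_enorm_ge// lerDr mulr_ge0.
Qed.

Lemma measurable_cut_enorm e : measurable_fun setT (cut_enorm e).
Proof. by apply: measurable_maxr => //; exact: measurable_enorm. Qed.

Lemma measurable_div (f g : X -> R) k : measurable_fun setT f ->
  measurable_fun setT g -> (forall x, 0 <= g x) ->
  measurable_fun setT (fun x => f x / g x ^+ k).
Proof.
move=> mf mg g0; apply: measurable_funM => //.
under eq_fun do rewrite -exprVn; apply: measurable_funX.
under eq_fun do rewrite -powR_inv1//.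
exact: (measurableT_comp (@measurable_powR R (-1)) mg).
Qed.

Lemma measurable_reg_kernel e : 0 < e -> measurable_fun setT (reg_kernel e).
Proof.
move=> e0; apply: measurable_div; first exact: measurable_qform.
  exact: measurable_cut_enorm.
by move=> x; exact/ltW/cut_enorm_gt0.
Qed.

Lemma reg_kernelN e x : reg_kernel e (- x) = reg_kernel e x.
Proof. by rewrite /reg_kernel /cut_enorm qformN enormN. Qed.

Lemma div_cut_le (q M e : R) x : 0 < e -> 0 <= M -> `|q| <= M * enorm x ^+ 2 ->
  `|q / cut_enorm e x ^+ n.+2| <= M / cut_enorm e x ^+ n.
Proof.
move=> e0 M0 qM; have c0 := cut_enorm_gt0 x e0.
rewrite normrM [X in _ * X]gtr0_norm ?invr_gt0 ?exprn_gt0//.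
rewrite ler_pdivrMr ?exprn_gt0//; apply: le_trans qM _.
have -> : M / cut_enorm e x ^+ n * cut_enorm e x ^+ n.+2 = M * cut_enorm e x ^+ 2.
  by rewrite -addn2 exprD; field; rewrite expf_neq0 ?gt_eqF.
by rewrite ler_wpM2l// lerXn2r ?nnegrE ?enorm_ge0 ?(ltW c0)// enorm_le_cut.
Qed.

Lemma inv_cut_le e x k : 0 < e -> (cut_enorm e x ^+ k)^-1 <= (e ^+ k)^-1.
Proof.
move=> e0; rewrite lef_pV2 ?posrE ?exprn_gt0 ?cut_enorm_gt0//.
by rewrite lerXn2r ?nnegrE ?cut_enorm_ge// ltW// cut_enorm_gt0.
Qed.

Lemma reg_kernel_le e x : 0 < e -> `|reg_kernel e x| <= qsize a / cut_enorm e x ^+ n.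
Proof. by move=> e0; apply: div_cut_le => //; [exact: qsize_ge0|exact: qform_le]. Qed.

Lemma reg_kernel_bound e x : 0 < e -> `|reg_kernel e x| <= qsize a / e ^+ n.
Proof.
move=> e0; apply: le_trans (reg_kernel_le x e0) _.
by rewrite ler_wpM2l ?qsize_ge0 ?inv_cut_le.
Qed.

Lemma bounded_reg_kernel e : 0 < e -> bounded_measurable (reg_kernel e).
Proof.
move=> e0; split; first exact: measurable_reg_kernel.
by exists (qsize a / e ^+ n) => x; exact: reg_kernel_bound.
Qed.

(** This is the size of the gradient of a kernel of degree -n. By symmetry y may be the point with
    the smaller cut-off norm, as [qform_div_dist] wants it. *)
Lemma reg_kernel_dist e x y : 0 < e -> `|reg_kernel e x - reg_kernel e y| <=
  lip_const * `|x - y| / Num.min (cut_enorm e x) (cut_enorm e y) ^+ n.+1.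
Proof.
move=> e0; wlog yx : x y / cut_enorm e y <= cut_enorm e x => [hwlog|].
  have /orP[yx|xy] := le_total (cut_enorm e y) (cut_enorm e x); last first.
    by rewrite (distrC (reg_kernel e x)) (distrC x y) minC; exact: hwlog.
  exact: hwlog.
rewrite min_r//; apply: qform_div_dist => //; rewrite ?enorm_le_cut ?cut_enorm_gt0//.
exact: cut_enorm_dist.
Qed.

Lemma reg_kernel_lip e x y : 0 < e -> `|reg_kernel e x - reg_kernel e y| <=
  lip_const * `|x - y| / e ^+ n.+1.
Proof.
move=> e0; apply: le_trans (reg_kernel_dist x y e0) _.
apply: ler_wpM2l; first by rewrite mulr_ge0 ?lip_const_ge0.
have m0 : e <= Num.min (cut_enorm e x) (cut_enorm e y).
  by rewrite le_min !cut_enorm_ge.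
rewrite lef_pV2 ?posrE ?exprn_gt0 ?(lt_le_trans e0)//.
by rewrite lerXn2r ?nnegrE ?(ltW e0) ?(le_trans (ltW e0) m0).
Qed.

(** With the ratio 8, a gain e / d between two scales is the cube of a power of 1/2, which is the
    decay that the abstract bound asks for. *)
Definition band_kernel e x : R := reg_kernel e x - reg_kernel (8 * e) x.

Lemma band_kernelN e x : band_kernel e (- x) = band_kernel e x.
Proof. by rewrite /band_kernel !reg_kernelN. Qed.

Lemma cut_enorm_far e x : e < `|x| -> cut_enorm e x = enorm x.
Proof. by move=> ex; apply/max_l/ltW/(lt_le_trans ex)/norm_le_enorm. Qed.

Lemma band_kernel0 e x : 0 < e -> 8 * e < `|x| -> band_kernel e x = 0.
Proof.
move=> e0 ex; rewrite /band_kernel /reg_kernel !cut_enorm_far ?subrr//.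
by apply: le_lt_trans ex; lra.
Qed.

Lemma inv_expr8 e k : 0 < e -> ((8 * e) ^+ k)^-1 <= (e ^+ k)^-1.
Proof.
move=> e0; rewrite lef_pV2 ?posrE ?exprn_gt0 ?mulr_gt0//.
by rewrite lerXn2r ?nnegrE ?mulr_ge0 ?(ltW e0)//; lra.
Qed.

Lemma band_kernel_bound e x : 0 < e -> `|band_kernel e x| <= 2 * qsize a / e ^+ n.
Proof.
move=> e0; apply: le_trans (ler_normB _ _) _.
have e8 : 0 < 8 * e by rewrite mulr_gt0.
have -> : 2 * qsize a / e ^+ n = qsize a / e ^+ n + qsize a / e ^+ n by ring.
rewrite lerD ?reg_kernel_bound//; apply: le_trans (reg_kernel_bound x e8) _.
by rewrite ler_wpM2l ?qsize_ge0 ?inv_expr8.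
Qed.

Lemma band_kernel_lip e x y : 0 < e -> `|band_kernel e x - band_kernel e y| <=
  2 * lip_const * `|x - y| / e ^+ n.+1.
Proof.
move=> e0; have e8 : 0 < 8 * e by rewrite mulr_gt0.
have -> : band_kernel e x - band_kernel e y = (reg_kernel e x - reg_kernel e y) -
  (reg_kernel (8 * e) x - reg_kernel (8 * e) y) by rewrite /band_kernel; ring.
apply: le_trans (ler_normB _ _) _.
have -> : 2 * lip_const * `|x - y| / e ^+ n.+1 =
 lip_const * `|x - y| / e ^+ n.+1 + lip_const * `|x - y| / e ^+ n.+1 by ring.
rewrite lerD ?reg_kernel_lip//; apply: le_trans (reg_kernel_lip _ _ e8) _.
by rewrite ler_wpM2l ?inv_expr8// mulr_ge0 ?lip_const_ge0.
Qed.

(** Stated for any q of quadratic growth, because the symmetry argument of [Rintegral_qform_radial]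
    needs it for the monomials x_i x_j as well. *)
Lemma bsf_band_radial e (q : X -> R) (M : R) : 0 < e -> 0 <= M ->
  measurable_fun setT q -> (forall x, `|q x| <= M * enorm x ^+ 2) ->
  bsf (fun x => q x * ((cut_enorm e x ^+ n.+2)^-1 - (cut_enorm (8 * e) x ^+ n.+2)^-1)).
Proof.
move=> e0 M0 mq qM; have e8 : 0 < 8 * e by rewrite mulr_gt0.
have mdiv d : 0 < d -> measurable_fun setT (fun x => q x / cut_enorm d x ^+ n.+2).
  move=> d0; apply: measurable_div => //; first exact: measurable_cut_enorm.
  by move=> x; exact/ltW/cut_enorm_gt0.
split.
  by under eq_fun do rewrite mulrBr; apply: measurable_funB; exact: mdiv.
exists (2 * M / e ^+ n + 8 * e) => x; have M1 : 0 <= 2 * M / e ^+ n.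
  by rewrite divr_ge0 ?mulr_ge0// exprn_ge0// ltW.
split.
  apply: (@le_trans _ _ (2 * M / e ^+ n)); last by rewrite lerDl ltW.
  have -> : 2 * M / e ^+ n = M / e ^+ n + M / e ^+ n by ring.
  rewrite mulrBr; apply: le_trans (ler_normB _ _) _.
  apply: lerD.
    by apply: le_trans (div_cut_le e0 M0 (qM x)) _; rewrite ler_wpM2l// inv_cut_le.
  apply: le_trans (div_cut_le e8 M0 (qM x)) _; rewrite ler_wpM2l//.
  exact: le_trans (inv_cut_le _ _ e8) (inv_expr8 _ e0).
move=> h; rewrite !cut_enorm_far ?subrr ?mulr0//; lra.
Qed.

Lemma bsf_band_kernel e : 0 < e -> bsf (band_kernel e).
Proof.
move=> e0; rewrite (_ : band_kernel e = fun x => qform a x *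
  ((cut_enorm e x ^+ n.+2)^-1 - (cut_enorm (8 * e) x ^+ n.+2)^-1)).
  apply: (@bsf_band_radial _ _ (qsize a)) => //; first exact: qsize_ge0.
    exact: measurable_qform.
  by move=> x; exact: qform_le.
by apply/funext => x; rewrite mulrBr.
Qed.

Hypothesis tr0 : \tr a = 0.

Lemma Rintegral_band_kernel e : 0 < e -> \int[leb]_x band_kernel e x = 0.
Proof.
move=> e0.
pose g r : R := (Num.max r e ^+ n.+2)^-1 - (Num.max r (8 * e) ^+ n.+2)^-1.
rewrite -[RHS](Rintegral_qform_radial tr0 (g := g)).
  by apply: eq_Rintegral => x _; rewrite mulrBr.
move=> i j; apply: (@bsf_band_radial e _ 1) => //.
  by apply: measurable_funM; exact: measurable_coord.
by move=> x; rewrite normrM mul1r expr2 ler_pM// coord_le_enorm.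
Qed.

(** The band at scale e has integral 0, so the constant [band_kernel a d x] may be subtracted from
    the other factor. Over a support of radius 8 e the Lipschitz bound at scale d gains e / d; the
    other factors are the sup norm of the band at scale e and the volume of its support. *)
Lemma convol_band_kernel_le e d x : 0 < e -> 0 < d ->
  `|convol (band_kernel e) (band_kernel d) x| <=
  2 * lip_const * (8 * e) / d ^+ n.+1 * (2 * qsize a / e ^+ n) * (2 * (8 * e)) ^+ n.
Proof.
move=> e0 d0; have be := bsf_band_kernel e0; have bd := bsf_band_kernel d0.
have e8 : 0 <= 8 * e by rewrite mulr_ge0// ltW.
rewrite (convolC be bd).
have bi : bsf (fun y => band_kernel d (x - y) * band_kernel e y).
  by apply: bsf_convol_integrand => //; exact: bsf_bounded.
have -> : convol (band_kernel d) (band_kernel e) x =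
   \int[leb]_y ((band_kernel d (x - y) - band_kernel d x) * band_kernel e y).
  under [RHS]eq_Rintegral do rewrite mulrBl.
  rewrite Rintegral_bsfB//; last exact: bsfZ.
  by rewrite Rintegral_bsfZ// Rintegral_band_kernel// mulr0 subr0.
apply: bsf_bound => //.
- under eq_fun do rewrite mulrBl; apply: bsfB => //; exact: bsfZ.
- rewrite !mulr_ge0 ?lip_const_ge0 ?qsize_ge0 ?invr_ge0 ?exprn_ge0// ltW//.
- move=> y; have [ye|ye] := ltP (8 * e) `|y|.
    rewrite (band_kernel0 e0 ye) mulr0 normr0 !mulr_ge0 ?lip_const_ge0//
      ?qsize_ge0 ?invr_ge0 ?exprn_ge0// ltW//.
  rewrite normrM ler_pM ?band_kernel_bound//.
  apply: le_trans (band_kernel_lip _ _ d0) _.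
  rewrite ler_wpM2r ?invr_ge0 ?exprn_ge0 ?(ltW d0)//.
  have dxy : `|x - y - x| <= 8 * e by rewrite addrAC subrr add0r normrN.
  by apply: ler_wpM2l => //; apply: mulr_ge0 => //; exact: lip_const_ge0.
- by move=> y ye; rewrite (band_kernel0 e0 ye) mulr0.
Qed.

Lemma convol_band_kernel0 e d x : 0 < e -> e <= d -> 16 * d < `|x| ->
  convol (band_kernel e) (band_kernel d) x = 0.
Proof.
move=> e0 ed dx; rewrite /convol [LHS](_ : _ = \int[leb]_y 0).
  by rewrite /Rintegral integral0.
apply: eq_Rintegral => y _; have d0 : 0 < d by exact: lt_le_trans ed.
have [yd|yd] := ltP (8 * d) `|y|; first by rewrite (band_kernel0 d0 yd) mulr0.
by rewrite band_kernel0 ?mul0r//; have := lerB_dist x y; lra.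
Qed.

(** The constants of [convol_band_kernel_le], with 16^n from the support of the finer band, times
    32^n for the radius 16 d of the support of the convolution; adding 1 makes the sum positive. *)
Definition cz_const : R :=
  2 * lip_const * 8 * (2 * qsize a) * 16 ^+ n * 32 ^+ n + 1.

Definition cz_bound : R := 162 * cz_const ^+ 2 + 1.

Lemma band_sum_L2_bound e N (u : X -> R) : 0 < e -> bsf u ->
  inner (convol (fun x => reg_kernel e x - reg_kernel (8 ^+ N * e) x) u)
        (convol (fun x => reg_kernel e x - reg_kernel (8 ^+ N * e) x) u) <=
  cz_bound * inner u u.
Proof.
move=> e0 bu; have e8 j : 0 < 8 ^+ j * e by rewrite mulr_gt0// exprn_gt0.
pose k j : X -> R := band_kernel (8 ^+ j * e).
have bk j : bsf (k j) by exact: bsf_band_kernel.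
have ek j x : k j (- x) = k j x by exact: band_kernelN.
have cz0 : 0 <= 2 * lip_const * 8 * (2 * qsize a) * 16 ^+ n * 32 ^+ n.
  by rewrite !mulr_ge0 ?lip_const_ge0 ?qsize_ge0 ?exprn_ge0.
have c0 : 0 < cz_const by rewrite /cz_const; lra.
have kk i j : (i <= j)%N -> exists c r : R,
    [/\ 0 <= c, 0 <= r, forall x, `|convol (k i) (k j) x| <= c,
        forall x, r < `|x| -> convol (k i) (k j) x = 0 &
        c * (2 * r) ^+ n <= cz_const * (2^-1 ^+ (j - i)) ^+ 3].
  move=> ij; pose ei : R := 8 ^+ i * e; pose ej : R := 8 ^+ j * e.
  have ei0 : 0 < ei by exact: e8. have ej0 : 0 < ej by exact: e8.
  exists (2 * lip_const * (8 * ei) / ej ^+ n.+1 * (2 * qsize a / ei ^+ n) * (2 * (8 * ei)) ^+ n).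
  exists (16 * ej); split.
  - rewrite !mulr_ge0 ?lip_const_ge0 ?qsize_ge0 ?invr_ge0 ?exprn_ge0 ?mulr_ge0// ltW//.
  - by rewrite mulr_ge0// ltW.
  - by move=> x; exact: convol_band_kernel_le.
  - move=> x; apply: convol_band_kernel0 => //.
    by rewrite /ei /ej ler_pM2r// ler_eXn2l//; lra.
  have -> : (2^-1 ^+ (j - i)) ^+ 3 = ei / ej.
    rewrite -exprM mulnC exprM (_ : 2^-1 ^+ 3 = 8^-1 :> R); last by rewrite exprVn; congr _^-1; ring.
    rewrite /ei /ej -[in RHS](subnKC ij) exprD exprVn.
    by field; rewrite !expf_neq0 ?gt_eqF.
  have -> : 2 * (16 * ej) = 32 * ej by ring.
  have -> : 2 * (8 * ei) = 16 * ei by ring.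
  clearbody ei ej; rewrite [(32 * ej) ^+ n]exprMn [(16 * ei) ^+ n]exprMn (exprS ej).
  apply: (@le_trans _ _ (2 * lip_const * 8 * (2 * qsize a) * 16 ^+ n * 32 ^+ n * (ei / ej))).
    rewrite le_eqVlt; apply/orP; left; apply/eqP.
    by field; rewrite !expf_neq0 ?gt_eqF.
  by rewrite ler_wpM2r ?divr_ge0 ?(ltW ei0) ?(ltW ej0)// /cz_const lerDl.
have := convol_cotlar_stein bk ek c0 kk N bu.
suff -> : (fun x => \sum_(j < N) k j x) =
  (fun x => reg_kernel e x - reg_kernel (8 ^+ N * e) x) by [].
apply/funext => x; elim: N => [|N IH].
  by rewrite big_ord0 expr0 mul1r subrr.
by rewrite big_ord_recr IH /= /k /band_kernel exprS mulrA addrA subrK.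
Qed.

End regularized_kernel.

(** * L2 bounds for truncated singular integrals *)

Lemma fatou_le d (T : measurableType d) (R : realType)
    (mu : {measure set T -> \bar R}) (g : nat -> T -> R) (g_lim : T -> R) (C : \bar R) :
  (forall k, measurable_fun setT (g k)) -> measurable_fun setT g_lim ->
  (forall k x, 0 <= g k x) -> (forall x, 0 <= g_lim x) ->
  {ae mu, forall x, g k x @[k --> \oo] --> g_lim x} ->
  (forall k, \int[mu]_x (g k x)%:E <= C)%E ->
  (\int[mu]_x (g_lim x)%:E <= C)%E.
Proof.
move=> mg ml g0 l0 [N [mN N0 Nsub]] gC.
(* Multiplication by the indicator of the complement of the exceptional set makes the convergence
   hold everywhere. *)
pose h k x := g k x * \1_(~` N) x; pose h_lim x := g_lim x * \1_(~` N) x.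
have m1 : measurable_fun setT (\1_(~` N) : T -> R) by apply: measurable_indic; exact: measurableC.
have mh k : measurable_fun setT (h k) by exact: measurable_funM.
have mhl : measurable_fun setT h_lim by exact: measurable_funM.
have h0 k x : 0 <= h k x by rewrite mulr_ge0.
have hl0 x : 0 <= h_lim x by rewrite mulr_ge0.
have -> : (\int[mu]_x (g_lim x)%:E = \int[mu]_x (h_lim x)%:E)%E.
  apply: ge0_ae_eq_integral => //; try exact/measurable_EFinP.
  - by move=> x _; rewrite lee_fin.
  - by move=> x _; rewrite lee_fin.
  exists N; split => // x /= xh; apply: contrapT => xN; apply: xh => _.
  by rewrite /h_lim indicE mem_set// mulr1.
have hC k : (\int[mu]_x (h k x)%:E <= C)%E.
  apply: le_trans (gC k); apply: ge0_le_integral => //; try exact/measurable_EFinP.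
  - by move=> x _; rewrite lee_fin.
  - by move=> x _; rewrite lee_fin /h indicE; case: (_ \in _); rewrite ?mulr1 ?mulr0.
have hcvg x : h k x @[k --> \oo] --> h_lim x.
  rewrite /h /h_lim; have [xN|xN] := pselect (N x).
    rewrite indicE memNset ?mulr0; last by [].
    by under eq_fun do rewrite mulr0; exact: cvg_cst.
  apply: cvgMr_tmp; have : (fun x => g k x @[k --> \oo] --> g_lim x) x; last by [].
  by apply: contrapT => /Nsub.
apply: (@le_trans _ _ (\int[mu]_x (limn_einf (fun k => (h k x)%:E)))%E).
  rewrite le_eqVlt; apply/orP; left; apply/eqP; apply: eq_integral => x _.
  have c : (h k x)%:E @[k --> \oo] --> (h_lim x)%:E by apply: cvg_EFin; [exact: nearW|exact: hcvg].
  by rewrite is_cvg_limn_einfE; [exact/esym/cvg_lim|apply/cvg_ex; eexists; exact: c].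
apply: le_trans (fatou mu measurableT (f := fun k x => (h k x)%:E) _ _) _.
- by move=> k; exact/measurable_EFinP.
- by move=> k x _; rewrite lee_fin.
rewrite limn_einf_lim; apply: lime_le; first exact: is_cvg_einfs.
apply: nearW => k; apply: le_trans (hC k).
by apply: ereal_inf_lbound; exists k => //=.
Qed.

Section L2_bound.
Variables (R : realType) (n : nat).
Local Notation X := 'rV[R]_n.
Local Notation leb := (lebesgue_row R n).

Definition L2sq (u : X -> R) : \bar R := (\int[leb]_x ((u x) ^+ 2)%:E)%E.

Lemma L2sq_bsf u : bsf u -> L2sq u = (inner u u)%:E.
Proof.
move=> bu; rewrite EFin_Rintegral; last by apply: bsfM => //; exact: bsf_bounded.
by apply: eq_integral => x _; rewrite expr2.
Qed.

Lemma L2sq_fatou (g : nat -> X -> R) (g_lim : X -> R) (C : \bar R) :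
  (forall k, measurable_fun setT (g k)) -> measurable_fun setT g_lim ->
  {ae leb, forall x, g k x @[k --> \oo] --> g_lim x} ->
  (forall k, L2sq (g k) <= C)%E -> (L2sq g_lim <= C)%E.
Proof.
move=> mg ml [N [mN N0 Nsub]] gC.
apply: (@fatou_le _ _ _ leb (fun k x => g k x ^+ 2)) => //.
- by move=> k; exact: measurable_funX.
- exact: measurable_funX.
- by move=> k x; exact: sqr_ge0.
- by move=> x; exact: sqr_ge0.
exists N; split => // x /= nx; apply: Nsub => /= gx; apply: nx.
by rewrite expr2; under eq_fun do rewrite expr2; exact: cvgM.
Qed.

Lemma L2sqD (f g : X -> R) : measurable_fun setT f -> measurable_fun setT g ->
  (L2sq (fun x => f x + g x)%R <= 2%:E * (L2sq f + L2sq g))%E.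
Proof.
move=> mf mg; rewrite /L2sq -ge0_integralD//; last 4 first.
- by move=> x _; rewrite lee_fin sqr_ge0.
- exact/measurable_EFinP/measurable_funX.
- by move=> x _; rewrite lee_fin sqr_ge0.
- exact/measurable_EFinP/measurable_funX.
rewrite -ge0_integralZl_EFin//; last 2 first.
- by move=> x _; rewrite lee_fin addr_ge0// sqr_ge0.
- by apply/measurable_EFinP/measurable_funD; exact: measurable_funX.
apply: ge0_le_integral => //.
- by move=> x _; rewrite lee_fin sqr_ge0.
- exact/measurable_EFinP/measurable_funX/measurable_funD.
- apply/measurable_EFinP/measurable_funM => //.
  by apply: measurable_funD; exact: measurable_funX.
move=> x _; rewrite lee_fin.
have : (0 <= (f x - g x) ^+ 2)%R by exact: sqr_ge0.
nra.
Qed.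

Lemma L2sqN (f : X -> R) : L2sq (fun x => - f x) = L2sq f.
Proof. by apply: eq_integral => x _; rewrite sqrrN. Qed.

(* By duality: bound <f * u, v> for v proportional to f * u. *)
Lemma convol_L2_bound (f u : X -> R) (c r : R) : bsf f -> bsf u -> 0 <= c ->
  0 <= r -> (forall x, `|f x| <= c) -> (forall x, r < `|x| -> f x = 0) ->
  inner (convol f u) (convol f u) <= (c * (2 * r) ^+ n + 1) ^+ 2 * inner u u.
Proof.
(* Adding 1 makes b positive, so that the test function b^-1 * w makes sense. *)
move=> bf bu c0 r0 fc fr; pose b := c * (2 * r) ^+ n + 1.
have cr0 : 0 <= c * (2 * r) ^+ n by rewrite mulr_ge0// exprn_ge0// mulr_ge0.
have b0 : 0 < b by rewrite /b; lra.
have bc := bsf_convol bf bu; set w := convol f u in bc *.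
have sq0 g : 0 <= inner g g by apply: Rintegral_ge0 => x _; rewrite -expr2 sqr_ge0.
have := convol_inner_bound bf bu (bsfZ b^-1 bc) c0 r0 fc fr; rewrite -/w.
have bww : bsf (fun x => w x * w x) by apply: bsfM => //; exact: bsf_bounded.
have -> : inner w (fun x => b^-1 * w x) = b^-1 * inner w w.
  by rewrite -Rintegral_bsfZ//; apply: eq_Rintegral => x _; ring.
have -> : inner (fun x => b^-1 * w x) (fun x => b^-1 * w x) = b^-1 * (b^-1 * inner w w).
  rewrite -!Rintegral_bsfZ//; last exact: bsfZ.
  by apply: eq_Rintegral => x _; ring.
move=> /ler_normlW h.
have {}h : b^-1 * inner w w <= b * (inner u u + b^-1 * (b^-1 * inner w w)) / 2.
  apply: le_trans h _; rewrite ler_pM2r ?invr_gt0//.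
  apply: ler_wpM2r; last by rewrite /b; lra.
  apply: addr_ge0; first exact: sq0.
  by rewrite !mulr_ge0 ?invr_ge0 ?(ltW b0)//; exact: sq0.
have := ler_wpM2l (ltW b0) h; rewrite mulVKf ?gt_eqF//.
have -> : b * (b * (inner u u + b^-1 * (b^-1 * inner w w)) / 2) =
  (b ^+ 2 * inner u u + inner w w) / 2 by field; exact: lt0r_neq0.
rewrite -/b; lra.
Qed.

Hypothesis n0 : (0 < n)%N.

Lemma cvg_expr_inv8 (c : R) : 0 < c -> (c * (8 ^+ N)^-1) @[N --> \oo] --> (0 : R).
Proof.
move=> c0; rewrite -[0 in X in _ --> X](mulr0 c); apply: cvgMl_tmp.
under eq_fun do rewrite -exprVn; apply: cvg_expr.
by rewrite ger0_norm ?invr_ge0// invf_lt1// ltr1n.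
Qed.

Variable a : 'M[R]_n.

(** The kernel at scale 8^N e is at most [qsize a] / (8^N e)^n everywhere, which tends to 0 as n >
    0, and u is integrable. *)
Lemma convol_reg_kernel_cvg e u x : 0 < e -> bsf u ->
  convol (fun y => reg_kernel a e y - reg_kernel a (8 ^+ N * e) y) u x @[N --> \oo]
    --> convol (reg_kernel a e) u x.
Proof.
move=> e0 bu; have e8 j : 0 < 8 ^+ j * e by rewrite mulr_gt0// exprn_gt0.
have bk d : 0 < d -> bsf (fun y => reg_kernel a d (x - y) * u y).
  by move=> d0; exact: bsf_convol_integrand x (bounded_reg_kernel a d0) bu.
pose I := \int[leb]_y `|u y|.
have I0 : 0 <= I by exact: Rintegral_ge0.
have d_le N : `|convol (reg_kernel a e) u x -
   convol (fun y => reg_kernel a e y - reg_kernel a (8 ^+ N * e) y) u x| <=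
   qsize a / e ^+ n * I * (8 ^+ N)^-1.
  rewrite /convol -Rintegral_bsfB; last 2 first.
  - exact: bk.
  - by under eq_fun do rewrite mulrBl; apply: bsfB; exact: bk.
  under eq_Rintegral do rewrite -mulrBl opprB addrC subrK.
  apply: le_trans (le_normr_Rintegral _ _) _ => //; first exact: bsf_integrable (bk _ (e8 N)).
  rewrite mulrAC -Rintegral_bsfZ; last exact: bsf_abs.
  apply: le_Rintegral_bsf; first exact: bsf_abs (bk _ (e8 N)).
    by apply: bsfZ; exact: bsf_abs.
  move=> y; rewrite normrM ler_wpM2r//.
  apply: le_trans (reg_kernel_bound a _ (e8 N)) _.
  rewrite -mulrA ler_wpM2l ?qsize_ge0// exprMn invfM mulrC ler_wpM2l//.
    by rewrite invr_ge0 exprn_ge0// ltW.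
  rewrite lef_pV2 ?posrE ?exprn_gt0// -exprM ler_eXn2l//; last by rewrite ltr1n.
  by rewrite leq_pmulr.
apply/cvgrPdist_le => d d0.
have C0 : 0 < qsize a / e ^+ n * I + 1.
  by rewrite ltr_wpDl// mulr_ge0// divr_ge0 ?qsize_ge0// exprn_ge0// ltW.
have /cvgrPdist_le/(_ d d0) := cvg_expr_inv8 C0.
apply: filterS => N; rewrite sub0r normrN ger0_norm; last first.
  by rewrite mulr_ge0 ?(ltW C0)// invr_ge0 exprn_ge0.
apply: le_trans; apply: le_trans (d_le N) _; apply: ler_wpM2r.
  by rewrite invr_ge0 exprn_ge0.
by rewrite lerDl.
Qed.

Hypothesis tr0 : \tr a = 0.

(** The bound for a sum of bands does not depend on their number, so Fatou's lemma removes the outer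
    scale. *)
Lemma reg_kernel_L2_bound e u : 0 < e -> bsf u ->
  (L2sq (convol (reg_kernel a e) u) <= (cz_bound a * inner u u)%:E)%E.
Proof.
move=> e0 bu; have e8 j : 0 < 8 ^+ j * e by rewrite mulr_gt0// exprn_gt0.
apply: (L2sq_fatou (g := fun N => convol (fun y =>
    reg_kernel a e y - reg_kernel a (8 ^+ N * e) y) u)).
- move=> N; apply: measurable_convol; last by case: bu.
  by apply: measurable_funB; exact: measurable_reg_kernel.
- by apply: measurable_convol; [exact: measurable_reg_kernel|case: bu].
- by apply: aeW => x; exact: convol_reg_kernel_cvg.
move=> N; have bb : bsf (fun y => reg_kernel a e y - reg_kernel a (8 ^+ N * e) y).
  elim: N => [|N IH].
    rewrite (_ : (fun _ => _) = fun=> 0); first exact: bsf0.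
    by apply/funext => y; rewrite expr0 mul1r subrr.
  rewrite (_ : (fun _ => _) = fun y => (reg_kernel a e y - reg_kernel a (8 ^+ N * e) y)
    + band_kernel a (8 ^+ N * e) y); first exact: bsfD IH (bsf_band_kernel a (e8 N)).
  by apply/funext => y; rewrite /band_kernel exprS mulrA addrA subrK.
by rewrite L2sq_bsf ?lee_fin; [exact: band_sum_L2_bound|exact: bsf_convol].
Qed.

End L2_bound.

Lemma Rintegral_dominated_cvg d (T : measurableType d) (R : realType)
    (mu : {measure set T -> \bar R}) (f : nat -> T -> R) (f_lim G : T -> R) :
  (forall k, measurable_fun setT (f k)) -> measurable_fun setT f_lim ->
  (forall x, f k x @[k --> \oo] --> f_lim x) ->
  mu.-integrable setT (EFin \o G) -> (forall k x, `|f k x| <= G x) ->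
  \int[mu]_x f k x @[k --> \oo] --> \int[mu]_x f_lim x.
Proof.
move=> mf ml fl iG fG.
have mf' k : measurable_fun setT (EFin \o f k) by exact/measurable_EFinP.
have ml' : measurable_fun setT (EFin \o f_lim) by exact/measurable_EFinP.
have fl' : {ae mu, forall x, setT x -> (EFin \o f k) x @[k --> \oo] --> (EFin \o f_lim) x}.
  by apply: aeW => x _; apply: cvg_EFin; [exact: nearW|exact: fl].
have fG' : {ae mu, forall x k, setT x -> (`|(EFin \o f k) x| <= (EFin \o G) x)%E}.
  by apply: aeW => x k _; rewrite lee_fin.
have [il _ cv] := dominated_convergence measurableT mf' ml' fl' iG fG'.
by apply: fine_cvg; rewrite fineK//; exact: integrable_fin_num il.
Qed.

(** * Sharp truncations on L^2 *)

Section truncation.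
Variables (R : realType) (n : nat).
Local Notation X := 'rV[R]_n.
Local Notation leb := (lebesgue_row R n).

(** Outside the cube of radius 2^N e the integrand is at most (2^N e)^(-n-1), and the next cube has
    volume (4 * 2^N e)^n, so each doubling adds at most 2^-N * 4^n / e. *)
Lemma integral_inv_cut_enorm (e : R) : 0 < e ->
  (\int[leb]_x ((cut_enorm e x ^+ n.+1)^-1)%:E <= (3 * 4 ^+ n / e)%:E)%E.
Proof.
move=> e0; pose f (x : X) : R := (cut_enorm e x ^+ n.+1)^-1.
have f0 x : 0 <= f x by rewrite invr_ge0 exprn_ge0// ltW// cut_enorm_gt0.
have mf : measurable_fun setT f.
  rewrite (_ : f = fun x => 1 / cut_enorm e x ^+ n.+1); last first.
    by apply/funext => x; rewrite div1r.
  apply: measurable_div => //; first exact: measurable_cut_enorm.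
  by move=> x; exact/ltW/cut_enorm_gt0.
pose A N : set X := cube (2 ^+ N * e).
have r0 N : 0 < 2 ^+ N * e by rewrite mulr_gt0// exprn_gt0.
have mA N : measurable (A N) by exact: measurable_cube.
pose g N x := f x * \1_(A N) x.
have b1 N : bsf (\1_(A N) : X -> R).
  split; first exact: measurable_indic.
  exists (Num.max 1 (2 ^+ N * e)) => x; rewrite indicE; split.
    by case: (_ \in _); rewrite ?normr1 ?normr0 le_max ?lexx ?ler01.
  rewrite gt_max => /andP[_ h]; rewrite memNset// => /cubeE => /(_ (ltW (r0 N))).
  by rewrite leNgt h.
have fb : bounded_measurable f.
  split => //; exists (e ^+ n.+1)^-1 => x; rewrite ger0_norm//; exact: inv_cut_le.
have bg N : bsf (g N) by exact: bsfM.
have int1 N : \int[leb]_x (\1_(A N) x) = (2 * (2 ^+ N * e)) ^+ n.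
  rewrite /Rintegral integral_indic// setIT.
  by have := congr1 fine (lebesgue_cube n (ltW (r0 N))).
have AP N x : A N x <-> `|x| <= 2 ^+ N * e by exact/cubeE/ltW.
(* 3 - 2 * 2^-N is 1, for the first cube, plus the sum of 2^-k over k < N. *)
have step N : \int[leb]_x g N x <= 4 ^+ n / e * (3 - 2 * (2 ^+ N)^-1).
  elim: N => [|N IH].
    apply: (@le_trans _ _ (\int[leb]_x ((e ^+ n.+1)^-1 * \1_(A 0%N) x))).
      apply: le_Rintegral_bsf => //; first exact: bsfZ.
      by move=> x; rewrite ler_wpM2r// inv_cut_le.
    rewrite Rintegral_bsfZ// int1 expr0 mul1r invr1 exprMn exprS invfM.
    have -> : e^-1 / e ^+ n * (2 ^+ n * e ^+ n) = 2 ^+ n / e.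
      by field; rewrite expf_neq0 gt_eqF.
    have -> : 3 - 2 * 1 = 1 :> R by ring.
    by rewrite mulr1 ler_pM2r ?invr_gt0// lerXn2r ?nnegrE//; lra.
  apply: (@le_trans _ _ (\int[leb]_x (g N x + ((2 ^+ N * e) ^+ n.+1)^-1 * \1_(A N.+1) x))).
    apply: le_Rintegral_bsf => //; first by apply: bsfD => //; exact: bsfZ.
    move=> x; rewrite /g !indicE.
    have [xN|xN] := pselect (A N x).
      rewrite !mem_set ?mulr1//; last first.
        apply/AP; apply: le_trans ((AP _ _).1 xN) _; rewrite ler_pM2r// exprS.
        by rewrite ler_peMl// ?exprn_ge0//; lra.
      by rewrite lerDl invr_ge0 exprn_ge0// ltW.
    rewrite (memNset xN) mulr0 add0r ler_wpM2r//.
    rewrite lef_pV2 ?posrE ?exprn_gt0 ?cut_enorm_gt0//.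
    rewrite lerXn2r ?nnegrE ?(ltW (r0 N)) ?(ltW (cut_enorm_gt0 x e0))//.
    apply: le_trans (enorm_le_cut _ _); apply: le_trans (norm_le_enorm _).
    by rewrite leNgt; apply/negP => h; apply: xN; apply/AP/ltW.
  rewrite Rintegral_bsfD//; last exact: bsfZ.
  rewrite Rintegral_bsfZ// int1.
  have -> : ((2 ^+ N * e) ^+ n.+1)^-1 * (2 * (2 ^+ N.+1 * e)) ^+ n =
     4 ^+ n / e * (2 ^+ N)^-1.
    have -> : 2 * (2 ^+ N.+1 * e) = 4 * (2 ^+ N * e) by rewrite exprS; ring.
    rewrite [(4 * _) ^+ n]exprMn (exprS (2 ^+ N * e)).
    by field; rewrite !expf_neq0 ?mulf_neq0 ?expf_neq0 ?gt_eqF.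
  have -> : (2 ^+ N.+1)^-1 = 2^-1 * (2 ^+ N)^-1 :> R by rewrite exprS invfM.
  by apply: le_trans (lerD IH (lexx _)) _; lra.
apply: (@fatou_le _ _ _ leb g) => //.
- by move=> N; case: (bg N).
- by move=> N x; rewrite /g mulr_ge0// indicE.
- apply: aeW => x; apply: cvg_near_cst.
  exists (Num.truncn (`|x| / e)).+1 => // N /= hN; rewrite /g indicE mem_set ?mulr1//.
  apply/AP; rewrite -ler_pdivrMr//; apply: le_trans (ltW (truncnS_gt _)) _.
  apply: (@le_trans _ _ N%:R); first by rewrite ler_nat.
  by rewrite -natrX ler_nat ltnW// ltn_expl.
move=> N; rewrite -EFin_Rintegral// lee_fin; apply: le_trans (step N) _.
have -> : 3 * 4 ^+ n / e = 4 ^+ n / e * 3 by ring.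
rewrite ler_wpM2l ?divr_ge0 ?exprn_ge0 ?(ltW e0)//.
by rewrite gerBl mulr_ge0 ?invr_ge0 ?exprn_ge0.
Qed.

Variable a : 'M[R]_n.
Hypothesis n0 : (0 < n)%N.

(** The square decays like the power -2 n of the norm, and 2 n >= n + 1. It follows that the
    convolution with an L^2 function converges absolutely at every point. *)
Lemma L2sq_reg_kernel (e : R) : 0 < e -> (L2sq (reg_kernel a e) < +oo)%E.
Proof.
move=> e0; pose c := qsize a ^+ 2 / e ^+ n.-1.
have c0 : 0 <= c by rewrite divr_ge0 ?sqr_ge0 ?exprn_ge0 ?(ltW e0).
have mi : measurable_fun setT (fun x : X => (cut_enorm e x ^+ n.+1)^-1).
  rewrite (_ : (fun _ => _) = fun x => 1 / cut_enorm e x ^+ n.+1); last first.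
    by apply/funext => x; rewrite div1r.
  apply: measurable_div => //; first exact: measurable_cut_enorm.
  by move=> x; exact/ltW/cut_enorm_gt0.
have i0 (x : X) : 0 <= (cut_enorm e x ^+ n.+1)^-1.
  by rewrite invr_ge0 exprn_ge0// ltW// cut_enorm_gt0.
apply: (@le_lt_trans _ _ (\int[leb]_x (c%:E * ((cut_enorm e x ^+ n.+1)^-1)%:E))%E).
  apply: ge0_le_integral => //.
  - by move=> x _; rewrite lee_fin sqr_ge0.
  - by apply/measurable_EFinP; apply: measurable_funX; exact: measurable_reg_kernel.
  - by apply/measurable_EFinP; exact: measurable_funM.
  move=> x _; rewrite -EFinM lee_fin -[leLHS]real_normK ?num_real//.
  have k0 := cut_enorm_gt0 x e0.
  apply: (@le_trans _ _ ((qsize a / cut_enorm e x ^+ n) ^+ 2)).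
    by rewrite lerXn2r ?nnegrE ?reg_kernel_le// divr_ge0 ?qsize_ge0 ?exprn_ge0 ?(ltW k0).
  rewrite /c expr_div_n -[leRHS]mulrA ler_wpM2l ?sqr_ge0// -invfM lef_pV2 ?posrE ?mulr_gt0 ?exprn_gt0//.
  have -> : (cut_enorm e x ^+ n) ^+ 2 = cut_enorm e x ^+ n.-1 * cut_enorm e x ^+ n.+1.
    by rewrite -exprM -exprD; congr (_ ^+ _); lia.
  rewrite ler_pM2r ?exprn_gt0// lerXn2r ?nnegrE ?(ltW e0) ?(ltW k0)//.
  exact: cut_enorm_ge.
rewrite ge0_integralZl_EFin//; last 2 first.
- by move=> x _; rewrite lee_fin.
- exact/measurable_EFinP.
apply: (@le_lt_trans _ _ (c%:E * (3 * 4 ^+ n / e)%:E)%E); last by rewrite -EFinM ltry.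
by rewrite lee_wpmul2l ?lee_fin// integral_inv_cut_enorm.
Qed.

Definition far (e : R) : set X := [set x | e < enorm x].

Lemma measurable_far e : measurable (far e).
Proof.
rewrite (_ : far e = @enorm R n @^-1` `]e, +oo[).
  by rewrite -[X in measurable X]setTI; exact: measurable_enorm.
by apply/seteqP; split => x /=; rewrite in_itv/= andbT.
Qed.

(** This is K cut off to |x| > e, where the regularization is inactive. In this form its difference
    from [reg_kernel] visibly lives on the ball of radius e. *)
Definition sharp_kernel e x : R := reg_kernel a e x * \1_(far e) x.

Lemma sharp_kernel_le e x : `|sharp_kernel e x| <= `|reg_kernel a e x|.
Proof.
by rewrite /sharp_kernel indicE; case: (_ \in _); rewrite ?mulr1 ?mulr0 ?normr0.
Qed.

Lemma measurable_sharp_kernel e : 0 < e -> measurable_fun setT (sharp_kernel e).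
Proof.
move=> e0; apply: measurable_funM; first exact: measurable_reg_kernel.
by apply: measurable_indic; exact: measurable_far.
Qed.

(** The outer 2 is that of [L2sqD]. The second term is [convol_L2_bound] for the difference from the
    regularized kernel: its bound [qsize a] / e^n times the volume (2 e)^n no longer contains e. *)
Definition sharp_bound : R := 2 * (cz_bound a + (qsize a * 2 ^+ n + 1) ^+ 2).

Hypothesis tr0 : \tr a = 0.

Lemma sharp_kernel_bsf_bound e u : 0 < e -> bsf u ->
  (L2sq (convol (sharp_kernel e) u) <= (sharp_bound * inner u u)%:E)%E.
Proof.
move=> e0 bu; pose D x := sharp_kernel e x - reg_kernel a e x.
have Dfar x : far e x -> D x = 0.
  by move=> fx; rewrite /D /sharp_kernel indicE mem_set// mulr1 subrr.
have Dnear x : ~ far e x -> D x = - reg_kernel a e x.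
  by move=> fx; rewrite /D /sharp_kernel indicE memNset// mulr0 sub0r.
have Dle x : `|D x| <= qsize a / e ^+ n.
  have [fx|fx] := pselect (far e x); last by rewrite Dnear// normrN reg_kernel_bound.
  by rewrite Dfar// normr0 divr_ge0 ?qsize_ge0 ?exprn_ge0 ?(ltW e0).
have D0 x : e < `|x| -> D x = 0.
  by move=> ex; apply: Dfar; exact: lt_le_trans ex (norm_le_enorm x).
have mD : measurable_fun setT D.
  by apply: measurable_funB; [exact: measurable_sharp_kernel|exact: measurable_reg_kernel].
have c0 : 0 <= qsize a / e ^+ n by rewrite divr_ge0 ?qsize_ge0 ?exprn_ge0 ?(ltW e0).
have bD : bsf D.
  split => //; exists (qsize a / e ^+ n + e) => x; split.
    by apply: le_trans (Dle x) _; rewrite lerDl ltW.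
  by move=> h; apply: D0; apply: le_lt_trans h; rewrite lerDr.
have := convol_L2_bound bD bu c0 (ltW e0) Dle D0.
have -> : qsize a / e ^+ n * (2 * e) ^+ n = qsize a * 2 ^+ n.
  by rewrite exprMn; field; rewrite expf_neq0 ?gt_eqF.
move=> hD; have hK := reg_kernel_L2_bound n0 tr0 e0 bu.
rewrite (_ : convol _ u = fun x => convol (reg_kernel a e) u x + convol D u x); last first.
  apply/funext => x; rewrite /convol -Rintegral_bsfD.
  - by apply: eq_Rintegral => y _; rewrite /D; ring.
  - exact: bsf_convol_integrand x (bounded_reg_kernel a e0) bu.
  - exact: bsf_convol_integrand x (bsf_bounded bD) bu.
have mu := bsf_measurable bu.
apply: le_trans (L2sqD _ _) _.
- by apply: measurable_convol => //; exact: measurable_reg_kernel.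
- exact: measurable_convol.
rewrite /sharp_bound -mulrA EFinM lee_wpmul2l ?lee_fin// mulrDl EFinD leeD//.
by rewrite L2sq_bsf ?lee_fin//; exact: bsf_convol.
Qed.

Lemma integrable_sharp_mul e (u : X -> R) x : 0 < e -> measurable_fun setT u ->
  (L2sq u < +oo)%E ->
  leb.-integrable setT (EFin \o (fun y : X => reg_kernel a e (x - y) ^+ 2 + u y ^+ 2)).
Proof.
move=> e0 mu Lu; have mk : measurable_fun setT (fun y : X => reg_kernel a e (x - y)).
  exact: measurableT_comp (measurable_reg_kernel a e0) (measurable_subl x).
have i2 (w : X -> R) : measurable_fun setT w -> (L2sq w < +oo)%E ->
    leb.-integrable setT (EFin \o (fun y => w y ^+ 2)).
  move=> mw Lw; apply/integrableP; split; first exact/measurable_EFinP/measurable_funX.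
  rewrite (_ : integral _ _ _ = L2sq w)//; apply: eq_integral => y _.
  by rewrite /= ger0_norm ?sqr_ge0.
pose f1 (y : X) := reg_kernel a e (x - y) ^+ 2; pose f2 (y : X) := u y ^+ 2.
rewrite (_ : EFin \o _ = (EFin \o f1) \+ (EFin \o f2))%E; last by [].
apply: integrableD => //; apply: i2 => //.
rewrite (_ : L2sq _ = L2sq (reg_kernel a e)); first exact: L2sq_reg_kernel.
have := integral_signed_perm x xpredT 1%g
  (measurable_funX 2 (measurable_reg_kernel a e0)).
rewrite /L2sq => <-; apply: eq_integral => y _; congr ((reg_kernel a e _) ^+ 2)%:E.
by apply/rowP => i; rewrite !mxE perm1 mulN1r.
Qed.

Lemma mul_le_sqr (s t : R) : `|s * t| <= s ^+ 2 + t ^+ 2.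
Proof.
rewrite normrM -(real_normK (num_real s)) -(real_normK (num_real t)).
have := sqr_ge0 (`|s| - `|t|); have := sqr_ge0 (`|s|); have := sqr_ge0 (`|t|).
nra.
Qed.

Lemma sharp_mul_le e (u : X -> R) x y :
  `|sharp_kernel e (x - y) * u y| <= reg_kernel a e (x - y) ^+ 2 + u y ^+ 2.
Proof.
apply: le_trans (mul_le_sqr (reg_kernel a e (x - y)) (u y)).
rewrite [leLHS]normrM [leRHS]normrM.
by apply: ler_wpM2r => //; exact: sharp_kernel_le.
Qed.

(** u is cut down to bounded functions of bounded support. At each x their convolutions converge by
    domination, and Fatou's lemma carries the bound to the limit. *)
Lemma sharp_kernel_L2_bound e (u : X -> R) : 0 < e -> measurable_fun setT u ->
  (L2sq u < +oo)%E ->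
  (L2sq (convol (sharp_kernel e) u) <= sharp_bound%:E * L2sq u)%E.
Proof.
move=> e0 mu Lu.
pose A k : set X := cube k%:R `&` (fun x => `|u x|) @^-1` `]-oo, k%:R].
have mA k : measurable (A k).
  apply: measurableI; first exact: measurable_cube.
  rewrite -[X in measurable X]setTI.
  by apply: (measurableT_comp (@normr_measurable R _) mu).
pose w k x := u x * \1_(A k) x.
have mw k : measurable_fun setT (w k).
  by apply: measurable_funM => //; exact: measurable_indic.
have bw k : bsf (w k).
  split => //; exists k%:R => x; rewrite /w indicE; split.
    case: (boolP (x \in A k)) => [|_]; last by rewrite mulr0 normr0.
    by rewrite inE => -[_]; rewrite /= in_itv /= mulr1.
  move=> h; rewrite memNset ?mulr0// => -[/cubeE + _].
  by move=> /(_ (ler0n _ _)); rewrite leNgt h.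
have w_le k x : w k x ^+ 2 <= u x ^+ 2.
  by rewrite /w indicE; case: (_ \in _); rewrite ?mulr1// mulr0 expr0n sqr_ge0.
have mk := measurable_sharp_kernel e0.
apply: (L2sq_fatou (g := fun k => convol (sharp_kernel e) (w k))).
- by move=> k; exact: measurable_convol.
- exact: measurable_convol.
- apply: aeW => x.
  have mkx : measurable_fun setT (fun y : X => sharp_kernel e (x - y)).
    exact: measurableT_comp mk (measurable_subl x).
  apply: (Rintegral_dominated_cvg
    (f := fun k (y : X) => sharp_kernel e (x - y) * w k y)
    (f_lim := fun y : X => sharp_kernel e (x - y) * u y) (G := fun y : X => reg_kernel a e (x - y) ^+ 2 + u y ^+ 2)).
  + by move=> k; exact: measurable_funM.
  + exact: measurable_funM.
  + move=> y; apply: cvg_near_cst.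
    exists (Num.truncn (`|y| + `|u y|)).+1 => // k /= hk.
    rewrite /w indicE mem_set ?mulr1//.
    have yk : `|y| + `|u y| <= k%:R.
      by apply: le_trans (ltW (truncnS_gt _)) _; rewrite ler_nat.
    split; first by apply/cubeE => //; apply: le_trans yk; rewrite lerDl.
    by rewrite /= in_itv /=; apply: le_trans yk; rewrite lerDr.
  + exact: integrable_sharp_mul.
  + move=> k y; apply: le_trans (sharp_mul_le e (w k) x y) _.
    by rewrite lerD2l.
move=> k; apply: le_trans (sharp_kernel_bsf_bound e0 (bw k)) _.
rewrite EFinM lee_wpmul2l//.
  rewrite lee_fin /sharp_bound mulr_ge0// addr_ge0 ?sqr_ge0//.
  by rewrite /cz_bound addr_ge0// mulr_ge0 ?sqr_ge0.
rewrite -L2sq_bsf//; apply: ge0_le_integral => //.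
- by move=> x _; rewrite lee_fin sqr_ge0.
- exact/measurable_EFinP/measurable_funX.
- exact/measurable_EFinP/measurable_funX.
- by move=> x _; rewrite lee_fin.
Qed.

End truncation.

(** * The kernel on the integer lattice *)

Section lattice.
Variables (R : realType) (n : nat).
Local Notation X := 'rV[R]_n.
Local Notation Z := 'rV[int]_n.
Local Notation leb := (lebesgue_row R n).

Implicit Types (G : seq Z) (k l : Z) (f : Z -> R) (x : X).

Definition lattice_point (k : Z) : X := map_mx intr k.

Lemma lattice_pointB k l : lattice_point (k - l) = lattice_point k - lattice_point l.
Proof. by apply/rowP => i; rewrite !mxE intrB. Qed.

(* The side 1/2 keeps these closed cubes pairwise disjoint. *)
Definition cell (k : Z) : set X :=
  box (lattice_point k) (lattice_point k + const_mx 2^-1).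

Lemma measurable_cell k : measurable (cell k).
Proof. exact: measurable_box. Qed.

Lemma lebesgue_cell k : leb (cell k) = (2^-1 ^+ n)%:E.
Proof.
rewrite lebesgue_row_box; last by move=> i; rewrite !mxE; lra.
congr EFin; under eq_bigr do rewrite !mxE addrAC subrr add0r.
by rewrite prodr_const card_ord.
Qed.

Lemma cell_inj k l x : cell k x -> cell l x -> k = l.
Proof.
have le12 (s t : int) (y : R) : s%:~R <= y -> y <= t%:~R + 2^-1 -> s <= t.
  move=> sy yt; rewrite -ltzD1 -(ltr_int R) intrD.
  by apply: le_lt_trans sy _; apply: le_lt_trans yt _; rewrite ltrD2l; lra.
move=> xk xl; apply/rowP => i; have := xk i; have := xl i; rewrite !mxE.
move=> /andP[l1 l2] /andP[k1 k2]; apply/eqP; rewrite eq_le.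
by rewrite (le12 _ _ _ k1 l2) (le12 _ _ _ l1 k2).
Qed.

Lemma cell_dist k x : cell k x -> `|x - lattice_point k| <= 2^-1.
Proof.
move=> xk; apply/ge_rV_norm => // i; have := xk i; rewrite !mxE => /andP[h1 h2].
by rewrite ger0_norm; lra.
Qed.

Definition step_fun (G : seq Z) (f : Z -> R) (x : X) : R :=
  \sum_(k <- G) f k * \1_(cell k) x.

Lemma step_fun_in G f k x : uniq G -> k \in G -> cell k x -> step_fun G f x = f k.
Proof.
move=> uG kG xk; rewrite /step_fun (bigD1_seq k)//= indicE mem_set// mulr1.
rewrite big1 ?addr0// => l lk; rewrite indicE memNset ?mulr0// => xl.
by move: lk; rewrite (cell_inj xk xl) eqxx.
Qed.

Lemma step_fun_out G f x : (forall k, k \in G -> ~ cell k x) -> step_fun G f x = 0.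
Proof.
move=> xG; rewrite /step_fun big_seq big1// => k kG.
by rewrite indicE memNset ?mulr0//; exact: xG.
Qed.

Lemma step_funP G x : (exists2 k, k \in G & cell k x) \/
  (forall k, k \in G -> ~ cell k x).
Proof.
have [h|h] := pselect (exists2 k, k \in G & cell k x); [by left|right].
by move=> k kG xk; apply: h; exists k.
Qed.

Lemma bsf_cell k : bsf (\1_(cell k) : X -> R).
Proof.
split; first by apply: measurable_indic; exact: measurable_cell.
exists (1 + `|lattice_point k|) => x; rewrite indicE; split.
  by case: (_ \in _); rewrite ?normr1 ?normr0 ?lerDl// addr_ge0.
move=> h; rewrite memNset// => /cell_dist hx.
have := ler_normD (x - lattice_point k) (lattice_point k); rewrite subrK; lra.
Qed.

Lemma Rintegral_cell k : \int[leb]_x (\1_(cell k) x) = 2^-1 ^+ n.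
Proof.
rewrite /Rintegral integral_indic//; last exact: measurable_cell.
by rewrite setIT; have := congr1 fine (lebesgue_cell k).
Qed.

Lemma step_funE G f : bsf (step_fun G f) /\
  \int[leb]_x step_fun G f x = 2^-1 ^+ n * \sum_(k <- G) f k.
Proof.
elim: G => [|k G [b IH]].
  rewrite /step_fun (_ : (fun x => _) = fun=> 0); last by apply/funext => x; rewrite big_nil.
  by rewrite big_nil mulr0 /Rintegral integral0; split => //; exact: bsf0.
have -> : step_fun (k :: G) f = fun x => f k * \1_(cell k) x + step_fun G f x.
  by apply/funext => x; rewrite /step_fun big_cons.
have bk := bsfZ (f k) (bsf_cell k).
split; first exact: bsfD.
by rewrite Rintegral_bsfD// Rintegral_bsfZ ?Rintegral_cell ?IH ?big_cons; [ring|exact: bsf_cell].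
Qed.

Lemma sum_cell_le (G : seq Z) (f : Z -> R) (g : X -> R) : uniq G ->
  measurable_fun setT g -> (forall x, 0 <= g x) ->
  (forall k x, cell k x -> f k <= g x) ->
  ((2^-1 ^+ n * \sum_(k <- G) f k)%:E <= \int[leb]_x (g x)%:E)%E.
Proof.
(* f may take negative values, as it does when an error term is subtracted; its positive part gives
   a step function between 0 and g. *)
move=> uG mg g0 fg; pose f' k := Num.max 0 (f k).
apply: (@le_trans _ _ (2^-1 ^+ n * \sum_(k <- G) f' k)%:E).
  rewrite lee_fin ler_wpM2l ?exprn_ge0 ?invr_ge0// ler_sum// => k _.
  by rewrite le_max lexx orbT.
have [b <-] := step_funE G f'; rewrite EFin_Rintegral//.
have s_le x : 0 <= step_fun G f' x <= g x.
  case: (step_funP G x) => [[k kG xk]|out]; last by rewrite step_fun_out ?lexx ?g0.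
  by rewrite (step_fun_in _ uG kG xk) le_max lexx /= ge_max g0 (fg _ _ xk).
apply: ge0_le_integral => //.
- by move=> x _; rewrite lee_fin; case/andP: (s_le x).
- by apply/measurable_EFinP; case: b.
- exact/measurable_EFinP.
- by move=> x _; rewrite lee_fin; case/andP: (s_le x).
Qed.

Lemma cut_enorm_cmp (x y : X) : `|x - y| <= 1 ->
  cut_enorm 1 x <= n.+1%:R * cut_enorm 1 y.
Proof.
move=> xy; have h := cut_enorm_dist 1 x y; have y1 := cut_enorm_ge 1 y.
have : n%:R * `|x - y| <= n%:R * cut_enorm 1 y.
  by rewrite ler_wpM2l// (le_trans xy).
rewrite -natr1 mulrDl mul1r; lra.
Qed.

Definition decay (k : Z) : R := (cut_enorm 1 (lattice_point k) ^+ n.+1)^-1.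

Lemma decay_ge0 k : 0 <= decay k.
Proof. by rewrite invr_ge0 exprn_ge0// ltW// cut_enorm_gt0. Qed.

(** The bound 3 * 4^n on the integral at scale 1, a factor for moving from a lattice point to the
    points of its cell, and the inverse volume 2^n of a cell. *)
Definition decay_sum : R := n.+1%:R ^+ n.+1 * (3 * 4 ^+ n) * 2 ^+ n.

Lemma sum_decay_le (G : seq Z) : uniq G -> \sum_(k <- G) decay k <= decay_sum.
Proof.
move=> uG; have c0 : 0 <= n.+1%:R ^+ n.+1 :> R by rewrite exprn_ge0.
pose g x : R := n.+1%:R ^+ n.+1 * (1 / cut_enorm 1 x ^+ n.+1).
have p0 (x : X) : 0 < cut_enorm 1 x ^+ n.+1 by rewrite exprn_gt0// cut_enorm_gt0.
have mi : measurable_fun setT (fun x : X => 1 / cut_enorm 1 x ^+ n.+1).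
  apply: measurable_div => //; first exact: measurable_cut_enorm.
  by move=> x; exact/ltW/cut_enorm_gt0.
have : ((2^-1 ^+ n * \sum_(k <- G) decay k)%:E <= \int[leb]_x (g x)%:E)%E.
  apply: sum_cell_le => //.
  - exact: measurable_funM.
  - by move=> x; rewrite mulr_ge0// divr_ge0// ltW.
  move=> k x xk; rewrite /decay /g div1r ler_pdivlMr// mulrC ler_pdivrMr//.
  rewrite -exprMn lerXn2r ?nnegrE ?mulr_ge0 ?(ltW (cut_enorm_gt0 _ _))//.
  by apply: cut_enorm_cmp; apply: le_trans (cell_dist xk) _; lra.
have -> : (\int[leb]_x (g x)%:E = (n.+1%:R ^+ n.+1)%:E *
    \int[leb]_x ((cut_enorm 1 x ^+ n.+1)^-1)%:E)%E.
  rewrite -ge0_integralZl_EFin//.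
  - by apply: eq_integral => x _; rewrite /g div1r EFinM.
  - by move=> x _; rewrite lee_fin invr_ge0 ltW.
  - by apply/measurable_EFinP; under eq_fun do rewrite -div1r.
have := @integral_inv_cut_enorm R n 1 ltr01; rewrite divr1.
move=> /(lee_wpmul2l (x := (n.+1%:R ^+ n.+1)%:E)) => /(_ _)/[swap] h1 h2.
have := le_trans h1 (h2 _); rewrite lee_fin => /(_ c0); rewrite -EFinM lee_fin.
rewrite exprVn ler_pdivrMl ?exprn_gt0// /decay_sum mulrC; apply.
Qed.

Variable a : 'M[R]_n.
Hypotheses (n0 : (0 < n)%N) (tr0 : \tr a = 0).

(** The cut-off at 1 changes K at no nonzero lattice point and gives 0 at the origin, in agreement
    with the diagonal of the matrix. *)
Definition lattice_kernel (k : Z) : R := reg_kernel a 1 (lattice_point k).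

Definition approx_const : R := lip_const a * n.+1%:R ^+ n.+1.

(** x and y are within 1/2 of their lattice points, so x - y is within 1 of the lattice point of k -
    l, and [cut_enorm_cmp] compares the cut-off norms up to a factor n + 1. *)
Lemma lattice_kernel_approx k l x y : cell k x -> cell l y ->
  `|reg_kernel a 1 (x - y) - lattice_kernel (k - l)| <= approx_const * decay (k - l).
Proof.
move=> xk yl; set z := lattice_point (k - l).
have dz : `|x - y - z| <= 1.
  have -> : x - y - z = (x - lattice_point k) - (y - lattice_point l).
    by rewrite /z lattice_pointB; apply/rowP => i; rewrite !mxE; ring.
  have := cell_dist xk; have := cell_dist yl.
  have := ler_normB (x - lattice_point k) (y - lattice_point l); lra.
apply: le_trans (reg_kernel_dist a _ _ ltr01) _.
rewrite /approx_const -[leLHS]mulrA -[leRHS]mulrA; apply: ler_wpM2l; first exact: lip_const_ge0.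
have cz := cut_enorm_gt0 z ltr01; have cxy := cut_enorm_gt0 (x - y) ltr01.
set mn := Num.min _ _; have mn0 : 0 < mn by rewrite lt_min cz cxy.
rewrite -[leRHS]mul1r ler_pM// ?invr_ge0 ?exprn_ge0 ?(ltW mn0)//.
rewrite /decay -/z ler_pdivlMr ?exprn_gt0// mulrC ler_pdivrMr ?exprn_gt0//.
rewrite -exprMn lerXn2r ?nnegrE ?mulr_ge0 ?(ltW cz) ?(ltW mn0)//.
rewrite /mn minEle; case: ifP => _; first by rewrite cut_enorm_cmp// distrC.
by rewrite -[leLHS]mul1r ler_pM ?(ltW cz)// ler1n.
Qed.

Definition lattice_bound : R :=
  4 * (cz_bound a * 2 ^+ n * 2 ^+ n) + 2 * (approx_const * decay_sum) ^+ 2.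

(** Cauchy-Schwarz with the weights [decay (m - k)], whose sums over rows and over columns are at
    most [decay_sum]. *)
Lemma schur_sum (F G : seq Z) (u : Z -> R) : uniq F -> uniq G ->
  \sum_(m <- F) (\sum_(k <- G) decay (m - k) * `|u k|) ^+ 2 <=
  decay_sum ^+ 2 * \sum_(k <- G) u k ^+ 2.
Proof.
move=> uF uG.
have decayC m k : decay (m - k) = decay (k - m).
  by rewrite /decay /cut_enorm !lattice_pointB -enormN opprB.
have sumd (S : seq Z) k : uniq S -> \sum_(m <- S) decay (m - k) <= decay_sum.
  move=> uS; rewrite -(big_map (fun m => m - k) xpredT decay) /=.
  by apply: sum_decay_le; rewrite map_inj_uniq//; exact: addIr.
have ds0 : 0 <= decay_sum by rewrite /decay_sum !mulr_ge0 ?exprn_ge0.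
have cs m : (\sum_(k <- G) decay (m - k) * `|u k|) ^+ 2 <=
    decay_sum * \sum_(k <- G) decay (m - k) * u k ^+ 2.
  set w := fun k => decay (m - k).
  have w0 k : 0 <= w k by exact: decay_ge0.
  apply: (@le_trans _ _ ((\sum_(k <- G) w k) * \sum_(k <- G) w k * u k ^+ 2)).
    rewrite expr2 !mulr_suml.
    (* The double sum is symmetrized, so that |u_k| |u_l| <= (u_k^2 + u_l^2) / 2 can be applied term
       by term. *)
    have e : \sum_(k <- G) w k * \sum_(l <- G) w l * u l ^+ 2 =
      \sum_(k <- G) \sum_(l <- G) w k * w l * (u k ^+ 2 + u l ^+ 2) / 2.
      transitivity (2^-1 * (\sum_(k <- G) \sum_(l <- G) w k * w l * u k ^+ 2 +
         \sum_(k <- G) \sum_(l <- G) w k * w l * u l ^+ 2)).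
        have -> : \sum_(k <- G) \sum_(l <- G) w k * w l * u k ^+ 2 =
            \sum_(k <- G) \sum_(l <- G) w k * w l * u l ^+ 2.
          rewrite exchange_big; apply: eq_bigr => k _; apply: eq_bigr => l _.
          by rewrite (mulrC (w l)).
        have -> : \sum_(k <- G) w k * \sum_(l <- G) w l * u l ^+ 2 =
            \sum_(k <- G) \sum_(l <- G) w k * w l * u l ^+ 2.
          by apply: eq_bigr => k _; rewrite mulr_sumr; apply: eq_bigr => l _; rewrite mulrA.
        by set s := \sum_(k <- G) _; lra.
      rewrite -big_split /= mulr_sumr; apply: eq_bigr => k _.
      by rewrite -big_split /= mulr_sumr; apply: eq_bigr => l _; ring.
    rewrite e; apply: ler_sum => k _; rewrite mulr_sumr; apply: ler_sum => l _.
    have -> : w k * `|u k| * (w l * `|u l|) = w k * w l * (`|u k| * `|u l|) by ring.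
    rewrite -[X in _ <= X]mulrA; apply: ler_wpM2l; first by rewrite mulr_ge0.
    rewrite -(real_normK (num_real (u k))) -(real_normK (num_real (u l))).
    by have := sqr_ge0 (`|u k| - `|u l|); nra.
  apply: ler_wpM2r.
    by apply: sumr_ge0 => k _; rewrite mulr_ge0 ?sqr_ge0.
  by rewrite /w; under eq_bigr do rewrite decayC; exact: sumd.
apply: (@le_trans _ _ (\sum_(m <- F) decay_sum * \sum_(k <- G) decay (m - k) * u k ^+ 2)).
  by apply: ler_sum => m _; exact: cs.
rewrite -mulr_sumr expr2 -mulrA ler_wpM2l// exchange_big /= mulr_sumr.
by apply: ler_sum => k _; rewrite -mulr_suml ler_wpM2r ?sqr_ge0 ?sumd.
Qed.

(* Giving a step function the value u k on the cell of k turns the lattice sum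
   into a convolution, up to an error which is summed by Schur's test. *)
Lemma lattice_kernel_bound (F G : seq Z) (u : Z -> R) : uniq F -> uniq G ->
  \sum_(m <- F) (\sum_(k <- G) lattice_kernel (m - k) * u k) ^+ 2 <=
  lattice_bound * \sum_(k <- G) u k ^+ 2.
Proof.
move=> uF uG; pose v : R := 2^-1 ^+ n.
have v0 : 0 < v by rewrite exprn_gt0// invr_gt0.
pose U := step_fun G u; have [bU _] := step_funE G u; rewrite -/U in bU.
pose s m := \sum_(k <- G) lattice_kernel (m - k) * u k.
pose t m := \sum_(k <- G) decay (m - k) * `|u k|.
have ac0 : 0 <= approx_const by rewrite mulr_ge0 ?lip_const_ge0 ?exprn_ge0.
have bk := bounded_reg_kernel a ltr01.
(* For x in the cell of m, the integral over the cell of k is v * u k times the lattice kernel, up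
   to the error in [lattice_kernel_approx]. *)
have sE m x : cell m x -> `|convol (reg_kernel a 1) U x - v * s m| <= approx_const * v * t m.
  move=> xm.
  have kb k : bsf (fun y => reg_kernel a 1 (x - y) * (u k * \1_(cell k) y)).
    exact: bsf_convol_integrand x bk (bsfZ (u k) (bsf_cell k)).
  have -> : convol (reg_kernel a 1) U x =
      \sum_(k <- G) \int[leb]_y (reg_kernel a 1 (x - y) * (u k * \1_(cell k) y)).
    suff [_ <-] : bsf (fun y => \sum_(k <- G) reg_kernel a 1 (x - y) * (u k * \1_(cell k) y))
      /\ \int[leb]_y (\sum_(k <- G) reg_kernel a 1 (x - y) * (u k * \1_(cell k) y)) =
       \sum_(k <- G) \int[leb]_y (reg_kernel a 1 (x - y) * (u k * \1_(cell k) y)).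
      by apply: eq_Rintegral => y _; rewrite mulr_sumr.
    elim: (G) => [|k G' [b IH]].
      rewrite (_ : (fun y => _) = fun=> 0); last by apply/funext => y; rewrite big_nil.
      by rewrite big_nil /Rintegral integral0; split => //; exact: bsf0.
    rewrite (_ : (fun y => _) = fun y => reg_kernel a 1 (x - y) * (u k * \1_(cell k) y) +
       \sum_(k <- G') reg_kernel a 1 (x - y) * (u k * \1_(cell k) y)).
      by rewrite big_cons Rintegral_bsfD// IH; split => //; exact: bsfD.
    by apply/funext => y; rewrite big_cons.
  rewrite /s /t !mulr_sumr -sumrB; apply: le_trans (ler_norm_sum _ _ _) _.
  apply: ler_sum => k _.
  have ic := bsf_cell k.
  have -> : v * (lattice_kernel (m - k) * u k) =
    \int[leb]_y ((lattice_kernel (m - k) * u k) * \1_(cell k) y).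
    by rewrite Rintegral_bsfZ// Rintegral_cell mulrC.
  rewrite -Rintegral_bsfB//; last exact: bsfZ.
  have -> : approx_const * v * (decay (m - k) * `|u k|) =
    \int[leb]_y ((approx_const * decay (m - k) * `|u k|) * \1_(cell k) y).
    by rewrite Rintegral_bsfZ// Rintegral_cell /v; ring.
  have bB := bsfB (kb k) (bsfZ (lattice_kernel (m - k) * u k) ic).
  apply: le_trans (le_normr_Rintegral _ (bsf_integrable bB)) _ => //.
  apply: le_Rintegral_bsf; [exact: bsf_abs|exact: bsfZ|] => y.
  rewrite indicE; case: (boolP (y \in cell k)) => [|_]; last first.
    by rewrite !mulr0 subrr normr0.
  rewrite inE => yk; rewrite !mulr1 -mulrBl normrM ler_wpM2r//.
  exact: lattice_kernel_approx.
have mc : measurable_fun setT (convol (reg_kernel a 1) U).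
  by apply: measurable_convol; [exact: measurable_reg_kernel|case: bU].
(* If |q - v s| <= b then (v s)^2 / 2 - b^2 <= q^2, which bounds the square of the convolution from
   below on each cell. *)
have main : ((v * \sum_(m <- F) ((v * s m) ^+ 2 / 2 - (approx_const * v * t m) ^+ 2))%:E <=
    L2sq (convol (reg_kernel a 1) U))%E.
  apply: sum_cell_le => //.
  - exact: measurable_funX.
  - by move=> x; exact: sqr_ge0.
  move=> m x xm; have := sE m x xm; set q := convol _ _ _; set b := approx_const * v * t m.
  rewrite ler_norml => /andP[h1 h2].
  have h3 : (q - v * s m) ^+ 2 <= b ^+ 2.
    have : 0 <= (b - (q - v * s m)) * (b + (q - v * s m)) by rewrite mulr_ge0; lra.
    by rewrite -subr_sqr subr_ge0.
  have h4 := sqr_ge0 (2 * q - v * s m).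
  by move: h3 h4; rewrite !expr2; nra.
have UU : inner U U = v * \sum_(k <- G) u k ^+ 2.
  have [_ <-] := step_funE G (fun k => u k ^+ 2); apply: eq_Rintegral => x _.
  case: (step_funP G x) => [[k kG xk]|out]; last by rewrite /U !step_fun_out ?mulr0.
  by rewrite /U !(step_fun_in _ uG kG xk) expr2.
have := le_trans main (reg_kernel_L2_bound n0 tr0 ltr01 bU).
rewrite lee_fin UU mulrCA ler_pM2l// sumrB -mulr_suml => h5.
have sc := schur_sum u uF uG.
have -> : \sum_(m <- F) (\sum_(k <- G) lattice_kernel (m - k) * u k) ^+ 2 = \sum_(m <- F) s m ^+ 2 by [].
set A := \sum_(k <- G) u k ^+ 2 in h5 sc *.
set S := \sum_(m <- F) s m ^+ 2.
have h6 : v ^+ 2 * S / 2 <= cz_bound a * A + (approx_const * v) ^+ 2 * (decay_sum ^+ 2 * A).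
  apply: (@le_trans _ _ (cz_bound a * A + (approx_const * v) ^+ 2 * \sum_(m <- F) t m ^+ 2)).
    have e1 : \sum_(m <- F) (v * s m) ^+ 2 = v ^+ 2 * S.
      by rewrite mulr_sumr; apply: eq_bigr => m _; rewrite exprMn.
    have e2 : \sum_(m <- F) (approx_const * v * t m) ^+ 2 =
        (approx_const * v) ^+ 2 * \sum_(m <- F) t m ^+ 2.
      by rewrite mulr_sumr; apply: eq_bigr => m _; rewrite exprMn.
    by move: h5; rewrite e1 e2; lra.
  by rewrite lerD2l ler_wpM2l ?sqr_ge0.
have V : v * 2 ^+ n = 1 by rewrite /v -exprMn mulVf ?expr1n.
have -> : S = (v * 2 ^+ n) ^+ 2 * S by rewrite V expr1n mul1r.
have A0 : 0 <= A by apply: sumr_ge0 => k _; exact: sqr_ge0.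
have p0 : 0 <= (2 ^+ n) ^+ 2 :> R by rewrite sqr_ge0.
have := ler_wpM2l p0 h6.
have -> : (2 ^+ n) ^+ 2 * (cz_bound a * A + (approx_const * v) ^+ 2 * (decay_sum ^+ 2 * A)) =
  (cz_bound a * 2 ^+ n * 2 ^+ n) * A + (v * 2 ^+ n) ^+ 2 * (approx_const * decay_sum) ^+ 2 * A by ring.
have -> : (2 ^+ n) ^+ 2 * (v ^+ 2 * S / 2) = (v * 2 ^+ n) ^+ 2 * S / 2 by ring.
rewrite V expr1n !mul1r /lattice_bound.
have cA : 0 <= (cz_bound a * 2 ^+ n * 2 ^+ n) * A.
  by rewrite !mulr_ge0 ?exprn_ge0// /cz_bound addr_ge0// mulr_ge0 ?sqr_ge0.
lra.
Qed.

End lattice.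

(** * Quadratic polynomials with vanishing spherical mean *)

Section monomials.
Variables (R : comNzRingType) (n : nat).

(** Two such steps turn a monomial of degree 2, given by its exponents, into a product v_i v_j. *)
Lemma prod_expr_peel (f : 'I_n -> nat) s : (\sum_i f i = s.+1)%N ->
  exists i g, (\sum_i g i = s)%N /\
    forall v : 'I_n -> R, \prod_k v k ^+ f k = v i * \prod_k v k ^+ g k.
Proof.
move=> fs; have [i fi] : exists i, (0 < f i)%N.
  apply: contrapT => h; move: fs; rewrite big1// => i _.
  by apply/eqP; rewrite -leqn0 leqNgt; apply/negP => fi; apply: h; exists i.
exists i, (fun k => if k == i then (f k).-1 else f k); split.
  move: fs; rewrite (bigD1 i)//= [in X in _ -> X](bigD1 i)//= eqxx.
  rewrite [in X in _ -> X](eq_bigr f); last by move=> k /negbTE ->.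
  by case: (f i) fi => // m _; rewrite addSn => -[].
move=> v; rewrite (bigD1 i)//= [in RHS](bigD1 i)//= eqxx.
rewrite [in RHS](eq_bigr (fun k => v k ^+ f k)); last by move=> k /negbTE ->.
by case: (f i) fi => // m _; rewrite exprS mulrA.
Qed.

Lemma homog2_quadratic (p : mpoly.mpoly n R) :
  p \is mpoly.ishomog1 2 (@mpoly.mdeg n) ->
  exists a : 'I_n -> 'I_n -> R, forall v : 'I_n -> R,
    mpoly.meval v p = \sum_i \sum_j a i j * (v i * v j).
Proof.
move=> /mpoly.dhomogP hp.
suff [a aP] : exists a : 'I_n -> 'I_n -> R, forall v : 'I_n -> R,
   \sum_(m <- mpoly.msupp p) mpoly.mcoeff m p * \prod_i v i ^+ mpoly.fun_of_multinom m i =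
   \sum_i \sum_j a i j * (v i * v j).
  by exists a => v; rewrite mpoly.mevalE.
have {hp} : {in mpoly.msupp p, forall m, mpoly.mdeg m = 2%N} by [].
elim: (mpoly.msupp p : seq _) => [|m s IH] hs.
  exists (fun _ _ => 0) => v; rewrite big_nil big1// => i _.
  by rewrite big1// => j _; rewrite mul0r.
have [a aP] : exists a : 'I_n -> 'I_n -> R, forall v : 'I_n -> R,
   \sum_(m <- s) mpoly.mcoeff m p * \prod_i v i ^+ mpoly.fun_of_multinom m i =
   \sum_i \sum_j a i j * (v i * v j).
  by apply: IH => k ks; apply: hs; rewrite inE ks orbT.
have := hs m (mem_head _ _); rewrite mpoly.mdegE => /prod_expr_peel[i [g [g1 gP]]].
have [j [h [h0 hP]]] := prod_expr_peel g1.
pose c := mpoly.mcoeff m p.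
exists (fun k l => a k l + (if (k == i) && (l == j) then c else 0)) => v.
rewrite big_cons aP gP hP.
have -> : \prod_k v k ^+ h k = 1.
  rewrite big1// => k _; move: h0 => /eqP; rewrite sum_nat_eq0 => /forallP/(_ k).
  by move=> /eqP ->.
under [RHS]eq_bigr do under eq_bigr do rewrite mulrDl.
under [RHS]eq_bigr do rewrite big_split /=.
rewrite big_split /= addrC; congr (_ + _).
rewrite (bigD1 i)//= (bigD1 j)//= !eqxx /= mulr1 !big1 ?addr0//.
- by move=> k /negbTE ki; rewrite big1// => l _; rewrite ki mul0r.
- by move=> l /negbTE lj; rewrite lj mul0r.
Qed.

End monomials.

Section complex_quadratic.
Variables (R : realType) (n : nat).

Lemma homog2_qform (p : mpoly.mpoly n R[i]) :
  p \is mpoly.ishomog1 2 (@mpoly.mdeg n) ->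
  exists a b : 'M[R]_n, forall x : 'rV[R]_n,
    mpoly.meval (fun i => (x ord0 i)%:C%C) p = (qform a x +i* qform b x)%C.
Proof.
move=> /homog2_quadratic[c cP].
exists (\matrix_(i, j) complex.Re (c i j)), (\matrix_(i, j) complex.Im (c i j)) => x.
rewrite cP.
have sumC (f : 'I_n -> R[i]) :
    \sum_i f i = ((\sum_i complex.Re (f i)) +i* (\sum_i complex.Im (f i)))%C.
  elim: (index_enum _) => [|i r IH]; first by rewrite !big_nil.
  by rewrite !big_cons IH; case: (f i).
rewrite sumC; congr Complex; apply: eq_bigr => i _; rewrite sumC /=;
  apply: eq_bigr => j _; rewrite mxE; case: (c i j) => s t /=; ring.
Qed.

End complex_quadratic.

(** * The unit sphere: a vanishing mean and the trace *)

Section sphere.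
Variables (R : realType) (n : nat).
Local Notation X := 'rV[R]_n.
Local Notation leb := (lebesgue_row R n).
Local Notation sigma := (@surface_measure R n).

Let S : set X := [set x | enorm x = 1].

Lemma measurable_sphere : measurable S.
Proof.
rewrite (_ : S = @enorm R n @^-1` [set 1]); last by apply/seteqP; split.
by rewrite -[X in measurable X]setTI; exact: measurable_enorm.
Qed.

Let cone (E : set X) : set X :=
  [set x | (0 < enorm x <= 1)%R] `&` (fun x => (enorm x)^-1 *: x)%R @^-1` E.

Let measurable_cone E : measurable E -> measurable (cone E).
Proof.
move=> mE; apply: measurableI.
  rewrite (_ : [set _ | _] = @enorm R n @^-1` `]0%R, 1%R]).
    by rewrite -[X in measurable X]setTI; exact: measurable_enorm.
  by apply/seteqP; split => x /=; rewrite in_itv.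
rewrite -[X in measurable X]setTI.
suff: measurable_fun setT (fun x : X => (enorm x)^-1 *: x)%R by exact.
apply: measurable_fun_row => i; under eq_fun do rewrite mxE.
apply: measurable_funM; last exact: measurable_coord.
under eq_fun do rewrite -powR_inv1 ?sqrtr_ge0//.
exact: (measurableT_comp (@measurable_powR R (-1)) (@measurable_enorm R n)).
Qed.

Lemma surface_measure_signed_perm e s E : measurable E ->
  sigma (signed_perm 0 e s @^-1` E) = sigma E.
Proof.
move=> mE; rewrite /surface_measure; congr (_ * _)%E.
rewrite -(lebesgue_row_signed_perm 0 e s (measurable_cone mE)).
congr (lebesgue_row R n _); apply/seteqP; split => x /=;
  rewrite /cone /= enorm_signed_perm => -[h1 h2]; split => //; move: h2;
  congr (E _); apply/rowP => i; rewrite !mxE !add0r; ring.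
Qed.

Lemma surface_sphere_fin : (sigma S < +oo)%E.
Proof.
rewrite /surface_measure; apply: lte_mul_pinfty => //.
apply: le_lt_trans (lebesgue_cube_fin n ler01).
apply: le_measure; rewrite ?inE; [exact: measurable_cone measurable_sphere|exact: measurable_cube|].
move=> x [/andP[_ x1] _]; apply/cubeE => //; exact: le_trans (norm_le_enorm x) x1.
Qed.

Lemma surface_sphere_gt0 : (0 < n)%N -> (0 < sigma S)%E.
Proof.
move=> n0; rewrite /surface_measure; apply: mule_gt0; first by rewrite lte_fin ltr0n.
(* The box with all coordinates between c and 2 c lies in the punctured unit ball, because the
   Euclidean norm is at most n times the sup norm. *)
pose c : R := (2 * n%:R)^-1; have c0 : 0 < c by rewrite invr_gt0 mulr_gt0 ?ltr0n.
apply: (@lt_le_trans _ _ (leb (box (const_mx c) (const_mx (2 * c))))).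
  rewrite lebesgue_row_box; last by move=> i; rewrite !mxE; lra.
  by rewrite lte_fin prodr_gt0// => i _; rewrite !mxE; lra.
apply: le_measure; rewrite ?inE; [exact: measurable_box|exact: measurable_cone measurable_sphere|].
move=> x xb; have xc i : c <= x ord0 i <= 2 * c by have := xb i; rewrite !mxE.
have x0 : 0 < enorm x.
  apply: lt_le_trans (coord_le_enorm x (Ordinal n0)).
  have /andP[h _] := xc (Ordinal n0).
  by apply: lt_le_trans c0 _; apply: le_trans h _; exact: ler_norm.
split; last first.
  rewrite /S /= {1}/enorm; under eq_bigr do rewrite mxE exprMn.
  rewrite -mulr_sumr -sqr_enorm -exprMn mulVf ?gt_eqF// expr1n sqrtr1//.
rewrite /= x0 /=.
have e0 : enorm (0 : X) = 0.
  by rewrite /enorm big1 ?sqrtr0// => i _; rewrite mxE expr0n.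
have := enorm_dist x 0; rewrite e0 !subr0 ger0_norm ?enorm_ge0// => h.
apply: le_trans h _; rewrite -ler_pdivlMl ?ltr0n// mulr1.
apply/ge_rV_norm; first by rewrite invr_ge0.
move=> i; have /andP[h1 h2] := xc i.
rewrite ger0_norm; last by apply: le_trans h1; exact: ltW.
apply: le_trans h2 _; rewrite /c invfM mulrA divff ?mul1r//.
Qed.

Let integrable_sphere (f : X -> R) (c : R) : measurable_fun setT f ->
  (forall x, S x -> `|f x| <= c) -> (sigma : {measure set X -> \bar R}).-integrable S (EFin \o f).
Proof.
move=> mf fc; apply: measurable_bounded_integrable.
- exact: measurable_sphere.
- exact: surface_sphere_fin.
- exact: measurable_funTS.
- by exists c; split; [exact: num_real|move=> t ct x Sx; exact: le_trans (fc x Sx) (ltW ct)].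
Qed.

Let Rintegral_sphere_signed_perm e s (f : X -> R) : measurable_fun setT f ->
  \int[sigma]_(x in S) f (signed_perm 0 e s x) = \int[sigma]_(x in S) f x.
Proof.
move=> mf; rewrite Rintegral_mkcond [RHS]Rintegral_mkcond.
have mfS : measurable_fun setT (f \_ S).
  apply/(measurable_restrictT _ _).1; [exact: measurable_sphere|exact: measurable_funTS].
have := integral_measure_preserving (measurable_signed_perm 0 e s)
  (surface_measure_signed_perm e s) mfS.
rewrite /Rintegral => <-; congr fine; apply: eq_integral => x _; congr EFin.
rewrite !patchE; have -> : (signed_perm 0 e s x \in S) = (x \in S) by apply/idP/idP; rewrite !inE /S /= enorm_signed_perm.
by [].
Qed.

(** By symmetry the integral is the trace times the common integral of the x_i^2. That factor is not
    0: for the identity matrix the integrand is 1 on the sphere, whose measure is finite and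
    positive. *)
Lemma sphere_integral_trace (a : 'M[R]_n) : (0 < n)%N ->
  \int[sigma]_(x in S) qform a x = 0 -> \tr a = 0.
Proof.
move=> n0; have mS := measurable_sphere.
have mm i j : measurable_fun setT (fun x : X => x ord0 i * x ord0 j).
  by apply: measurable_funM; exact: measurable_coord.
have im i j : (sigma : {measure set X -> \bar R}).-integrable S (EFin \o (fun x : X => x ord0 i * x ord0 j)).
  apply: (@integrable_sphere _ 1) => // x Sx.
  by rewrite normrM -[leRHS]mulr1 ler_pM//; have := coord_le_enorm x i;
    have := coord_le_enorm x j; rewrite Sx.
pose I i j := \int[sigma]_(x in S) (x ord0 i * x ord0 j).
have off i j : i != j -> I i j = 0.
  move=> ij; suff : I i j = - I i j by lra.
  rewrite {1}/I -(Rintegral_sphere_signed_perm (pred1 i) 1%g (mm i j)).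
  rewrite -[RHS]mulN1r -RintegralZl//; apply: eq_Rintegral => x _.
  by rewrite !mxE !perm1 !add0r /= eqxx eq_sym (negbTE ij) expr1 expr0; ring.
have diag i j : I i i = I j j.
  rewrite {1}/I -(Rintegral_sphere_signed_perm xpred0 (tperm i j) (mm i i)).
  by apply: eq_Rintegral => x _; rewrite !mxE tpermL add0r expr0 mul1r.
have sumR (J : finType) (F : J -> X -> R) :
   (forall j, (sigma : {measure set X -> \bar R}).-integrable S (EFin \o F j)) ->
   (sigma : {measure set X -> \bar R}).-integrable S (EFin \o (fun x => \sum_j F j x)) /\
   \int[sigma]_(x in S) (\sum_j F j x) = \sum_j \int[sigma]_(x in S) F j x.
  move=> bF; elim: (index_enum J) => [|j s [b IH]].
    rewrite (_ : (fun x => _) = fun=> 0); last by apply/funext => x; rewrite big_nil.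
    by rewrite big_nil /Rintegral integral0; split => //; exact: integrable0.
  rewrite (_ : (fun x => _) = fun x => F j x + \sum_(j <- s) F j x).
    rewrite big_cons RintegralD// IH; split => //.
    rewrite (_ : EFin \o _ = (EFin \o F j) \+ (EFin \o (fun x => (\sum_(j <- s) F j x)%R)))%E.
      exact: integrableD.
    by apply/funext.
  by apply/funext => x; rewrite big_cons.
have qE (b : 'M[R]_n) : \int[sigma]_(x in S) qform b x = \tr b * I (Ordinal n0) (Ordinal n0).
  have ib i j : (sigma : {measure set X -> \bar R}).-integrable S
      (EFin \o (fun x : X => b i j * (x ord0 i * x ord0 j))).
    rewrite (_ : EFin \o _ = fun x => ((b i j)%:E * (EFin \o (fun x : X => (x ord0 i * x ord0 j)%R)) x)%E).
      exact: integrableZl.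
    by apply/funext => x /=; rewrite EFinM.
  have [_ ->] := sumR _ _ (fun i => (sumR _ _ (ib i)).1).
  rewrite /mxtrace mulr_suml; apply: eq_bigr => i _.
  have [_ ->] := sumR _ _ (ib i).
  rewrite (bigD1 i)//= big1 ?addr0 => [|j ji]; last first.
    by rewrite RintegralZl// -/(I i j) off ?mulr0// eq_sym.
  by rewrite RintegralZl// -/(I i i) (diag i (Ordinal n0)).
rewrite qE => /eqP; rewrite mulf_eq0 => /orP[/eqP//|/eqP I0].
have := qE 1%:M; rewrite I0 mulr0.
have -> : \int[sigma]_(x in S) qform 1%:M x = \int[sigma]_(x in S) 1.
  apply: eq_Rintegral => x; rewrite inE => Sx.
  have : enorm x ^+ 2 = 1 by rewrite Sx expr1n.
  rewrite sqr_enorm => x1; rewrite -[RHS]x1; apply: eq_bigr => i _.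
  rewrite (bigD1 i)//= big1 ?addr0 => [|j ji]; rewrite mxE ?eqxx ?mul1r ?expr2//.
  by rewrite eq_sym (negbTE ji) mul0r.
rewrite Rintegral_cst// mul1r => /eqP; rewrite fine_eq0; last first.
  by rewrite ge0_fin_numE//; exact: surface_sphere_fin.
by move=> /eqP h; have := surface_sphere_gt0 n0; rewrite h ltxx.
Qed.

End sphere.

(** * Complex families and resolvents on l2 *)

Section normc_theory.
Variable R : realType.
Implicit Types z w : R[i].

Lemma normc_ge0 z : 0 <= normc z.
Proof. by case: z => s t /=; exact: sqrtr_ge0. Qed.

Lemma sqr_normc z : normc z ^+ 2 = complex.Re z ^+ 2 + complex.Im z ^+ 2.
Proof. by case: z => s t /=; rewrite sqr_sqrtr// addr_ge0 ?sqr_ge0. Qed.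

Lemma normcD z w : normc (z + w) <= normc z + normc w.
Proof. by have := ler_normD z w; rewrite lecE /= => /andP[]. Qed.

Lemma normcN z : normc (- z) = normc z.
Proof. by case: z => s t /=; rewrite !sqrrN. Qed.

Lemma normcB z w : normc (z - w) <= normc z + normc w.
Proof. by rewrite -(normcN w); exact: normcD. Qed.

Lemma normc_real (x : R) : normc (x%:C)%C = `|x|.
Proof. by rewrite /= expr0n addr0 sqrtr_sqr. Qed.

Lemma Re_le_normc z : `|complex.Re z| <= normc z.
Proof.
rewrite -(ler_pXn2r (n := 2)) ?nnegrE ?normc_ge0// sqr_normc real_normK ?num_real//.
by rewrite lerDl sqr_ge0.
Qed.

Lemma Im_le_normc z : `|complex.Im z| <= normc z.
Proof.
rewrite -(ler_pXn2r (n := 2)) ?nnegrE ?normc_ge0// sqr_normc real_normK ?num_real//.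
by rewrite lerDr sqr_ge0.
Qed.

Lemma normc_le_ReIm z : normc z <= `|complex.Re z| + `|complex.Im z|.
Proof.
rewrite -(ler_pXn2r (n := 2)) ?nnegrE ?normc_ge0 ?addr_ge0// sqr_normc.
rewrite -(real_normK (num_real (complex.Re z))) -(real_normK (num_real (complex.Im z))).
by rewrite sqrrD -addrA lerD2l lerDr mulrn_wge0// mulr_ge0.
Qed.

Lemma geometric_cvg_real (x : nat -> R) (c q : R) : 0 <= q -> q < 1 ->
  (forall k, `|x k.+1 - x k| <= c * q ^+ k) ->
  exists l : R, x k @[k --> \oo] --> l.
Proof.
move=> q0 q1 xq.
have c0 : 0 <= c by have := xq 0%N; rewrite expr0 mulr1; exact: le_trans.
pose d := [sequence x k.+1 - x k]_k.
have : cvgn [normed series d].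
  apply: (series_le_cvg (v_ := geometric c q)).
  - by move=> k; exact: normr_ge0.
  - by move=> k; rewrite mulr_ge0// exprn_ge0.
  - by move=> k; rewrite /= xq.
  - by apply: is_cvg_geometric_series; rewrite ger0_norm.
move=> /normed_cvg /cvg_ex[l dl]; exists (x 0%N + l).
have xE : x = (fun=> x 0%N) \+ series d.
  by apply/funext => k; rewrite /series /= telescope_sumr// addrC subrK.
by rewrite {1}xE; apply: cvgD => //; exact: cvg_cst.
Qed.

Lemma geometric_cvg (z : nat -> R[i]) (c q : R) : 0 <= q -> q < 1 ->
  (forall k, normc (z k.+1 - z k) <= c * q ^+ k) ->
  exists l, forall e, 0 < e -> exists K, forall k, (K <= k)%N -> normc (l - z k) <= e.
Proof.
move=> q0 q1 zq.
have [|lr hr] := @geometric_cvg_real (fun k => complex.Re (z k)) c q q0 q1.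
  move=> k; apply: le_trans (zq k); apply: le_trans (Re_le_normc _).
  by case: (z k) (z k.+1) => ? ? [? ?].
have [|li hi] := @geometric_cvg_real (fun k => complex.Im (z k)) c q q0 q1.
  move=> k; apply: le_trans (zq k); apply: le_trans (Im_le_normc _).
  by case: (z k) (z k.+1) => ? ? [? ?].
exists (lr +i* li)%C => e e0; have e2 : 0 < e / 2 by rewrite divr_gt0.
have /cvgrPdist_le/(_ _ e2)[K1 _ h1] := hr.
have /cvgrPdist_le/(_ _ e2)[K2 _ h2] := hi.
exists (maxn K1 K2) => k; rewrite geq_max => /andP[k1 k2].
apply: le_trans (normc_le_ReIm _) _; have := h1 k k1; have := h2 k k2.
by case: (z k) => s t /=; lra.
Qed.

End normc_theory.

Section l2_theory.
Variables (R : realType) (I : choiceType).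
Implicit Types (u v : I -> R[i]) (s : seq I).

Lemma esum_le (f : I -> R) (C : R) : (forall i, 0 <= f i) ->
  (\esum_(i in [set: I]) (f i)%:E <= C%:E)%E <->
  (forall s, uniq s -> \sum_(i <- s) f i <= C).
Proof.
move=> f0; split => [h s us|h].
  rewrite -lee_fin; apply: le_trans h; apply: esum_ge; exists [set` s].
    by split => //; exact: finite_seq.
  by rewrite -fsbig_seq// sumEFin.
apply: ge_ereal_sup => _ [A [fA _] <-].
by rewrite fsbig_finite// sumEFin lee_fin; apply: h; exact: finmap.fset_uniq.
Qed.

(** For c >= 0 this says that the l2 norm is at most c, in terms of finite sums alone; the estimates
    on l2 are made in this form. *)
Definition l2le u (c : R) := forall s, uniq s -> \sum_(i <- s) normc (u i) ^+ 2 <= c ^+ 2.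

Lemma l2norm_le u (c : R) : 0 <= c -> (l2norm u <= c%:E)%E <-> l2le u c.
Proof.
move=> c0; rewrite /l2le -esum_le; last by move=> i; exact: sqr_ge0.
rewrite /l2norm; set S := (\esum_(i in _) _)%E.
have S0 : (0 <= S)%E by apply: esum_ge0 => i _; rewrite lee_fin sqr_ge0.
rewrite -[X in _ <-> is_true X](@lee_sqrt R S (c ^+ 2)%:E) ?lee_fin ?sqr_ge0//.
by rewrite /= sqrtr_sqr ger0_norm.
Qed.

Lemma l2P u : l2 u <-> exists2 c : R, 0 < c & l2le u c.
Proof.
split => [h|[c c0 h]]; last first.
  by apply: le_lt_trans ((l2norm_le u (ltW c0)).2 h) _; rewrite ltry.
exists (fine (l2norm u) + 1); first by rewrite ltr_wpDl// fine_ge0// sqrte_ge0.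
apply/l2norm_le; first by rewrite addr_ge0// fine_ge0// sqrte_ge0.
by rewrite EFinD fineK ?leeDl// ge0_fin_numE ?sqrte_ge0.
Qed.

Lemma l2le_coord u c i : 0 <= c -> l2le u c -> normc (u i) <= c.
Proof.
move=> c0 /(_ [:: i] isT); rewrite big_seq1 ler_pXn2r ?nnegrE ?normc_ge0//.
Qed.

Lemma l2le_mono u c d : 0 <= c -> c <= d -> l2le u c -> l2le u d.
Proof.
move=> c0 cd h s us; apply: le_trans (h s us) _.
by rewrite lerXn2r ?nnegrE// (le_trans c0).
Qed.

Lemma l2leZ u (c : R) (z : R[i]) : l2le u c -> l2le (fun i => z * u i) (normc z * c).
Proof.
move=> h s us; rewrite exprMn.
under eq_bigr do rewrite ComplexField.Normc.normcM exprMn.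
by rewrite -mulr_sumr ler_wpM2l ?sqr_ge0 ?h.
Qed.

(** Minkowski's inequality: |x + y|^2 is split with the weights d / c and c / d, for which the
    bounds add up to (c + d)^2. They need c, d > 0, which [l2P] provides. *)
Lemma l2leD u v (c d : R) : 0 < c -> 0 < d -> l2le u c -> l2le v d ->
  l2le (fun i => u i + v i) (c + d).
Proof.
move=> c0 d0 hu hv s us.
have pt i : normc (u i + v i) ^+ 2 <= (1 + d / c) * normc (u i) ^+ 2 + (1 + c / d) * normc (v i) ^+ 2.
  apply: (@le_trans _ _ ((normc (u i) + normc (v i)) ^+ 2)).
    by rewrite lerXn2r ?nnegrE ?addr_ge0 ?normc_ge0 ?normcD.
  set x := normc (u i); set y := normc (v i).
  have -> : (1 + d / c) * x ^+ 2 + (1 + c / d) * y ^+ 2 =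
     (x + y) ^+ 2 + (d * x - c * y) ^+ 2 / (c * d).
    by field; rewrite !gt_eqF.
  by rewrite lerDl divr_ge0 ?sqr_ge0// mulr_ge0// ltW.
apply: (@le_trans _ _ ((1 + d / c) * c ^+ 2 + (1 + c / d) * d ^+ 2)).
  apply: le_trans (ler_sum _ (fun i _ => pt i)) _; rewrite big_split /= -!mulr_sumr.
  by apply: lerD; apply: ler_wpM2l; rewrite ?hu ?hv// addr_ge0 ?divr_ge0// ltW.
rewrite le_eqVlt; apply/orP; left; apply/eqP.
by field; rewrite !gt_eqF.
Qed.

Lemma l2leN u c : l2le u c -> l2le (fun i => - u i) c.
Proof. by move=> h s us; under eq_bigr do rewrite normcN; exact: h. Qed.

Lemma le_eps (x y C : R) : (forall e, 0 < e -> e <= 1 -> x <= y + e * C) -> x <= y.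
Proof.
move=> h; apply/ler_addgt0Pr => e e0.
pose d := Num.min 1 (e / (1 + `|C|)).
have C0 : 0 < 1 + `|C| by rewrite ltr_wpDr.
have d0 : 0 < d by rewrite lt_min ltr01 divr_gt0.
apply: le_trans (h d d0 _) _; first by rewrite ge_min lexx.
rewrite lerD2l; apply: (@le_trans _ _ (d * (1 + `|C|))).
  by rewrite ler_wpM2l ?(ltW d0)//; have := ler_norm C; lra.
by rewrite -ler_pdivlMr// ge_min lexx orbT.
Qed.

(** Only finitely many coordinates are tested at a time, so a pointwise limit stays in the ball. The
    error term is (x + e)^2 <= x^2 + e (2 c + 1) for 0 <= x <= c and 0 < e <= 1. *)
Lemma l2le_lim (z : nat -> I -> R[i]) u (c : R) : 0 <= c ->
  (forall k, l2le (z k) c) ->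
  (forall i e, 0 < e -> exists K, forall k, (K <= k)%N -> normc (u i - z k i) <= e) ->
  l2le u c.
Proof.
move=> c0 zc zu s us.
apply: (@le_eps _ _ (\sum_(i <- s) (2 * c + 1))) => e e0 e1.
have [k hk] : exists k, forall i, i \in s -> normc (u i - z k i) <= e.
  have [K hK] : exists K, forall i, i \in s -> forall k, (K <= k)%N -> normc (u i - z k i) <= e.
    elim: (s) => [|i t [K hK]]; first by exists 0%N.
    have [K' hK'] := zu i e e0; exists (maxn K K') => j; rewrite inE => /predU1P[->|jt] k.
      by rewrite geq_max => /andP[_]; exact: hK'.
    by rewrite geq_max => /andP[+ _]; exact: hK.
  by exists K => i /hK; apply.
apply: (@le_trans _ _ (\sum_(i <- s) (normc (z k i) ^+ 2 + e * (2 * c + 1)))).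
  rewrite big_seq [leRHS]big_seq; apply: ler_sum => i /hk h.
  have zi := l2le_coord i c0 (zc k).
  have : normc (u i) <= normc (z k i) + e.
    by have := normcD (u i - z k i) (z k i); rewrite subrK; lra.
  move=> h2; apply: (@le_trans _ _ ((normc (z k i) + e) ^+ 2)).
    by rewrite lerXn2r ?nnegrE ?normc_ge0 ?addr_ge0 ?normc_ge0 ?(ltW e0).
  have n0 := normc_ge0 (z k i).
  have : e * normc (z k i) <= e * c by rewrite ler_pM2l.
  have : e * e <= e * 1 by rewrite ler_pM2l.
  by rewrite sqrrD expr2; lra.
by rewrite big_split /= -mulr_sumr; apply: lerD => //; exact: zc.
Qed.

(** Convergence along the finite sets of indices ordered by inclusion. Such limits are unique and
    linear, which is not evident for [csum], made of positive and negative parts. *)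
Definition has_csum (f : I -> R[i]) (z : R[i]) := forall e : R, 0 < e ->
  exists2 s0, uniq s0 & forall s, uniq s -> {subset s0 <= s} ->
    normc (z - \sum_(i <- s) f i) <= e.

Definition abs_summable (f : I -> R[i]) := exists C : R, forall s, uniq s ->
  \sum_(i <- s) normc (f i) <= C.

Lemma has_rsum (f : I -> R) (C : R) : (forall s, uniq s -> \sum_(i <- s) `|f i| <= C) ->
  forall e : R, 0 < e -> exists2 s0, uniq s0 & forall s, uniq s -> {subset s0 <= s} ->
    `|rsum setT f - \sum_(i <- s) f i| <= e.
Proof.
move=> fC.
have pos (g : I -> R) : (forall i, 0 <= g i <= `|f i|) ->
  forall e : R, 0 < e -> exists2 s0, uniq s0 & forall s, uniq s -> {subset s0 <= s} ->
    `|fine (\esum_(i in [set: I]) (g i)%:E) - \sum_(i <- s) g i| <= e.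
  move=> gf e e0.
  have g0 i : 0 <= g i by case/andP: (gf i).
  have Ele : (\esum_(i in [set: I]) (g i)%:E <= C%:E)%E.
    apply/esum_le => // s us; apply: le_trans (fC s us); apply: ler_sum => i _.
    by case/andP: (gf i).
  set E := (\esum_(i in _) _)%E in Ele *.
  have E0 : (0 <= E)%E by apply: esum_ge0 => i _; rewrite lee_fin.
  have Efin : E \is a fin_num by rewrite ge0_fin_numE// (le_lt_trans Ele)// ltry.
  have EE : E = (fine E)%:E by rewrite fineK.
  have [s0 us0 hs0] : exists2 s0, uniq s0 & fine E - e < \sum_(i <- s0) g i.
    apply: contrapT => h; suff : (E <= (fine E - e)%:E)%E by rewrite EE lee_fin; lra.
    apply/esum_le => // s us; rewrite leNgt; apply/negP => hs; apply: h; by exists s.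
  exists s0 => // s us sub.
  have s_le : \sum_(i <- s) g i <= fine E.
    by move: (lexx E); rewrite {2}EE => /esum_le; apply.
  have : \sum_(i <- s0) g i <= \sum_(i <- s) g i.
    rewrite [leRHS](bigID (fun i => i \in s0)) /= -[X in _ <= X + _]big_filter.
    have ps : perm_eq [seq i <- s | i \in s0] s0.
      apply: uniq_perm => //; first exact: filter_uniq.
      move=> i; rewrite mem_filter; case: (boolP (i \in s0)) => //= is0.
      exact: sub.
    by rewrite (perm_big _ ps) /= lerDl sumr_ge0.
  by rewrite ger0_norm ?subr_ge0//; lra.
move=> e e0; have e2 : 0 < e / 2 by rewrite divr_gt0.
pose fp i := Num.max (f i) 0; pose fn i := Num.max (- f i) 0.
have fpE : (\esum_(i in [set: I]) ((fun j => (f j)%:E)^\+ i) = \esum_(i in [set: I]) (fp i)%:E)%E.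
  by apply: eq_esum => i _; rewrite !unlock /fp EFin_max.
have fnE : (\esum_(i in [set: I]) ((fun j => (f j)%:E)^\- i) = \esum_(i in [set: I]) (fn i)%:E)%E.
  by apply: eq_esum => i _; rewrite !unlock /fn EFin_max.
have [|s1 us1 h1] := pos fp _ _ e2.
  by move=> i; rewrite /fp le_max lexx orbT ge_max ler_norm normr_ge0.
have [|s2 us2 h2] := pos fn _ _ e2.
  by move=> i; rewrite /fn le_max lexx orbT ge_max normr_ge0 andbT ler_normr lexx orbT.
exists (undup (s1 ++ s2)); first exact: undup_uniq.
move=> s us sub.
have k1 := h1 s us; have k2 := h2 s us.
have fE i : f i = fp i - fn i.
  by rewrite /fp /fn; case: (leP (f i) 0) => h; case: (leP (- f i) 0) => h'; lra.
rewrite /rsum fpE fnE; under eq_bigr do rewrite fE; rewrite sumrB.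
have {}k1 : `|fine (\esum_(i in [set: I]) (fp i)%:E) - \sum_(i <- s) fp i| <= e / 2.
  by apply: k1 => i is1; apply: sub; rewrite mem_undup mem_cat is1.
have {}k2 : `|fine (\esum_(i in [set: I]) (fn i)%:E) - \sum_(i <- s) fn i| <= e / 2.
  by apply: k2 => i is2; apply: sub; rewrite mem_undup mem_cat is2 orbT.
move: k1 k2; rewrite !ler_norml => /andP[? ?] /andP[? ?]; apply/andP; lra.
Qed.

Lemma has_csumP (f : I -> R[i]) : abs_summable f -> has_csum f (csum setT f).
Proof.
move=> [C fC] e e0; have e2 : 0 < e / 2 by rewrite divr_gt0.
have [|s1 us1 h1] := @has_rsum (fun i => complex.Re (f i)) C _ _ e2.
  by move=> s us; apply: le_trans (fC s us); apply: ler_sum => i _; exact: Re_le_normc.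
have [|s2 us2 h2] := @has_rsum (fun i => complex.Im (f i)) C _ _ e2.
  by move=> s us; apply: le_trans (fC s us); apply: ler_sum => i _; exact: Im_le_normc.
exists (undup (s1 ++ s2)); first exact: undup_uniq.
move=> s us sub; apply: le_trans (normc_le_ReIm _) _.
have sumC : \sum_(i <- s) f i =
    ((\sum_(i <- s) complex.Re (f i)) +i* (\sum_(i <- s) complex.Im (f i)))%C.
  elim: (s) => [|i r IH]; first by rewrite !big_nil.
  by rewrite !big_cons IH; case: (f i).
rewrite sumC /=.
have -> : e = e / 2 + e / 2 by lra.
apply: lerD.
  by apply: h1 => // i is1; apply: sub; rewrite mem_undup mem_cat is1.
by apply: h2 => // i is2; apply: sub; rewrite mem_undup mem_cat is2 orbT.
Qed.

(** Finitely many rows can be summed approximately over one and the same finite set, so that bounds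
    on finite sections apply. *)
Lemma has_csum_common (J : Type) (r : seq J) (f : J -> I -> R[i]) (z : J -> R[i]) (e : R) :
  0 < e -> (forall j, has_csum (f j) (z j)) ->
  exists2 s, uniq s & forall j, List.In j r -> normc (z j - \sum_(i <- s) f j i) <= e.
Proof.
move=> e0 fz.
suff [s us h] : exists2 s0, uniq s0 & forall s, uniq s -> {subset s0 <= s} ->
   forall j, List.In j r -> normc (z j - \sum_(i <- s) f j i) <= e.
  by exists s => //; exact: h.
elim: r => [|j r [s0 us0 h0]]; first by exists [::].
have [s1 us1 h1] := fz j e e0.
exists (undup (s0 ++ s1)); first exact: undup_uniq.
move=> s us sub k /= [<-|kr].
  by apply: h1 => // i is1; apply: sub; rewrite mem_undup mem_cat is1 orbT.
by apply: h0 => // i is0; apply: sub; rewrite mem_undup mem_cat is0.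
Qed.

Lemma has_csum_unique f z w : has_csum f z -> has_csum f w -> z = w.
Proof.
move=> fz fw; apply/eqP; rewrite -subr_eq0; apply/eqP.
apply: ComplexField.Normc.eq0_normc; apply/eqP; rewrite eq_le normc_ge0 andbT.
apply: (@le_eps _ _ 2) => e e0 _; rewrite add0r.
have [s1 us1 h1] := fz e e0; have [s2 us2 h2] := fw e e0.
pose s := undup (s1 ++ s2); have us : uniq s by exact: undup_uniq.
have k1' : normc (z - \sum_(i <- s) f i) <= e.
  by apply: h1 => // i h; rewrite mem_undup mem_cat h.
have k2' : normc (w - \sum_(i <- s) f i) <= e.
  by apply: h2 => // i h; rewrite mem_undup mem_cat h orbT.
have := normcB (z - \sum_(i <- s) f i) (w - \sum_(i <- s) f i).
by rewrite opprB addrA subrK; lra.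
Qed.

Lemma has_csumZD (f g : I -> R[i]) (z w a : R[i]) : has_csum f z -> has_csum g w ->
  has_csum (fun i => a * f i + g i) (a * z + w).
Proof.
move=> fz gw e e0; have a0 := normc_ge0 a.
pose d := e / (normc a + 1).
have d0 : 0 < d by rewrite divr_gt0// ltr_wpDl.
have [s1 us1 h1] := fz d d0; have [s2 us2 h2] := gw d d0.
exists (undup (s1 ++ s2)); first exact: undup_uniq.
move=> s us sub; rewrite big_split /= -mulr_sumr.
have -> : a * z + w - (a * \sum_(i <- s) f i + \sum_(i <- s) g i) =
  a * (z - \sum_(i <- s) f i) + (w - \sum_(i <- s) g i) by ring.
apply: le_trans (normcD _ _) _; rewrite ComplexField.Normc.normcM.
have -> : e = normc a * d + d.
  by rewrite /d; field; rewrite gt_eqF// ltr_wpDl.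
apply: lerD; first apply: ler_wpM2l => //.
  by apply: h1 => // i h; apply: sub; rewrite mem_undup mem_cat h.
by apply: h2 => // i h; apply: sub; rewrite mem_undup mem_cat h orbT.
Qed.

End l2_theory.

(** * Matrices with uniformly bounded finite sections *)

Section matrix_operator.
Variables (R : realType) (I : choiceType) (t : I -> I -> R[i]) (b : R).
Hypothesis b0 : 0 < b.
Hypothesis tb : forall (F G : seq I) (u : I -> R[i]), uniq F -> uniq G ->
  \sum_(m <- F) normc (\sum_(k <- G) t m k * u k) ^+ 2 <=
  b ^+ 2 * \sum_(k <- G) normc (u k) ^+ 2.
Implicit Types (u v F : I -> R[i]).
Local Notation T := (matrix_op t).

(** The section with the single row m, applied to the conjugate of that row, gives tau^2 <= b^2
    tau. *)
Lemma matrix_row_sqr_le m (G : seq I) : uniq G ->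
  \sum_(k <- G) normc (t m k) ^+ 2 <= b ^+ 2.
Proof.
move=> uG; set tau := \sum_(k <- G) _.
have tau0 : 0 <= tau by apply: sumr_ge0 => k _; exact: sqr_ge0.
have := @tb [:: m] G (fun k => (t m k)^*%C) isT uG; rewrite big_seq1.
have -> : \sum_(k <- G) t m k * (t m k)^*%C = (tau%:C)%C.
  rewrite /tau rmorph_sum; apply: eq_bigr => k _; rewrite sqr_normc.
  case: (t m k) => x y /=; apply/eqP; rewrite eq_complex /=.
  by apply/andP; split; apply/eqP; ring.
rewrite normc_real ger0_norm//.
have -> : \sum_(k <- G) normc ((t m k)^*%C) ^+ 2 = tau.
  by apply: eq_bigr => k _; case: (t m k) => x y /=; rewrite sqrrN.
have [->|tau_n0] := eqVneq tau 0; first by move=> _; rewrite sqr_ge0.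
by rewrite expr2 ler_pM2r// lt0r tau_n0.
Qed.

Lemma row_summable u c m : l2le u c -> abs_summable (fun k => t m k * u k).
Proof.
move=> uc; exists (b ^+ 2 + c ^+ 2) => s us.
apply: (@le_trans _ _ (\sum_(k <- s) (normc (t m k) ^+ 2 + normc (u k) ^+ 2))).
  apply: ler_sum => k _; rewrite ComplexField.Normc.normcM.
  have := sqr_ge0 (normc (t m k) - normc (u k)).
  have := normc_ge0 (t m k); have := normc_ge0 (u k); nra.
by rewrite big_split /= lerD ?matrix_row_sqr_le ?uc.
Qed.

Lemma matrix_op_has_csum u c m : l2le u c -> has_csum (fun k => t m k * u k) (T u m).
Proof. by move=> uc; apply: has_csumP; exact: row_summable uc. Qed.

(** On finitely many rows, T u is within e of a finite section applied to u, for which the bound is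
    the hypothesis [tb]. *)
Lemma matrix_op_bound u c : 0 <= c -> l2le u c -> l2le (T u) (b * c).
Proof.
move=> c0 uc s us; pose B := b * c.
have B0 : 0 <= B by rewrite mulr_ge0// ltW.
apply: (@le_eps _ _ _ (\sum_(m <- s) (2 * B + 1))) => e e0 e1.
have [G uG hG] := @has_csum_common _ _ _ s (fun m k => t m k * u k) (T u) e e0
  (fun m => matrix_op_has_csum m uc).
have inL m (r : seq I) : m \in r -> List.In m r.
  by elim: r => // x r IH; rewrite inE => /predU1P[->|/IH]; [left|right].
pose y m := \sum_(k <- G) t m k * u k.
have yB : l2le y B.
  move=> r ur; apply: le_trans (tb u ur uG) _; rewrite /B exprMn.
  by rewrite ler_wpM2l ?sqr_ge0 ?uc.
apply: (@le_trans _ _ (\sum_(m <- s) (normc (y m) ^+ 2 + e * (2 * B + 1)))).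
  rewrite big_seq [leRHS]big_seq; apply: ler_sum => m /inL /hG h.
  have ym := l2le_coord m B0 yB.
  have : normc (T u m) <= normc (y m) + e.
    by have := normcD (T u m - y m) (y m); rewrite subrK; move: h; rewrite -/(y m); lra.
  move=> h2; apply: (@le_trans _ _ ((normc (y m) + e) ^+ 2)).
    by rewrite lerXn2r ?nnegrE ?normc_ge0 ?addr_ge0 ?normc_ge0 ?(ltW e0).
  have n0 := normc_ge0 (y m).
  have : e * normc (y m) <= e * B by rewrite ler_pM2l.
  have : e * e <= e * 1 by rewrite ler_pM2l.
  by rewrite sqrrD expr2; lra.
by rewrite big_split /= -mulr_sumr; apply: lerD => //; exact: yB.
Qed.

Lemma matrix_opZD u v (a : R[i]) m : l2 u -> l2 v ->
  T (fun i => a * u i + v i) m = a * T u m + T v m.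
Proof.
move=> /l2P[c c0 uc] /l2P[d d0 vd]; have a0 := normc_ge0 a.
have auc : l2le (fun i => a * u i) (normc a * c + 1).
  by apply: l2le_mono (l2leZ a uc); rewrite ?mulr_ge0 ?(ltW c0)// lerDl.
have ac0 : 0 < normc a * c + 1 by rewrite ltr_wpDl// mulr_ge0// ltW.
have wc := l2leD ac0 d0 auc vd.
apply: has_csum_unique (matrix_op_has_csum m wc) _.
rewrite (_ : (fun k => _) = fun k => a * (t m k * u k) + t m k * v k).
  by apply: has_csumZD; [exact: matrix_op_has_csum uc|exact: matrix_op_has_csum vd].
by apply/funext => k; ring.
Qed.

Variable lambda : R[i].
Hypothesis lb : b < normc lambda.

Let l0 : 0 < normc lambda. Proof. exact: lt_trans lb. Qed.
Let lambda_neq0 : lambda != 0.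
Proof. by apply/eqP => h; move: l0; rewrite h ComplexField.Normc.normc0 ltxx. Qed.

Let q := b / normc lambda.
Let q0 : 0 < q. Proof. exact: divr_gt0. Qed.
Let q1 : q < 1. Proof. by rewrite ltr_pdivrMr// mul1r. Qed.

Lemma l2B u v : l2 u -> l2 v -> l2 (fun i => u i - v i).
Proof.
move=> /l2P[c c0 uc] /l2P[d d0 vd]; apply/l2P; exists (c + d); first exact: addr_gt0.
exact: l2leD (l2leN vd).
Qed.

Lemma matrix_opB u v m : l2 u -> l2 v -> T (fun i => u i - v i) m = T u m - T v m.
Proof.
move=> lu lv; have := matrix_opZD (-1) m lv lu; rewrite mulN1r addrC => <-.
by congr (T _ m); apply/funext => i; rewrite mulN1r addrC.
Qed.

(** The difference w satisfies w = lambda^-1 T w, so its norm is at most q^k c for every k. *)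
Lemma resolvent_unique u v : l2 u -> l2 v ->
  (forall m, lambda * u m - T u m = lambda * v m - T v m) -> u = v.
Proof.
move=> lu lv uv; pose w i := u i - v i.
have /l2P[c c0 wc] := l2B lu lv.
have we m : w m = lambda^-1 * T w m.
  have := uv m; rewrite /w matrix_opB// => h.
  apply: (mulfI lambda_neq0); rewrite mulVKf// mulrBr.
  have -> : lambda * u m = T u m + (lambda * v m - T v m) by rewrite -h; ring.
  ring.
have wk k : l2le w (q ^+ k * c).
  elim: k => [|k IH]; first by rewrite expr0 mul1r.
  have c1 : 0 <= q ^+ k * c by rewrite mulr_ge0 ?exprn_ge0 ?(ltW q0) ?(ltW c0).
  have h := l2leZ lambda^-1 (matrix_op_bound c1 IH).
  have -> : q ^+ k.+1 * c = normc lambda^-1 * (b * (q ^+ k * c)).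
    by rewrite ComplexField.Normc.normcV exprS {1}/q; ring.
  by move=> s us; under eq_bigr do rewrite we; exact: h.
apply/funext => m; apply/eqP; rewrite -subr_eq0 -/(w m); apply/eqP.
apply: ComplexField.Normc.eq0_normc; apply/eqP; rewrite eq_le normc_ge0 andbT.
apply/ler_addgt0Pr => e e0; rewrite add0r.
have : (c * q ^+ k) @[k --> \oo] --> (0 : R).
  by rewrite -[0 in X in _ --> X](mulr0 c); apply: cvgMl_tmp; apply: cvg_expr; rewrite ger0_norm// ltW.
move=> /cvgrPdist_le/(_ e e0)[K _ hK].
have := hK K (leqnn K); rewrite sub0r normrN ger0_norm; last first.
  by rewrite mulr_ge0 ?exprn_ge0 ?(ltW q0) ?(ltW c0).
apply: le_trans; rewrite mulrC; apply: l2le_coord (wk K).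
by rewrite mulr_ge0 ?exprn_ge0 ?(ltW q0) ?(ltW c0).
Qed.

(** The Neumann series as a fixed point iteration. X solves X = (f + b X) / |lambda|, so all
    iterates stay in the ball of radius X, and with them the limit. *)
Lemma resolvent_exists F (f : R) : 0 < f -> l2le F f ->
  exists2 u, l2le u (f / (normc lambda - b)) &
    forall m, lambda * u m - T u m = F m.
Proof.
move=> f0 Ff; set X := f / (normc lambda - b).
have lb0 : 0 < normc lambda - b by rewrite subr_gt0.
have X0 : 0 < X by exact: divr_gt0.
have [z [z0 zS]] : exists z : nat -> I -> R[i], z 0%N = (fun=> 0) /\
    forall k i, z k.+1 i = lambda^-1 * (F i + T (z k) i).
  by exists (fun k => iter k (fun u i => lambda^-1 * (F i + T u i)) (fun=> 0)).
have bX : 0 < b * X by exact: mulr_gt0.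
have zX k : l2le (z k) X.
  elim: k => [|k IH].
    move=> s us; rewrite big1 ?sqr_ge0// => i _.
    by rewrite z0 ComplexField.Normc.normc0 expr0n.
  have h := l2leZ lambda^-1 (l2leD f0 bX Ff (matrix_op_bound (ltW X0) IH)).
  have -> : X = normc lambda^-1 * (f + b * X).
    rewrite ComplexField.Normc.normcV /X; field.
    by rewrite !gt_eqF.
  by move=> s us; under eq_bigr do rewrite zS; exact: h.
have zl2 k : l2 (z k) by apply/l2P; exists X.
pose Y := f / normc lambda.
have Y0 : 0 < Y by exact: divr_gt0.
have dz k : l2le (fun i => z k.+1 i - z k i) (q ^+ k * Y).
  elim: k => [|k IH].
    have -> : (fun i => z 1%N i - z 0%N i) = fun i => lambda^-1 * F i.
      apply/funext => i; rewrite zS z0 subr0.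
      have -> : T (fun=> 0) i = 0; last by rewrite addr0.
      have Tz0 := matrix_opB i (zl2 0%N) (zl2 0%N); rewrite subrr in Tz0.
      by rewrite -[RHS]Tz0; congr (T _ i); apply/funext => j; rewrite subrr.
    rewrite expr0 mul1r /Y mulrC -ComplexField.Normc.normcV; exact: l2leZ.
  have -> : (fun i => z k.+2 i - z k.+1 i) =
     fun i => lambda^-1 * T (fun i => z k.+1 i - z k i) i.
    by apply/funext => i; rewrite matrix_opB// !zS; ring.
  have -> : q ^+ k.+1 * Y = normc lambda^-1 * (b * (q ^+ k * Y)).
    by rewrite ComplexField.Normc.normcV exprS {1}/q; ring.
  apply: l2leZ; apply: matrix_op_bound => //.
  by rewrite mulr_ge0 ?exprn_ge0 ?(ltW q0) ?(ltW Y0).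
have qY k : 0 < q ^+ k * Y by rewrite mulr_gt0 ?exprn_gt0.
pose W := Y / (1 - q).
have W0 : 0 < W by rewrite divr_gt0// subr_gt0.
(* A partial geometric sum of the bounds in [dz]. The distance j + 1 rather than j keeps the bound
   positive, as [l2leD] requires. *)
have dzj k j : l2le (fun i => z (k + j.+1)%N i - z k i) (q ^+ k * (1 - q ^+ j.+1) * W).
  elim: j => [|j IH].
    have -> : q ^+ k * (1 - q ^+ 1) * W = q ^+ k * Y.
      by rewrite /W expr1; field; rewrite subr_eq0 gt_eqF.
    by rewrite addn1; exact: dz.
  have p0 : 0 < q ^+ k * (1 - q ^+ j.+1) * W.
    apply: mulr_gt0 => //; apply: mulr_gt0; first exact: exprn_gt0.
    by rewrite subr_gt0 exprn_ilt1// ltW.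
  have -> : q ^+ k * (1 - q ^+ j.+2) * W = q ^+ (k + j.+1) * Y + q ^+ k * (1 - q ^+ j.+1) * W.
    by rewrite /W exprD [q ^+ j.+2]exprS; field; rewrite subr_eq0 gt_eqF.
  rewrite (_ : (fun i => _) = fun i => (z (k + j.+1).+1 i - z (k + j.+1)%N i) +
    (z (k + j.+1)%N i - z k i)); last by apply/funext => i; rewrite addrA subrK addnS.
  exact: l2leD.
have [u hu] : exists u : I -> R[i], forall i e, 0 < e ->
    exists K, forall k, (K <= k)%N -> normc (u i - z k i) <= e.
  have /choice[u hu] : forall i, exists l, forall e, 0 < e ->
      exists K, forall k, (K <= k)%N -> normc (l - z k i) <= e.
    move=> i; apply: (@geometric_cvg _ (fun k => z k i) Y q (ltW q0) q1) => k.
    by rewrite mulrC; exact: l2le_coord (ltW (qY k)) (dz k).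
  by exists u.
have uX : l2le u X by exact: l2le_lim (ltW X0) zX hu.
have ul2 : l2 u by apply/l2P; exists X.
(* The bound on T acts on l2 norms, so convergence is wanted in l2 and not only at each index. *)
have uz k : l2le (fun i => u i - z k i) (q ^+ k * W).
  apply: (@l2le_lim _ _ (fun j i => z (k + j.+1)%N i - z k i)).
  - by rewrite mulr_ge0 ?exprn_ge0 ?(ltW q0) ?(ltW W0).
  - move=> j; apply: l2le_mono (dzj k j).
      apply: mulr_ge0; last exact: ltW.
      apply: mulr_ge0; first by rewrite exprn_ge0// ltW.
      by rewrite subr_ge0 exprn_ile1// ltW.
    rewrite ler_pM2r// ler_piMr ?exprn_ge0 ?(ltW q0)//.
    by rewrite gerBl exprn_ge0// ltW.
  move=> i e e0; have [K hK] := hu i e e0; exists K => j Kj.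
  rewrite opprB addrA subrK; apply: hK.
  exact: leq_trans Kj (leq_trans (leqnSn j) (leq_addl k j.+1)).
exists u => // m; apply/eqP; rewrite -subr_eq0; apply/eqP.
apply: ComplexField.Normc.eq0_normc; apply/eqP; rewrite eq_le normc_ge0 andbT.
apply: (@le_eps _ _ _ (normc lambda + b)) => e e0 _; rewrite add0r.
have [K1 hK1] := hu m e e0.
have : (W * q ^+ k) @[k --> \oo] --> (0 : R).
  by rewrite -[0 in X in _ --> X](mulr0 W); apply: cvgMl_tmp; apply: cvg_expr; rewrite ger0_norm// ltW.
move=> /cvgrPdist_le/(_ e e0)[K2 _ hK2].
pose k := maxn K1 K2.
have k1 : normc (u m - z k.+1 m) <= e by apply: hK1; rewrite leqW// leq_maxl.
have k2 : q ^+ k * W <= e.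
  have := hK2 k (leq_maxr _ _); rewrite sub0r normrN mulrC ger0_norm//.
  by rewrite mulr_ge0 ?exprn_ge0 ?(ltW q0) ?(ltW W0).
have k3 : normc (T u m - T (z k) m) <= b * e.
  rewrite -matrix_opB//.
  have W1 : 0 <= q ^+ k * W by rewrite mulr_ge0 ?exprn_ge0 ?(ltW q0) ?(ltW W0).
  apply: le_trans (l2le_coord m _ (matrix_op_bound W1 (uz k))) _.
    by rewrite mulr_ge0// ltW.
  by rewrite ler_pM2l.
have -> : lambda * u m - T u m - F m =
  lambda * (u m - z k.+1 m) - (T u m - T (z k) m).
  by rewrite zS mulrBr mulVKf//; ring.
apply: le_trans (normcB _ _) _; rewrite ComplexField.Normc.normcM.
have -> : e * (normc lambda + b) = normc lambda * e + b * e by ring.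
by apply: lerD => //; rewrite ler_pM2l.
Qed.

(** Choice selects a solution for each F in l2; the arbitrary values off l2 are seen neither by
    [l2_inverse] nor by [l2_opnorm]. *)
Lemma resolvent : exists S : (I -> R[i]) -> (I -> R[i]),
  l2_inverse (fun u m => lambda * u m - T u m) S /\
  (l2_opnorm S <= ((normc lambda - b)^-1)%:E)%E.
Proof.
have lb0 : 0 < normc lambda - b by rewrite subr_gt0.
have ex F : exists u, l2 F -> l2 u /\ forall m, lambda * u m - T u m = F m.
  have [lF|nF] := pselect (l2 F); last by exists (fun=> 0).
  have /l2P[f f0 Ff] := lF; have [u u1 u2] := resolvent_exists f0 Ff.
  by exists u => _; split => //; apply/l2P; exists (f / (normc lambda - b)) => //; exact: divr_gt0.
have [S SP] := choice ex.
have Tl2 u : l2 u -> l2 (T u).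
  move=> /l2P[c c0 uc]; apply/l2P; exists (b * c); first exact: mulr_gt0.
  exact: matrix_op_bound (ltW c0) uc.
have Zl2 u : l2 u -> l2 (fun i => lambda * u i).
  move=> /l2P[c c0 uc]; apply/l2P; exists (normc lambda * c); first exact: mulr_gt0.
  exact: l2leZ.
have Ll2 u : l2 u -> l2 (fun m => lambda * u m - T u m).
  by move=> lu; apply: l2B; [exact: Zl2|exact: Tl2].
exists S; split; first split.
- move=> u lu; split; first exact: Ll2.
  by have [s1 s2] := SP _ (Ll2 u lu); exact: resolvent_unique.
- by move=> u /SP[s1 s2]; split => //; apply/funext.
apply: ge_ereal_sup => _ [F /= Fle <-].
have F1 : l2le F 1 by exact/l2norm_le.
have [u u1 u2] := resolvent_exists ltr01 F1; rewrite div1r in u1.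
have lF : l2 F by apply/l2P; exists 1.
have lu : l2 u by apply/l2P; exists (normc lambda - b)^-1; rewrite ?invr_gt0.
have [s1 s2] := SP F lF.
have -> : S F = u by apply: resolvent_unique => // m; rewrite s2 u2.
by apply/l2norm_le => //; rewrite invr_ge0 ltW.
Qed.

End matrix_operator.

(** * Discs *)

Section disc.
Local Open Scope convex_scope.
Variable R : realType.

Definition disc (r : R) : set R[i] := [set z | normc z <= r].

Lemma Complex_continuous :
  continuous (fun p : R * R => (p.1 +i* p.2)%C : (R[i])^o).
Proof.
move=> p; apply/cvgrPdist_le => e e0.
have : 0 < complex.Re e /\ e = (complex.Re e)%:C%C.
  move: e0; rewrite ltcE /= => /andP[/eqP i0 ->]; split => //.
  by apply/eqP; rewrite eq_complex /= ?i0 -?i0 !eqxx.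
move=> [d0 ->]; have d2 : 0 < complex.Re e / 2 by rewrite divr_gt0.
exists (ball p.1 (complex.Re e / 2), ball p.2 (complex.Re e / 2)).
  by split; exact: nbhsx_ballx.
move=> q [/= q1 q2]; rewrite lecE /= eqxx /=.
move: q1 q2; rewrite /ball /= => q1 q2.
apply: le_trans (normc_le_ReIm ((p.1 - q.1) +i* (p.2 - q.2))%C) _ => /=; lra.
Qed.

(** The disc is the continuous image of a closed subset of the square of side 2 r in the plane. *)
Lemma compact_disc (r : R) : compact (disc r : set (R[i])^o).
Proof.
pose K := [set p : R * R | p.1 ^+ 2 + p.2 ^+ 2 <= r ^+ 2 /\ 0 <= r].
have [r0|r0] := ltP r 0.
  rewrite (_ : disc r = set0); first exact: compact0.
  apply/seteqP; split => // z; rewrite /disc /= => zr.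
  by have := le_lt_trans (le_trans (normc_ge0 z) zr) r0; rewrite ltxx.
have -> : (disc r : set (R[i])^o) = (fun p : R * R => (p.1 +i* p.2)%C : (R[i])^o) @` K.
  apply/seteqP; split => [z zr|_ [p [pr _] <-]].
    exists (complex.Re z, complex.Im z); last by case: (z).
    by split => //=; rewrite -sqr_normc lerXn2r ?nnegrE ?normc_ge0.
  by rewrite /disc /= -(ler_pXn2r (n := 2)) ?nnegrE ?sqrtr_ge0// sqr_sqrtr// addr_ge0 ?sqr_ge0.
apply: continuous_compact; first exact/continuous_subspaceT/Complex_continuous.
apply: (subclosed_compact _ (compact_setX (@segment_compact R (- r) r) (@segment_compact R (- r) r))).
  rewrite (_ : K = (fun p : R * R => p.1 ^+ 2 + p.2 ^+ 2) @^-1` [set x | x <= r ^+ 2]).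
    apply: preimage_closed; last exact: closed_le.
    move=> p _; apply: cvgD; rewrite expr2; under eq_fun do rewrite expr2.
      by apply: cvgM; exact: cvg_fst.
    by apply: cvgM; exact: cvg_snd.
  by apply/seteqP; split => p /=; [move=> []|].
have le_r (x y : R) : x ^+ 2 + y ^+ 2 <= r ^+ 2 -> - r <= x <= r.
  move=> h; rewrite -ler_norml -(ler_pXn2r (n := 2)) ?nnegrE// real_normK ?num_real//.
  by have := sqr_ge0 y; lra.
move=> [x y] [/= h _]; split; rewrite /= in_itv /=; first exact: le_r h.
by rewrite addrC in h; exact: le_r h.
Qed.

Lemma convex_disc (r : R) : @convex_set R (Rcomplex R) (disc r).
Proof.
move=> x y l; rewrite !inE => xr yr.
have l0 : 0 <= l%:num by [].
have l1 : 0 <= 1 - l%:num by rewrite subr_ge0.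
have -> : (x <| l |> y)%R = ((l%:num)%:C%C * x + (1 - l%:num)%:C%C * y : R[i]).
  rewrite -[(x <| l |> y)%R]/((l%:num)%R *: (x : Rcomplex R) + (1 - l%:num)%R *: (y : Rcomplex R)).
  apply/eqP; rewrite eq_complex; case: x y {xr yr} => [s t] [s' t'] /=.
  by rewrite /= !mul0r !subr0 !addr0 !eqxx.
apply: le_trans (normcD _ _) _; rewrite !ComplexField.Normc.normcM !normc_real !ger0_norm//.
have := ler_wpM2l l0 xr; have := ler_wpM2l l1 yr; lra.
Qed.

(** The distance is attained at (r / |z|) z. *)
Lemma cdist_disc (r : R) (z : R[i]) : 0 < r -> r < normc z -> cdist z (disc r) = normc z - r.
Proof.
move=> r0 rz; have z0 : 0 < normc z by exact: lt_trans rz.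
have lb : lbound [set normc (z - w) | w in disc r] (normc z - r).
  move=> _ [w wr <-]; rewrite lerBlDr; apply: le_trans (lerD (lexx _) wr).
  by have := normcD (z - w) w; rewrite subrK.
apply/eqP; rewrite eq_le; apply/andP; split.
  apply: ge_inf; first by exists (normc z - r).
  exists (((r / normc z)%:C)%C * z).
    rewrite /disc /= ComplexField.Normc.normcM normc_real ger0_norm; last exact: divr_ge0 (ltW r0) (ltW z0).
    by rewrite divfK// gt_eqF.
  have -> : z - ((r / normc z)%:C)%C * z = ((1 - r / normc z)%:C)%C * z.
    by rewrite rmorphB rmorph1 mulrBl mul1r.
  rewrite ComplexField.Normc.normcM normc_real ger0_norm; last first.
    by rewrite subr_ge0 ler_pdivrMr// mul1r ltW.
  by field; rewrite gt_eqF.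
apply: lb_le_inf => //; exists (normc z), 0; last by rewrite subr0.
by rewrite /disc /= expr0n addr0 sqrtr0 ltW.
Qed.

End disc.

(** * The numerical range *)

Section numerical_range_bound.
Variables (R : realType) (n : nat).
Local Notation X := 'rV[R]_n.
Local Notation leb := (lebesgue_row R n).
Variables (p : mpoly.mpoly n R[i]) (a b : 'M[R]_n).
Hypothesis pE : forall x : X,
  mpoly.meval (fun i => (x ord0 i)%:C%C) p = (qform a x +i* qform b x)%C.

Lemma hkernelE x : hkernel p x =
  (qform a x / enorm x ^+ n.+2 +i* (qform b x / enorm x ^+ n.+2))%C.
Proof.
rewrite /hkernel pE addn2.
(* Where the norm vanishes, both sides are 0, as the inverse of 0 is 0. *)
have [->|d0] := eqVneq (enorm x ^+ n.+2) 0.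
  by rewrite rmorph0 invr0 !mulr0; apply/eqP; rewrite eq_complex /= !invr0 !mulr0 eqxx.
apply: (mulIf (_ : (enorm x ^+ n.+2)%:C%C != 0)); first by rewrite fmorph_eq0.
rewrite divfK ?fmorph_eq0//; apply/eqP; rewrite eq_complex /= !mulr0 subr0 add0r.
by rewrite !divfK// !eqxx.
Qed.

Hypotheses (n0 : (0 < n)%N) (ta : \tr a = 0) (tb : \tr b = 0).

Lemma sharp_kernelE (c : 'M[R]_n) e x : e < enorm x ->
  sharp_kernel c e x = qform c x / enorm x ^+ n.+2.
Proof.
move=> ex; rewrite /sharp_kernel /reg_kernel indicE mem_set// mulr1.
by rewrite /cut_enorm max_l// ltW.
Qed.

Lemma sharp_kernel0 (c : 'M[R]_n) e x : ~ (e < enorm x) -> sharp_kernel c e x = 0.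
Proof. by move=> ex; rewrite /sharp_kernel indicE memNset// mulr0. Qed.

Lemma integrable_sharp_convol (c : 'M[R]_n) e (u : X -> R) x : 0 < e ->
  measurable_fun setT u -> (L2sq u < +oo)%E ->
  leb.-integrable setT (EFin \o (fun y => sharp_kernel c e (x - y) * u y)).
Proof.
move=> e0 mu Lu; apply: (le_integrable _ _ _ (integrable_sharp_mul c n0 x e0 mu Lu)) => //.
  apply/measurable_EFinP/measurable_funM => //.
  exact: measurableT_comp (measurable_sharp_kernel c e0) (measurable_subl x).
move=> y _; rewrite /= lee_fin; apply: le_trans (sharp_mul_le c e u x y) _.
exact: ler_norm.
Qed.

(** The domain of integration turns into the indicator inside [sharp_kernel], and the complex
    product splits into four real convolutions, each absolutely convergent. *)
Lemma truncated_integralE (u : X -> R[i]) x e : 0 < e ->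
  measurable_fun setT (@complex.Re R \o u) -> measurable_fun setT (@complex.Im R \o u) ->
  (L2sq (@complex.Re R \o u) < +oo)%E -> (L2sq (@complex.Im R \o u) < +oo)%E ->
  truncated_integral (hkernel p) u x e =
  ((convol (sharp_kernel a e) (@complex.Re R \o u) x - convol (sharp_kernel b e) (@complex.Im R \o u) x) +i*
   (convol (sharp_kernel a e) (@complex.Im R \o u) x + convol (sharp_kernel b e) (@complex.Re R \o u) x))%C.
Proof.
move=> e0 mr mi Lr Li; rewrite /truncated_integral /cintegral.
congr Complex.
  transitivity (\int[leb]_y (sharp_kernel a e (x - y) * (@complex.Re R \o u) y -
      sharp_kernel b e (x - y) * (@complex.Im R \o u) y)); last first.
    exact: RintegralB measurableT (integrable_sharp_convol a x e0 mr Lr)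
      (integrable_sharp_convol b x e0 mi Li).
  rewrite Rintegral_mkcond; apply: eq_Rintegral => y _; rewrite patchE.
  have [ye|ye] := pselect (e < enorm (x - y)).
    rewrite mem_set// hkernelE !sharp_kernelE//=; case: (u y) => s t /=; ring.
  by rewrite memNset// !sharp_kernel0// !mul0r subr0.
transitivity (\int[leb]_y (sharp_kernel a e (x - y) * (@complex.Im R \o u) y +
    sharp_kernel b e (x - y) * (@complex.Re R \o u) y)); last first.
  exact: RintegralD measurableT (integrable_sharp_convol a x e0 mi Li)
    (integrable_sharp_convol b x e0 mr Lr).
rewrite Rintegral_mkcond; apply: eq_Rintegral => y _; rewrite patchE.
have [ye|ye] := pselect (e < enorm (x - y)).
  rewrite mem_set// hkernelE !sharp_kernelE//=; case: (u y) => s t /=; ring.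
by rewrite memNset// !sharp_kernel0// !mul0r addr0.
Qed.

Lemma L2norm_sqr (u : X -> R[i]) : cmeasurable u -> L2norm leb u = 1%E ->
  (L2sq (@complex.Re R \o u) <= 1)%E /\ (L2sq (@complex.Im R \o u) <= 1)%E.
Proof.
move=> [mr mi] u1.
have int1 : (\int[leb]_x (normc (u x) ^+ 2)%:E = 1)%E.
  have := @poweR_Lnorm _ _ _ leb (fun x => (normc (u x))%:E) 2 (lt0r_neq0 (ltr0Sn _ 1)).
  rewrite -/(L2norm leb u) u1 poweR1r => ->; apply: eq_integral => x _.
  by rewrite /= ger0_norm ?normc_ge0//; congr EFin; rewrite powR_mulrn// normc_ge0.
have mn : measurable_fun setT (fun x => normc (u x) ^+ 2).
  under eq_fun do rewrite sqr_normc.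
  by apply: measurable_funD; exact: measurable_funX.
rewrite -int1; split; (apply: ge0_le_integral => //;
  [by move=> x _; rewrite lee_fin sqr_ge0
  |exact/measurable_EFinP/measurable_funX
  |exact/measurable_EFinP
  |move=> x _; rewrite lee_fin sqr_normc /=; rewrite ?lerDl ?lerDr sqr_ge0//]).
Qed.

Lemma Rintegral_le (f g : X -> R) (C : R) : measurable_fun setT f ->
  measurable_fun setT g -> (forall x, `|f x| <= g x) ->
  (\int[leb]_x (g x)%:E <= C%:E)%E -> `|\int[leb]_x f x| <= C.
Proof.
move=> mf mg fg gC.
have h : (`|\int[leb]_x (f x)%:E| <= C%:E)%E.
  apply: le_trans gC; apply: le_trans (le_abse_integral _ _ _) _ => //.
    exact/measurable_EFinP.
  apply: ge0_le_integral => //.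
  - by apply: measurableT_comp => //; exact/measurable_EFinP.
  - exact/measurable_EFinP.
  - by move=> x _; rewrite lee_fin fg.
have ff : (\int[leb]_x (f x)%:E)%E \is a fin_num.
  by rewrite fin_num_abs (le_lt_trans h)// ltry.
by rewrite /Rintegral -lee_fin -fine_abse// fineK// abse_fin_num.
Qed.

(** With E = 2 ([sharp_bound a] + [sharp_bound b]) bounding the squared norms of Re v and Im v, the
    two parts of the inner product are at most 2 + 2 E each. *)
Definition range_bound : R := 2 * (2 + 2 * (2 * (sharp_bound a + sharp_bound b))).

(** Almost everywhere v is the limit of the truncated integrals along e = 1 / (k + 1), so Fatou's
    lemma gives it their uniform L^2 bound. The inner product is then dominated by the integral of
    |u|^2 + |v|^2. *)
Lemma numerical_range_bound z :
  numerical_range leb (singular_integral (hkernel p)) z -> normc z <= range_bound.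
Proof.
move=> [u [v [[mu Lu] [mv Lv] u1 uv ->]]].
have [r1 i1] := L2norm_sqr mu u1; have [mr mi] := mu; have [mvr mvi] := mv.
have fin1 (w : X -> R) : (L2sq w <= 1)%E -> (L2sq w < +oo)%E.
  by move=> h; rewrite (le_lt_trans h)// ltry.
have sb0 (c : 'M[R]_n) : 0 <= sharp_bound c.
  rewrite /sharp_bound mulr_ge0// addr_ge0 ?sqr_ge0// /cz_bound.
  by rewrite addr_ge0// mulr_ge0// sqr_ge0.
pose E := 2 * (sharp_bound a + sharp_bound b).
pose e (k : nat) : R := k.+1%:R^-1.
have e0 k : 0 < e k by rewrite invr_gt0.
have ecvg : e k @[k --> \oo] --> 0^'+.
  move=> A [d /= d0 dA]; have : e k @[k --> \oo] --> (0 : R) by exact: cvg_harmonic.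
  move=> /cvgrPdist_lt/(_ d d0)[K _ hK]; exists K => // k kK; apply: dA => //.
  exact: hK.
have TE x k := @truncated_integralE u x (e k) (e0 k) mr mi (fin1 _ r1) (fin1 _ i1).
have cv x : is_pv (hkernel p) u x (v x) -> forall d : R, 0 < d -> \forall k \near \oo,
    normc (v x - truncated_integral (hkernel p) u x (e k)) <= d.
  move=> h d d0; have {}h : (truncated_integral (hkernel p) u x (e k) : (R[i])^o) @[k --> \oo] --> (v x : (R[i])^o).
    by move: h; rewrite /is_pv => h; exact: (cvg_comp e (truncated_integral (hkernel p) u x) ecvg h).
  have : (0 : R[i]) < (d%:C)%C by rewrite ltcE /= eqxx.
  move=> dC; have /cvgrPdist_le/(_ _ dC) := h.
  by apply: filterS => k; rewrite lecE /= eqxx.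
have convL2 (c : 'M[R]_n) (w : X -> R) k : \tr c = 0 -> measurable_fun setT w ->
    (L2sq w <= 1)%E -> (L2sq (convol (sharp_kernel c (e k)) w) <= (sharp_bound c)%:E)%E.
  move=> tc mw w1; apply: le_trans (sharp_kernel_L2_bound n0 tc (e0 k) mw (fin1 _ w1)) _.
  by rewrite -[leRHS]mule1 lee_wpmul2l// lee_fin.
have mconv (c : 'M[R]_n) (w : X -> R) k : measurable_fun setT w ->
    measurable_fun setT (convol (sharp_kernel c (e k)) w).
  by move=> mw; apply: measurable_convol => //; exact: measurable_sharp_kernel.
have vr : (L2sq (@complex.Re R \o v) <= E%:E)%E.
  apply: (L2sq_fatou (g := fun k x => convol (sharp_kernel a (e k)) (@complex.Re R \o u) x
     + - convol (sharp_kernel b (e k)) (@complex.Im R \o u) x)) => //.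
  - by move=> k; apply: measurable_funD; [exact: mconv|apply: measurable_funN; exact: mconv].
  - apply: filterS uv => x /cv h; apply/cvgrPdist_le => d d0.
    apply: filterS (h d d0) => k; apply: le_trans; rewrite TE.
    by move: (Re_le_normc (v x - truncated_integral (hkernel p) u x (e k))); rewrite TE /=; case: (v x).
  move=> k; apply: le_trans (L2sqD _ _) _; [exact: mconv|by apply: measurable_funN; exact: mconv|].
  rewrite L2sqN /E EFinM lee_wpmul2l ?lee_fin// EFinD leeD// convL2//.
have vi : (L2sq (@complex.Im R \o v) <= E%:E)%E.
  apply: (L2sq_fatou (g := fun k x => convol (sharp_kernel a (e k)) (@complex.Im R \o u) x
     + convol (sharp_kernel b (e k)) (@complex.Re R \o u) x)) => //.
  - by move=> k; apply: measurable_funD; exact: mconv.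
  - apply: filterS uv => x /cv h; apply/cvgrPdist_le => d d0.
    apply: filterS (h d d0) => k; apply: le_trans; rewrite TE.
    by move: (Im_le_normc (v x - truncated_integral (hkernel p) u x (e k))); rewrite TE /=; case: (v x).
  move=> k; apply: le_trans (L2sqD _ _) _; [exact: mconv|exact: mconv|].
  rewrite /E EFinM lee_wpmul2l ?lee_fin// EFinD leeD// convL2//.
pose g (x : X) : R := (complex.Re (u x) ^+ 2 + complex.Im (u x) ^+ 2) +
  (complex.Re (v x) ^+ 2 + complex.Im (v x) ^+ 2).
have mg : measurable_fun setT g by do 2!apply: measurable_funD; exact: measurable_funX.
have gC : (\int[leb]_x (g x)%:E <= (2 + 2 * E)%:E)%E.
  have i4 (w : X -> R) : measurable_fun setT w -> measurable_fun setT (EFin \o (fun x => w x ^+ 2)).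
    by move=> mw; exact/measurable_EFinP/measurable_funX.
  rewrite /g; under eq_integral do rewrite !EFinD.
  rewrite !ge0_integralD//; try (by move=> x _; rewrite ?adde_ge0// lee_fin sqr_ge0);
    try (exact: i4); try (by apply: emeasurable_funD; exact: i4).
  have -> : (2 + 2 * E = (1 + 1) + (E + E))%R by ring.
  by rewrite !EFinD !leeD.
rewrite /range_bound -/E; apply: le_trans (normc_le_ReIm _) _.
have -> : 2 * (2 + 2 * E) = (2 + 2 * E) + (2 + 2 * E) by ring.
have mprod (f1 f2 : X -> R) : measurable_fun setT f1 -> measurable_fun setT f2 ->
  measurable_fun setT (fun x => f1 x * f2 x) by exact: measurable_funM.
apply: lerD => /=; apply: (Rintegral_le _ mg _ gC).
- rewrite (_ : (fun x => _) = fun x => complex.Re (u x) * complex.Re (v x) + complex.Im (u x) * complex.Im (v x)).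
    by apply: measurable_funD; exact: mprod.
  by apply/funext => x; case: (u x) (v x) => [s t] [s' t'] /=; ring.
- move=> x; rewrite /g; case: (u x) (v x) => [s t] [s' t'] /=.
  rewrite ler_norml; have := sqr_ge0 (s - s'); have := sqr_ge0 (s + s').
  have := sqr_ge0 (t - t'); have := sqr_ge0 (t + t').
  have := sqr_ge0 s; have := sqr_ge0 s'; have := sqr_ge0 t; have := sqr_ge0 t'.
  by move=> *; apply/andP; split; nra.
- rewrite (_ : (fun x => _) = fun x => complex.Re (u x) * complex.Im (v x) - complex.Im (u x) * complex.Re (v x)).
    by apply: measurable_funB; exact: mprod.
  by apply/funext => x; case: (u x) (v x) => [s t] [s' t'] /=; ring.
- move=> x; rewrite /g; case: (u x) (v x) => [s t] [s' t'] /=.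
  rewrite ler_norml; have := sqr_ge0 (s - t'); have := sqr_ge0 (s + t').
  have := sqr_ge0 (t - s'); have := sqr_ge0 (t + s').
  have := sqr_ge0 s; have := sqr_ge0 s'; have := sqr_ge0 t; have := sqr_ge0 t'.
  by move=> *; apply/andP; split; nra.
Qed.

End numerical_range_bound.

(** * The discretized operator *)

Lemma sum_Complex (R : realType) (J : Type) (s : seq J) (f g : J -> R) :
  \sum_(i <- s) (f i +i* g i)%C = ((\sum_(i <- s) f i) +i* (\sum_(i <- s) g i))%C.
Proof. by elim: s => [|i s IH]; [rewrite !big_nil|rewrite !big_cons IH]. Qed.

Section discretization.
Variables (R : realType) (n : nat) (a b : 'M[R]_n) (D : set 'rV[int]_n).
Hypotheses (n0 : (0 < n)%N) (ta : \tr a = 0) (tb : \tr b = 0).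

Lemma lattice_bound_ge0 (c : 'M[R]_n) : 0 <= lattice_bound c.
Proof.
have c0 : 0 <= cz_bound c by rewrite addr_ge0// mulr_ge0// sqr_ge0.
by rewrite addr_ge0// mulr_ge0// ?sqr_ge0// !mulr_ge0// exprn_ge0.
Qed.

Lemma lattice_kernel_section (c : 'M[R]_n) (F G : seq D) (w : D -> R) :
  \tr c = 0 -> uniq F -> uniq G ->
  \sum_(m <- F) (\sum_(k <- G) lattice_kernel c (val m - val k) * w k) ^+ 2 <=
  lattice_bound c * \sum_(k <- G) w k ^+ 2.
Proof.
(* Extension by 0 from D to the whole lattice. *)
move=> tc uF uG; pose v z : R := oapp w 0 (insub z).
have vE k : w k = v (val k) by rewrite /v valK.
have := lattice_kernel_bound n0 tc v (F := map val F) (G := map val G).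
rewrite !map_inj_uniq//; try exact: val_inj.
move=> /(_ uF uG); rewrite !big_map => h.
rewrite [X in _ <= _ * X](eq_bigr (fun k => v (val k) ^+ 2)); last by move=> k _; rewrite vE.
apply: le_trans h; rewrite le_eqVlt; apply/orP; left; apply/eqP.
apply: eq_bigr => m _; rewrite big_map; congr (_ ^+ 2).
by apply: eq_bigr => k _; rewrite vE.
Qed.

(** The estimate is obtained with this constant to the first power but used with its square; adding
    1 makes it at most its square. *)
Definition section_bound : R := 2 * (lattice_bound a + lattice_bound b) + 1.

Lemma section_bound_gt0 : 0 < section_bound.
Proof. by rewrite ltr_wpDl// mulr_ge0// addr_ge0// lattice_bound_ge0. Qed.

Lemma complex_lattice_section (F G : seq D) (u : D -> R[i]) : uniq F -> uniq G ->
  \sum_(m <- F) normc (\sum_(k <- G)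
    (lattice_kernel a (val m - val k) +i* lattice_kernel b (val m - val k))%C * u k) ^+ 2 <=
  section_bound ^+ 2 * \sum_(k <- G) normc (u k) ^+ 2.
Proof.
move=> uF uG; pose re k := complex.Re (u k); pose im k := complex.Im (u k).
pose S (c : 'M[R]_n) (w : D -> R) (m : D) := \sum_(k <- G) lattice_kernel c (val m - val k) * w k.
have SE m : \sum_(k <- G)
    (lattice_kernel a (val m - val k) +i* lattice_kernel b (val m - val k))%C * u k =
    ((S a re m - S b im m) +i* (S a im m + S b re m))%C.
  rewrite /S -sumrB -big_split /=.
  rewrite -sum_Complex; apply: eq_bigr => k _.
  by rewrite /re /im; case: (u k).
pose U (w : D -> R) := \sum_(k <- G) w k ^+ 2.
have uE : \sum_(k <- G) normc (u k) ^+ 2 = U re + U im.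
  by rewrite /U -big_split /=; apply: eq_bigr => k _; rewrite sqr_normc.
have h (c : 'M[R]_n) (w : D -> R) : \tr c = 0 ->
    \sum_(m <- F) S c w m ^+ 2 <= lattice_bound c * U w.
  by move=> tc; exact: lattice_kernel_section.
have La := lattice_bound_ge0 a; have Lb := lattice_bound_ge0 b.
have U0 w : 0 <= U w by apply: sumr_ge0 => k _; exact: sqr_ge0.
apply: (@le_trans _ _ (2 * ((\sum_(m <- F) S a re m ^+ 2 + \sum_(m <- F) S b im m ^+ 2)
   + (\sum_(m <- F) S a im m ^+ 2 + \sum_(m <- F) S b re m ^+ 2)))).
  rewrite -!big_split /= mulr_sumr; apply: ler_sum => m _; rewrite SE sqr_normc /=.
  have := sqr_ge0 (S a re m + S b im m); have := sqr_ge0 (S a im m - S b re m); nra.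
apply: (@le_trans _ _ (section_bound * (U re + U im))).
  have := h a re ta; have := h a im ta; have := h b re tb; have := h b im tb.
  have := U0 re; have := U0 im; rewrite /section_bound; nra.
rewrite uE; apply: ler_wpM2r; first by rewrite addr_ge0.
by rewrite expr2 ler_peMl ?(ltW section_bound_gt0)// /section_bound lerDr mulr_ge0// addr_ge0.
Qed.

End discretization.

(** * From the grid to the integer lattice *)

Section grid.
Variables (R : realType) (n : nat).

Lemma enormZ (c : R) (x : 'rV[R]_n) : enorm (c *: x) = `|c| * enorm x.
Proof.
rewrite /enorm -sqrtr_sqr -sqrtrM ?sqr_ge0// mulr_sumr; congr Num.sqrt.
by apply: eq_bigr => i _; rewrite mxE exprMn.
Qed.

Lemma qformZ (a : 'M[R]_n) (c : R) (x : 'rV[R]_n) : qform a (c *: x) = c ^+ 2 * qform a x.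
Proof.
rewrite /qform mulr_sumr; apply: eq_bigr => i _; rewrite mulr_sumr.
by apply: eq_bigr => j _; rewrite !mxE; ring.
Qed.

Lemma lattice_kernel0 (a : 'M[R]_n) : lattice_kernel a 0 = 0.
Proof.
rewrite /lattice_kernel (_ : lattice_point R 0 = 0 *: 0); last first.
  by rewrite scaler0; apply/rowP => i; rewrite !mxE.
by rewrite /reg_kernel qformZ expr0n !mul0r.
Qed.

Lemma lattice_kernelE (a : 'M[R]_n) (k : 'rV[int]_n) :
  lattice_kernel a k = qform a (lattice_point R k) / enorm (lattice_point R k) ^+ n.+2.
Proof.
have [->|/eqP k0] := eqVneq k 0.
  rewrite lattice_kernel0 (_ : lattice_point R 0 = 0 *: 0) ?qformZ ?expr0n ?mul0r//.
  by rewrite scaler0; apply/rowP => i; rewrite !mxE.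
rewrite /lattice_kernel /reg_kernel /cut_enorm max_l//.
have [i ki] : exists i, k ord0 i != 0.
  apply/existsP; apply: contra_notT k0; rewrite negb_exists => /forallP h.
  by apply/rowP => i; rewrite mxE; apply/eqP; have := h i; rewrite negbK.
apply: le_trans (coord_le_enorm _ i); rewrite mxE -intr_norm.
by rewrite ler1z -gtz0_ge1 normr_gt0.
Qed.

(** K is homogeneous of degree -n, so the mesh size cancels, and the origin cancels in the
    difference of two grid points. *)
Lemma hkernel_grid (p : mpoly.mpoly n R[i]) (a b : 'M[R]_n) (c : nat -> 'rV[R]_n)
    (N : nat) (k l : 'rV[int]_n) : (0 < N)%N ->
  (forall x : 'rV[R]_n, mpoly.meval (fun i => (x ord0 i)%:C%C) p = (qform a x +i* qform b x)%C) ->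
  (N%:R ^- n)%:C%C * hkernel p (grid_point c N k - grid_point c N l) =
  (lattice_kernel a (k - l) +i* lattice_kernel b (k - l))%C.
Proof.
move=> N0 pE; rewrite (hkernelE pE) !lattice_kernelE lattice_pointB.
have -> : grid_point c N k - grid_point c N l =
    N%:R^-1 *: (lattice_point R k - lattice_point R l).
  by rewrite /grid_point opprD addrACA subrr add0r scalerBr.
set x := _ - _; rewrite enormZ !qformZ ger0_norm ?invr_ge0//.
have Nn : N%:R != 0 :> R by rewrite pnatr_eq0 -lt0n.
have E (q : R) : N%:R ^- n * (N%:R^-1 ^+ 2 * q / (N%:R^-1 * enorm x) ^+ n.+2) = q / enorm x ^+ n.+2.
  rewrite exprMn invfM -!exprVn invrK.
  have -> : N%:R^-1 ^+ n * (N%:R^-1 ^+ 2 * q * (N%:R ^+ n.+2 * (enorm x)^-1 ^+ n.+2)) =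
    (N%:R^-1 * N%:R) ^+ n.+2 * (q * (enorm x)^-1 ^+ n.+2) :> R.
    by rewrite exprMn !exprS; ring.
  by rewrite mulVf// expr1n mul1r.
by apply/eqP; rewrite eq_complex /= !mul0r addr0 subr0 !E !eqxx.
Qed.

End grid.

Section csum_restriction.
Variables (R : realType) (I : choiceType).

Lemma csum_setC1 (f : I -> R[i]) m : csum (~` [set m]) f =
  csum setT (fun k => if k == m then 0 else f k).
Proof.
have rE (g : I -> R) : rsum (~` [set m]) g = rsum setT (fun k => if k == m then 0 else g k).
  rewrite /rsum; congr (fine _ - fine _); rewrite esum_mkcond;
    apply: eq_esum => k _; rewrite !unlock; case: ifPn => [|/negP].
  - by rewrite inE /= => /eqP/negbTE ->.
  - by rewrite inE /= => /contrapT ->; rewrite eqxx maxxx.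
  - by rewrite inE /= => /eqP/negbTE ->.
  - by rewrite inE /= => /contrapT ->; rewrite eqxx oppr0 maxxx.
by rewrite /csum !rE; congr Complex; congr (rsum _ _); apply/funext => k; case: eqP.
Qed.

Lemma csumZ (f : I -> R[i]) (z : R[i]) : abs_summable f ->
  csum setT (fun k => z * f k) = z * csum setT f.
Proof.
move=> fs; have h0 : abs_summable (fun _ : I => 0 : R[i]).
  by exists 0 => s _; rewrite big1// => i _; rewrite ComplexField.Normc.normc0.
have H := has_csumZD z (has_csumP fs) (has_csumP h0).
have zs : abs_summable (fun k => z * f k).
  have [C fC] := fs; exists (normc z * C) => s us.
  under eq_bigr do rewrite ComplexField.Normc.normcM.
  by rewrite -mulr_sumr ler_wpM2l ?normc_ge0 ?fC.
have c0 : csum setT (fun _ : I => 0 : R[i]) = 0.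
  rewrite /csum; have -> : rsum [set: I] (fun=> 0 : R) = 0; last by [].
  by rewrite /rsum !esum1 ?subrr// => i _; rewrite unlock /= ?oppr0 maxxx.
move: H; rewrite c0 addr0 => H; apply: has_csum_unique H.
rewrite (_ : (fun i => _) = fun k => z * f k); last by apply/funext => k; rewrite addr0.
exact: has_csumP.
Qed.

End csum_restriction.

Lemma sphere_cintegral_trace (R : realType) (n : nat) (p : mpoly.mpoly n R[i])
    (a b : 'M[R]_n) : (0 < n)%N ->
  (forall x : 'rV[R]_n,
    mpoly.meval (fun i => (x ord0 i)%:C%C) p = (qform a x +i* qform b x)%C) ->
  cintegral (@surface_measure R n) [set x | enorm x = 1] (hkernel p) = 0 ->
  \tr a = 0 /\ \tr b = 0.
Proof.
move=> n0 pE /eqP; rewrite eq_complex /= => /andP[/eqP ha /eqP hb].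
split; apply: sphere_integral_trace => //.
- rewrite -[RHS]ha; apply: eq_Rintegral => x; rewrite inE => x1.
  by rewrite (hkernelE pE) /= x1 expr1n divr1.
- rewrite -[RHS]hb; apply: eq_Rintegral => x; rewrite inE => x1.
  by rewrite (hkernelE pE) /= x1 expr1n divr1.
Qed.

Theorem theorem1p6 (R : realType) (d : nat) (Omega : set 'rV[R]_d)
    (a : nat -> 'rV[R]_d) (p : mpoly.mpoly d R[i]) :
  (2 <= d)%N -> open Omega ->
  p \is mpoly.ishomog1 2 (@mpoly.mdeg d) ->
  cintegral (@surface_measure R d) [set x | enorm x = 1]
    (hkernel p) = 0 ->
  exists C : set R[i],
    [/\ compact (C : set (R[i])^o),
        @convex_set R (Rcomplex R) C,
        forall (lambda : R[i]) (N : nat),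
          ~ C lambda -> (0 < N)%N -> grid_index Omega a N !=set0 ->
          (forall F : grid_index Omega a N -> R[i], l2 F ->
             exists! u : grid_index Omega a N -> R[i],
               l2 u /\
               forall m : grid_index Omega a N,
                 lambda * u m
                 - (N%:R ^- d)%:C%C *
                   csum (~` [set m]) (fun n =>
                     hkernel p (grid_point a N (val m)
                                - grid_point a N (val n)) * u n)
                 = F m) /\
          exists S : (grid_index Omega a N -> R[i]) ->
                     (grid_index Omega a N -> R[i]),
            l2_inverse (fun u m =>
              lambda * u m - matrix_op (grid_matrix Omega a (hkernel p) N) u m) S /\
            (l2_opnorm S <= ((cdist lambda C)^-1)%:E)%E
      & numerical_range (lebesgue_row R d) (singular_integral (hkernel p))
          `<=` C].
Proof.
move=> d2 _ ph p0; have d0 : (0 < d)%N by exact: leq_trans d2.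
have [A [B pE]] := homog2_qform ph.
have [tA tB] := sphere_cintegral_trace d0 pE p0.
pose b := section_bound A B; have b0 : 0 < b by exact: section_bound_gt0.
(* One disc serves both claims: its radius dominates the matrices and the numerical range. *)
pose r := Num.max b (range_bound A B).
have br : b <= r by rewrite le_max lexx.
have r0 : 0 < r by exact: lt_le_trans br.
exists (disc r); split; [exact: compact_disc|exact: convex_disc| |]; last first.
  move=> z /(numerical_range_bound pE d0 tA tB) zr.
  by apply: le_trans zr _; rewrite le_max lexx orbT.
move=> lambda N /negP; rewrite -ltNge => lr N0 _.
pose I : choiceType := grid_index Omega a N.
pose t : I -> I -> R[i] := grid_matrix Omega a (hkernel p) N.
have tE (m k : I) : t m k =
    (lattice_kernel A (val m - val k) +i* lattice_kernel B (val m - val k))%C.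
  rewrite /t /grid_matrix; case: eqVneq => [->|_]; last exact: hkernel_grid.
  by rewrite subrr !lattice_kernel0.
have tb (F G : seq I) (u : I -> R[i]) : uniq F -> uniq G ->
    \sum_(m <- F) normc (\sum_(k <- G) t m k * u k) ^+ 2 <=
    r ^+ 2 * \sum_(k <- G) normc (u k) ^+ 2.
  move=> uF uG; apply: (@le_trans _ _ (b ^+ 2 * \sum_(k <- G) normc (u k) ^+ 2)).
    rewrite (eq_bigr (fun m : I => normc (\sum_(k <- G)
      (lattice_kernel A (val m - val k) +i* lattice_kernel B (val m - val k))%C * u k) ^+ 2)).
      exact: complex_lattice_section.
    by move=> m _; congr (normc _ ^+ 2); apply: eq_bigr => k _; rewrite tE.
  apply: ler_wpM2r; first by apply: sumr_ge0 => k _; exact: sqr_ge0.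
  by rewrite lerXn2r ?nnegrE// ltW.
(* In the system the factor N^-d stands outside a sum without diagonal. Absolute summability is
   known for the scaled entries, so the equation is divided by N^-d before [csumZ] is applied. *)
have rowE (u : I -> R[i]) (m : I) : l2 u ->
    (N%:R ^- d)%:C%C * csum (~` [set m]) (fun n =>
      hkernel p (grid_point a N (val m) - grid_point a N (val n)) * u n) =
    matrix_op t u m.
  move=> /l2P[c c0 uc]; rewrite csum_setC1.
  have c1 : (N%:R ^- d)%:C%C != 0 :> R[i].
    by rewrite fmorph_eq0 invr_eq0 expf_eq0 pnatr_eq0 eqn0Ngt N0 andbF.
  apply: (canLR (mulVKf c1)); rewrite -csumZ.
    congr (csum _ _); apply/funext => k; rewrite /t /grid_matrix eq_sym.
    by case: ifP => _; rewrite ?mul0r ?mulr0// -mulrA mulKf.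
  exact: (row_summable tb m uc).
have [S [SI SN]] := resolvent r0 tb lr.
split; last by exists S; split => //; rewrite cdist_disc.
move=> F lF; exists (S F); have [SL LS] := SI; have [lSF LSF] := LS F lF.
split; first by split => // m; rewrite rowE//; exact: (congr1 (fun f => f m) LSF).
move=> v [lv vF]; apply: (resolvent_unique r0 tb lr) => // m.
by rewrite (congr1 (fun f => f m) LSF : _ = F m) -vF rowE.
Qed.
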